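(* Let $T>0$, let $d,e\ge 1$ be integers, let $1\le q<2$ and $q-1<\gamma\le 1$. Let $U\subseteq\mathbb{R}^e$ be open and convex, let $F:U\to\mathcal{K}(\mathbb{R}^{e\times d})$ be locally $\gamma$-Hölder, and set $\Omega=U\times\mathcal{V}^q([0,T]\to\mathbb{R}^d)$. Then for every $\omega=(\xi,x)\in\Omega$ there exist an interval $I(\omega)\subseteq[0,T]$ of the form $[0,T_*(\omega)]$ or $[0,T_*(\omega))$, with $T_*(\omega)>0$, and a local solution $z(\omega)\in\mathcal{V}^q_{\rm loc}(I(\omega)\to U)$ to the Young differential inclusion $\mathrm{d}z_t\in F(z_t)\,\mathrm{d}x_t$, started at $\xi$ and with velocity $v(\omega)\in\mathbf{V}^{q/\gamma+}_{\rm loc}(I(\omega)\to\mathbb{R}^{e\times d})$, with the property that the image $\{z_t(\omega):t\in I(\omega)\}$ is not precompact in $U$ if $I(\omega)\ne[0,T]$. In particular, $z(\omega)$ is a maximal solution. Moreover, these can be chosen in such a way that the maps $T_*$ and $(z,v)\mathbf{1}_{I}$ are measurable on $\Omega$.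
   Context: $\mathbb{R}^{e\times d}$ is the space of real $e\times d$ matrices. For a topological space $Y$, $\mathcal{K}(Y)$ is the set of nonempty compact subsets of $Y$; $\mathcal{K}(\mathbb{R}^{e\times d})$ carries the Hausdorff distance $h$. $F$ is $\gamma$-Hölder on a set $A$ if $\sup_{a\ne b\in A}h(F(a),F(b))/|a-b|^\gamma<\infty$, and locally $\gamma$-Hölder if it is $\gamma$-Hölder on every compact subset of $U$. A subset of $U$ is precompact in $U$ if its closure in $U$ is compact. For a path $x:E\to X$ with $E\subseteq\mathbb{R}$, $X$ a normed space, and $F'\subseteq E$, $V_p(x,F')=\sup\big(\sum_{k=1}^n|x_{\sigma_k}-x_{\sigma_{k-1}}|^p\big)^{1/p}$, the supremum being over all finite sets $\sigma_0<\dots<\sigma_n$ in $F'$; $V_p(x)=V_p(x,E)$. $V^p(E\to X)$ is the set of paths with $V_p(x)<\infty$; $V^p_{\rm loc}$ the set of paths having finite $p$-variation on every compact subset of $E$; $\mathcal{V}^p$ (resp. $\mathcal{V}^p_{\rm loc}$) the subset of continuous paths of $V^p$ (resp. $V^p_{\rm loc}$); $\mathbf{V}^p_{\rm loc}$ the subset of càdlàg (right-continuous with left limits) paths of $V^p_{\rm loc}$; $\mathbf{V}^{r+}_{\rm loc}=\bigcap_{p>r}\mathbf{V}^p_{\rm loc}$. A path taking values in $U$ is regarded as a path in $\mathbb{R}^e$. Young integral: if $x$ is continuous of finite $q$-variation and $v$ has finite $p$-variation with $1/p+1/q>1$ on $[0,t]$, $\int_0^t v_s\,\mathrm{d}x_s$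 is the limit of $\sum_k v_{\sigma_{k-1}}(x_{\sigma_k}-x_{\sigma_{k-1}})$ over subdivisions $0=\sigma_0<\dots<\sigma_n=t$ as the mesh tends to $0$. Solution: for $\xi\in U$ and $x\in\mathcal{V}^q([0,T]\to\mathbb{R}^d)$, a (local) solution started from $\xi$ on an interval $I=[0,T_*]$ or $[0,T_* )$, $T_*\le T$, to $\mathrm{d}z_t\in F(z_t)\,\mathrm{d}x_t$ is a path $z\in\mathcal{V}^q_{\rm loc}(I\to U)$ such that there is $v\in V^p_{\rm loc}(I\to\mathbb{R}^{e\times d})$, for some $p\ge1$ with $1/p+1/q>1$, satisfying for all $t\in I$: $z_t=\xi+\int_0^t v_s\,\mathrm{d}x_s$ and $v_t\in F(z_t)$. One then says $z$ is a solution with velocity $v$. A maximal solution is a solution which cannot be extended to a solution on a bigger interval contained in $[0,T]$. Measurability: subsets of $\mathbb{R}^k$ carry the Borel $\sigma$-algebra; every path space (a subset of $(\mathbb{R}^k)^{[0,T]}$) carries the cylindrical $\sigma$-algebra, i.e. the smallest one making all evaluations $x\mapsto x_t$, $t\in[0,T]$, measurable; $\Omega$ carries the product $\sigma$-algebra. $(z,v)\mathbf{1}_{I}$ denotes the map sending $\omega$ to the path $[0,T]\to\mathbb{R}^e\times\mathbb{R}^{e\times d}$ equal to $(z_t(\omega),v_t(\omega))$ for $t\in I(\omega)$ and to $(0,0)$ otherwise. *)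

(* Defs.v *)
From HB Require Import structures.
From mathcomp Require Import all_boot all_order all_algebra.
From mathcomp Require Import all_classical all_reals all_analysis.
Set Implicit Arguments.
Unset Strict Implicit.
Unset Printing Implicit Defensive.
Import Order.TTheory GRing.Theory Num.Theory.
Import numFieldNormedType.Exports.
Local Open Scope classical_set_scope.
Local Open Scope ring_scope.

(* [R : realType] is the real line.  R^k is ['cV[R]_k] and
   R^(e x d) is ['M[R]_(e, d)], with the library (entrywise maximum) norm;
   every notion below depends on the norm only up to equivalence.

   A path on [E : set R] with values in [X] is a total function [R -> X] of
   which only the values on [E] are relevant: every predicate on paths takes
   [E] as an argument and does not depend on the values outside [E].
   Likewise a set-valued map on [U] is a total function restricted to [U]. *)

Section SetValuedMaps.
Context {R : realType} {X Y : normedModType R}.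

Definition hausdorff_dist (A B : set Y) : \bar R :=
  maxe (ereal_sup [set edist_inf B a | a in A])
       (ereal_sup [set edist_inf A b | b in B]).

Definition holder_on (gamma : R) (A : set X) (F : X -> set Y) : Prop :=
  (ereal_sup [set hausdorff_dist (F ab.1) (F ab.2)
                    * ((`|ab.1 - ab.2| `^ gamma)^-1)%:E
              | ab in [set ab : X * X | [/\ A ab.1, A ab.2 & ab.1 != ab.2]]]
   < +oo)%E.

Definition locally_holder (gamma : R) (U : set X) (F : X -> set Y) : Prop :=
  forall K : set X, compact K -> K `<=` U -> holder_on gamma K F.

Definition precompact_in (U A : set X) : Prop := compact (closure A `&` U).

End SetValuedMaps.

Section PathSpaces.
Context {R : realType} {X : normedModType R}.
Implicit Types (p r : R) (E : set R) (x : R -> X).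

(* The subdivision sigma_0 < ... < sigma_n is the sequence [s] of size n + 1;
   the empty sequence, also allowed, contributes 0 as single points do. *)
Definition pvariation p x E : \bar R :=
  ereal_sup
    [set ((\sum_(k < (size s).-1) `|x s`_k.+1 - x s`_k| `^ p) `^ p^-1)%:E
    | s in [set s : seq R | sorted <%R s /\ [set` s] `<=` E]].

Definition cadlag E x : Prop :=
  forall t, E t -> (x @ within E t^'+ --> x t) /\
                   (exists l : X, x @ within E t^'- --> l).

(* V^p(E -> X) *)
Definition Vp p E : set (R -> X) :=
  [set x | (pvariation p x E < +oo)%E].

(* V^p_loc(E -> X) *)
Definition Vp_loc p E : set (R -> X) :=
  [set x | forall K, compact K -> K `<=` E -> Vp p K x].

(* calligraphic V^p(E -> X) and V^p_loc(E -> X): continuous paths *)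
Definition Vp_cont p E : set (R -> X) :=
  Vp p E `&` [set x | {within E, continuous x}].

Definition Vp_cont_loc p E : set (R -> X) :=
  Vp_loc p E `&` [set x | {within E, continuous x}].

(* bold V^p_loc(E -> X) and V^(r+)_loc(E -> X): cadlag paths *)
Definition Vp_cadlag_loc p E : set (R -> X) :=
  Vp_loc p E `&` [set x | cadlag E x].

Definition Vplus_cadlag_loc r E : set (R -> X) :=
  \bigcap_(p in [set p : R | r < p]) Vp_cadlag_loc p E.

End PathSpaces.

Section YoungIntegral.
Context {R : realType} {e d : nat}.
Implicit Types (v : R -> 'M[R]_(e, d)) (x : R -> 'cV[R]_d).

(* The subdivision a = sigma_0 < ... < sigma_n = b is encoded, as in the
   library predicate [itv_partition], by the sequence of its last n points. *)
Definition mesh (a : R) (s : seq R) : R :=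
  \big[Num.max/0]_(k < size s) (s`_k - (a :: s)`_k).

Definition mesh_to_0 (a b : R) : set_system (seq R) :=
  filter_from [set delta : R | 0 < delta]
    (fun delta => [set s | itv_partition a b s /\ mesh a s < delta]).

Definition young_sum v x (a : R) (s : seq R) : 'cV[R]_e :=
  \sum_(k < size s) v (a :: s)`_k *m (x s`_k - x (a :: s)`_k).

Definition is_young_integral v x (a b : R) (l : 'cV[R]_e) : Prop :=
  young_sum v x a s @[s --> mesh_to_0 a b] --> l.

End YoungIntegral.

Section Solutions.
Context {R : realType} {e d : nat}.
Implicit Types (x : R -> 'cV[R]_d) (z : R -> 'cV[R]_e) (v : R -> 'M[R]_(e, d)).

Definition initial_interval (S : R) (I : set R) : Prop :=
  I = `[0, S]%classic \/ I = `[0, S[%classic.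

Definition solution_with_velocity (T q : R) (U : set 'cV[R]_e)
    (F : 'cV[R]_e -> set 'M[R]_(e, d)) (xi : 'cV[R]_e) x (I : set R) z v :
    Prop :=
  [/\ exists2 S, 0 <= S <= T & initial_interval S I,
      Vp_cont_loc q I z,
      (forall t, I t -> U (z t)),
      (exists p : R, [/\ 1 <= p, 1 < p^-1 + q^-1 & Vp_loc p I v]) &
      (forall t, I t ->
        (exists2 l, is_young_integral v x 0 t l & z t = xi + l) /\
        F (z t) (v t))].

Definition solution T q U F xi x I z : Prop :=
  exists v, solution_with_velocity T q U F xi x I z v.

Definition maximal_solution T q U F xi x I z : Prop :=
  solution T q U F xi x I z /\
  ~ (exists (J : set R) (z' : R -> 'cV[R]_e),
       [/\ I `<` J, solution T q U F xi x J z' & {in I, z' =1 z}]).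

End Solutions.

(* Sigma-algebras are given as set systems relative to a set [D].  The library
   predicate [measurable_fun D f] is not usable here: it presupposes that [D] is
   a measurable subset of the ambient type, which a set of continuous paths is
   not for the cylindrical sigma-algebra. *)
Section Measurability.

Definition borel_on {X : topologicalType} (D : set X) : set_system X :=
  <<s D, preimage_set_system D id [set A : set X | open A] >>.

(* cylindrical sigma-algebra on a set [P] of paths on [E] *)
Definition cylindrical {E0 : Type} {X : topologicalType}
    (E : set E0) (P : set (E0 -> X)) : set_system (E0 -> X) :=
  <<s P, \bigcup_(t in E) preimage_set_system P (fun x => x t)
                            (borel_on [set: X]) >>.

(* product sigma-algebra on [A `*` B] *)
Definition product_sigma {S1 S2 : Type} (A : set S1) (B : set S2)
    (SA : set_system S1) (SB : set_system S2) : set_system (S1 * S2) :=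
  <<s A `*` B, preimage_set_system (A `*` B) fst SA `|`
               preimage_set_system (A `*` B) snd SB >>.

Definition measurable_map {S1 S2 : Type} (D : set S1) (SD : set_system S1)
    (SY : set_system S2) (f : S1 -> S2) : Prop :=
  preimage_set_system D f SY `<=` SD.

Context {R : realType} {e d : nat}.

Definition Omega (T q : R) (U : set 'cV[R]_e) :
    set ('cV[R]_e * (R -> 'cV[R]_d)) :=
  U `*` Vp_cont q `[0, T].

Definition Omega_sigma (T q : R) (U : set 'cV[R]_e) :
    set_system ('cV[R]_e * (R -> 'cV[R]_d)) :=
  product_sigma U (Vp_cont q `[0, T])
    (borel_on U) (cylindrical `[0, T] (Vp_cont q `[0, T])).

End Measurability.

(* Main.v *)
Require Import Defs.
From HB Require Import structures.
From mathcomp Require Import all_boot all_order all_algebra.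
From mathcomp Require Import all_classical all_reals all_analysis.
From mathcomp Require Import measurable_realfun.
From mathcomp Require Import ring lra.
Set Implicit Arguments.
Unset Strict Implicit.
Unset Printing Implicit Defensive.
Import Order.TTheory GRing.Theory Num.Theory.
Import numFieldNormedType.Exports.
Local Open Scope classical_set_scope.
Local Open Scope ring_scope.

(** The driver [x] is first run at the speed of its [q]-variation: with the
    strictly increasing clock [t + V(t)], where [V(t)] is the variation over
    rational subdivisions of [[0, t)], one gets a homeomorphism of [[0, T]] onto
    [[0, 1]] ([unit_clock]) and a path [X] ([slow]), Hölder with exponent
    [al = 1 / q], such that [x] is [X] composed with the clock
    ([slow_holder]). Young integrals are invariant under this change of time
    ([young_time_change]), so that it remains to solve the inclusion driven by [X].

    In general [F] has no continuous selection, and values of [F] chosen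
    independently at successive times need not have finite variation. The
    velocities of the Euler scheme of step [2^-n] are chosen along the dyadic
    tree: at the time [k 2^-n], one takes a value of [F] that is almost nearest to
    the velocity at the [parent] of [k], the left end of the dyadic interval of
    which [k] is the midpoint. Then the velocity at the midpoint of an interval
    of length [l] differs from that at its left end by the order of
    [l ^ (al gamma)]. As [1 < al + al gamma], because [q - 1 < gamma], an
    induction on the size of dyadic intervals ([euler_block]) bounds the
    remainder of the linearized increments by the order of
    [l ^ (al + al gamma)], uniformly in [n] while the scheme remains in a
    compact subset of [U].

    Along a subsequence the schemes converge at all dyadic times. The limit
    values define a position that is Hölder with exponent [al], and a velocity
    that is càdlàg, may jump at dyadic times only, and has finite [p]-variation
    for [p > q / gamma] ([velo_var_sum]); the position is the Young integral of the
    velocity ([young_integral_path]), and the velocity belongs to [F] as the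
    graph of [F] is closed.

    The solution is defined as long as the schemes of the subsequence eventually
    stay in one of the members of a compact exhaustion of [U] ([lifetime]). From a
    point at a given distance from the complement of such a member, all schemes
    stay in the member for an additional time that only depends on the member and
    the distance ([stays_extend]). Hence the lifetime is an interval with a
    positive end, and it is the whole of [[0, T]] if the image of the solution is
    precompact in [U] ([lifetime_not_precompact]). An extension to a bigger
    interval would make the image precompact, so that the solution is maximal
    ([not_precompact_maximal]).

    Finally, all choices are measurable. Velocities are taken among rational
    matrices, the first that is good enough in a fixed enumeration ([sel]); they
    are only almost values of [F], with an error [2^-n]. The subsequence is obtained
    by deciding, one after the other, countably many questions on the schemes
    ([diag]): how each coordinate at each dyadic time compares with each rational
    number, which implies convergence ([decided_cvg]), and whether the scheme stays
    in a member of the exhaustion up to a dyadic time. Suprema over rational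
    subdivisions, first indices and limits of measurable functions being
    measurable, so are the end of the lifetime, the position and the velocity at
    every time. *)

(** * Matrix norms and powers of dyadic steps *)

Section MatrixNorm.
Context {R : realType}.

Lemma mx_norm_entry m n (A : 'M[R]_(m, n)) i j : `|A i j| <= `|A|.
Proof.
rewrite {2}/Num.norm /= mx_normrE.
exact: (le_bigmax _ (fun ij : 'I_m * 'I_n => `|A ij.1 ij.2|) (i, j)).
Qed.

Lemma mx_norm_leP m n (A : 'M[R]_(m, n)) c :
  0 <= c -> (forall i j, `|A i j| <= c) -> `|A| <= c.
Proof.
move=> c0 Ac; rewrite /Num.norm /= mx_normrE.
by apply: bigmax_le => // -[i j] _; apply: Ac.
Qed.

Lemma mx_norm_ltP m n (A : 'M[R]_(m, n)) c :
  0 < c -> (`|A| < c <-> forall i j, `|A i j| < c).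
Proof.
move=> c0; split=> [Ac i j|Ac]; first exact: le_lt_trans (mx_norm_entry A i j) Ac.
rewrite /Num.norm /= mx_normrE.
by apply: bigmax_lt => // -[i j] _; apply: Ac.
Qed.

Lemma norm_mulmx m n p (A : 'M[R]_(m, n)) (B : 'M[R]_(n, p)) :
  `|A *m B| <= n%:R * `|A| * `|B|.
Proof.
apply: mx_norm_leP => [|i j]; first by rewrite !mulr_ge0.
rewrite mxE; apply: le_trans (ler_norm_sum _ _ _) _.
rewrite -mulrA -[n%:R * _]mulrC -[n in n%:R]card_ord -sumr_const mulr_sumr.
rewrite ler_sum // => k _.
by rewrite mulr1 normrM ler_pM// mx_norm_entry.
Qed.

End MatrixNorm.

Section Dyadic.
Context {R : realType}.

Definition dy (n : nat) : R := 2^-1 ^+ n.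

Lemma dy_gt0 n : 0 < dy n. Proof. by rewrite exprn_gt0 ?invr_gt0. Qed.
Lemma dy_ge0 n : 0 <= dy n. Proof. exact/ltW/dy_gt0. Qed.

Lemma dyS n : dy n = 2 * dy n.+1.
Proof. by rewrite /dy exprS mulrA divff ?mul1r. Qed.

Lemma dyM n r : 2 ^+ r * dy (r + n) = dy n.
Proof. by rewrite /dy exprD mulrA -exprMn divff// expr1n mul1r. Qed.

Lemma dy_le m n : (m <= n)%N -> dy n <= dy m.
Proof. by move=> mn; rewrite ler_wiXn2l ?invr_ge0 ?invf_le1 ?ler1n. Qed.

Lemma dy_le1 n : dy n <= 1.
Proof. exact: (@dy_le 0 n). Qed.

Definition block_len (n r : nat) : R := 2 ^+ r * dy n.

Lemma block_lenE n j : (j <= n)%N -> block_len n (n - j) = dy j.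
Proof. by move=> jn; rewrite /block_len -{2}(subnK jn) dyM. Qed.

Lemma powR_dyS a n : 2 `^ a * dy n.+1 `^ a = dy n `^ a.
Proof. by rewrite -powRM ?dy_ge0// -dyS. Qed.

Lemma powR2_gt1 (a : R) : 0 < a -> 1 < 2 `^ a.
Proof.
move=> a0; have : (1:R) `^ a < 2 `^ a by rewrite gt0_ltr_powR ?nnegrE// ltr1n.
by rewrite powR1.
Qed.

Lemma powRVK (x p : R) : 0 <= x -> 0 < p -> (x `^ p^-1) `^ p = x.
Proof. by move=> x0 p0; rewrite -powRrM mulVf ?gt_eqF// powRr1. Qed.

Lemma powRKV (x p : R) : 0 <= x -> 0 < p -> (x `^ p) `^ p^-1 = x.
Proof. by move=> x0 p0; rewrite -powRrM divff ?gt_eqF// powRr1. Qed.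

Lemma dy_cvg0 : dy n @[n --> \oo] --> 0.
Proof. by apply: cvg_expr; rewrite ger0_norm ?invr_ge0// invf_lt1// ltr1n. Qed.

Lemma dy_small e : 0 < e -> exists n, dy n < e.
Proof.
move=> e0; have /cvgrPdist_lt/(_ _ e0)[n _ /(_ n (leqnn n))] := dy_cvg0.
by rewrite sub0r normrN ger0_norm ?dy_ge0// => ?; exists n.
Qed.

Lemma powR_dy_small a c e : 0 < a -> 0 <= c -> 0 < e ->
  exists n0, forall n, (n0 <= n)%N -> c * dy n `^ a <= e.
Proof.
move=> a0 c0 e0; have ec : 0 < e / (c + 1) by rewrite divr_gt0// ltr_wpDl.
have [n0 n0P] := dy_small (e := (e / (c + 1)) `^ a^-1) (powR_gt0 _ ec).
exists n0 => n n0n.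
have dae : dy n `^ a <= e / (c + 1).
  have -> : e / (c + 1) = ((e / (c + 1)) `^ a^-1) `^ a.
    by rewrite powRVK// ltW.
  rewrite ge0_ler_powR ?nnegrE ?dy_ge0 ?powR_ge0 ?ltW//.
  exact: le_lt_trans (dy_le n0n) n0P.
apply: le_trans (_ : (c + 1) * dy n `^ a <= e).
  by rewrite ler_wpM2r ?powR_ge0// ler_wpDr.
by rewrite mulrC -ler_pdivlMr // ltr_wpDl.
Qed.

Lemma powR_dy_small1 a c e : 0 < a -> 0 <= c -> 0 < e ->
  exists n, c * dy n `^ a <= e.
Proof.
by move=> a0 c0 e0; have [n /(_ n (leqnn n))] := powR_dy_small a0 c0 e0; exists n.
Qed.

Lemma powR_le_self (x a : R) : 0 <= x <= 1 -> 0 < a <= 1 -> x <= x `^ a.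
Proof.
move=> /andP[x0 x1] /andP[a0 a1]; have [->|xn0] := eqVneq x 0; first exact: powR_ge0.
by rewrite ger1_powR// lt_neqAle eq_sym xn0 x0 x1.
Qed.

End Dyadic.

(** * Dyadic sewing for Euler schemes *)

Section EulerBlock.
Context {R : realType} {e d : nat}.
Variables (al ga H L C : R).

(** The constants of the estimates on a dyadic block of length [len]:
    [euler_N] for the increment of the scheme over the block, [euler_G] for the
    difference of the velocities at its midpoint and at its left end, [euler_B]
    for the remainder of the linearization at the left end, and [euler_M] for
    the increment from the left end to any point of the block. The constant
    [euler_B] solves the equation [2 B + d H G = B 2 ^ (al + al ga)] that makes
    the induction on the size of the block close. *)
Definition euler_N : R := d%:R * L * H + 1.
Definition euler_G : R := C * euler_N `^ ga + 3.
Definition euler_B : R := d%:R * H * euler_G / (2 `^ (al + al * ga) - 2).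

Definition euler_M : R := euler_N * 2 `^ al / (2 `^ al - 1).

Variables (y : nat -> 'cV[R]_e) (v : nat -> 'M[R]_(e, d)) (x : nat -> 'cV[R]_d).
Variables (K : set 'cV[R]_e) (n : nat) (lam : R).
Let len := @block_len R n.
Let N := euler_N. Let G := euler_G. Let B := euler_B.
Let M := euler_M.
Let be := al * ga.

Hypotheses (al_gt0 : 0 < al) (ga_gt0 : 0 < ga) (be_le1 : be <= 1)
  (th_gt1 : 1 < al + be).
Hypotheses (H_ge0 : 0 <= H) (L_ge0 : 0 <= L) (C_ge0 : 0 <= C).
Hypotheses (lam1 : lam <= 1) (B_lam : B * lam `^ be <= 1).
Hypothesis yS : forall k, y k.+1 = y k + v k *m (x k.+1 - x k).
Hypothesis vL : forall k, K (y k) -> `|v k| <= L.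
Hypothesis v_parent : forall r i, K (y (i.*2 * 2 ^ r)) -> K (y (i.*2.+1 * 2 ^ r)) ->
  `|v (i.*2.+1 * 2 ^ r) - v (i.*2 * 2 ^ r)| <=
  C * `|y (i.*2.+1 * 2 ^ r) - y (i.*2 * 2 ^ r)| `^ ga + 3 * dy n.
Hypothesis xH : forall r i, `|x (i.+1 * 2 ^ r)%N - x (i * 2 ^ r)%N| <= H * len r `^ al.

Lemma len_gt0 r : 0 < len r.
Proof. by rewrite /len /block_len mulr_gt0 ?exprn_gt0 ?dy_gt0. Qed.
Let len_ge0 r : 0 <= len r := ltW (len_gt0 r).
Lemma lenS r : len r.+1 = 2 * len r.
Proof. by rewrite /len /block_len exprS mulrA. Qed.
Let len_leS r : len r <= len r.+1.
Proof. by rewrite lenS ler_peMl// ler1n. Qed.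
Lemma dy_le_len r : dy n <= len r.
Proof. by rewrite /len /block_len ler_peMl ?dy_ge0// exprn_ege1// ler1n. Qed.

Let be_gt0 : 0 < be. Proof. by rewrite mulr_gt0. Qed.
Let th_gt2 : 0 < 2 `^ (al + be) - 2.
Proof.
rewrite subr_gt0 -[ltLHS]powRr1// lt_neqAle; apply/andP; split; last first.
  by rewrite ler_powR ?ler1n// ltW.
have -> : al + be = 1 + (al + be - 1) by lra.
rewrite powRD ?pnatr_eq0 ?implybT// powRr1// -[X in X == _]mulr1.
by rewrite (inj_eq (mulfI _)) ?pnatr_eq0// lt_eqF// powR2_gt1// subr_gt0 th_gt1.
Qed.
Let N_ge0 : 0 <= N. Proof. by rewrite /N /euler_N addr_ge0// !mulr_ge0. Qed.
Let G_ge0 : 0 <= G.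
Proof. by rewrite /G /euler_G addr_ge0// mulr_ge0// powR_ge0. Qed.
Let B_ge0 : 0 <= B.
Proof. by rewrite /B /euler_B divr_ge0 ?(ltW th_gt2)// !mulr_ge0. Qed.

Lemma euler_velocity_step r i :
  K (y (i.*2 * 2 ^ r)) -> K (y (i.*2.+1 * 2 ^ r)) -> len r <= 1 ->
  `|y (i.*2.+1 * 2 ^ r) - y (i.*2 * 2 ^ r)| <= N * len r `^ al ->
  `|v (i.*2.+1 * 2 ^ r) - v (i.*2 * 2 ^ r)| <= G * len r `^ be.
Proof.
move=> Ka Kc len1 yN; apply: le_trans (v_parent Ka Kc) _.
rewrite /G /euler_G [leRHS]mulrDl -mulrA lerD//.
  rewrite ler_wpM2l// /be powRrM -powRM ?powR_ge0//.
  by rewrite ge0_ler_powR ?nnegrE ?(ltW ga_gt0) ?mulr_ge0 ?powR_ge0.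
rewrite ler_pM2l//; apply: le_trans (dy_le_len r) _.
by apply: powR_le_self; rewrite ?len_ge0 ?be_gt0.
Qed.

(** Sewing by induction on the size of the block. If [c] is the midpoint of
    [[a, b]], the remainder over [[a, b]] is the sum of the remainders over
    [[a, c]] and [[c, b]] and of [(v c - v a) *m (x b - x c)]. As [c] is compared
    with [a] when its velocity is chosen, the last term is of the order of
    [len ^ (al + al ga)], and since [2 < 2 ^ (al + al ga)] the constant of the
    remainder does not grow. Every midpoint is treated exactly once, at the scale
    of the block of which it is the midpoint: this is why velocities are
    compared along the dyadic tree and not from one step to the next. *)
Lemma euler_block r : len r <= lam -> forall i,
  (forall k, (i * 2 ^ r <= k < i.+1 * 2 ^ r)%N -> K (y k)) ->
  `|y (i.+1 * 2 ^ r)%N - y (i * 2 ^ r)%N| <= N * len r `^ al /\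
  `|y (i.+1 * 2 ^ r)%N - y (i * 2 ^ r)%N
     - v (i * 2 ^ r)%N *m (x (i.+1 * 2 ^ r)%N - x (i * 2 ^ r)%N)|
   <= B * len r `^ (al + be).
Proof.
have yN_of_R r' i' : len r' <= lam -> K (y (i' * 2 ^ r')%N) ->
    `|y (i'.+1 * 2 ^ r')%N - y (i' * 2 ^ r')%N
       - v (i' * 2 ^ r')%N *m (x (i'.+1 * 2 ^ r')%N - x (i' * 2 ^ r')%N)|
    <= B * len r' `^ (al + be) ->
    `|y (i'.+1 * 2 ^ r')%N - y (i' * 2 ^ r')%N| <= N * len r' `^ al.
  set u := y (_.+1 * _)%N - _; set w := _ *m _ => lenlam Ki uw.
  have -> : u = (u - w) + w by rewrite subrK.
  apply: le_trans (ler_normD _ _) _.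
  apply: le_trans (lerD uw (norm_mulmx _ _)) _.
  rewrite /N /euler_N mulrDl mul1r addrC lerD//.
    by rewrite -!mulrA ler_wpM2l// ler_pM ?vL.
  rewrite powRD ?(gt_eqF (len_gt0 _)) ?implybT// [leLHS]mulrCA ler_piMr ?powR_ge0//.
  apply: le_trans B_lam; rewrite ler_wpM2l// ge0_ler_powR ?nnegrE ?(ltW be_gt0)//.
  exact: le_trans lenlam.
elim: r => [|r IH] lenlam i Ki.
  rewrite !expn0 !muln1 in Ki *; have Ki' : K (y i) by apply: Ki; rewrite leqnn ltnSn.
  have R0 : `|y i.+1 - y i - v i *m (x i.+1 - x i)| <= B * len 0 `^ (al + be).
    by rewrite yS [y i + _]addrC addrK subrr normr0 mulr_ge0// powR_ge0.
  split=> //; have := @yN_of_R 0%N i lenlam.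
  by rewrite expn0 !muln1; apply.
have lenlam' : len r <= lam by apply: le_trans lenlam.
have len1 : len r <= 1 by apply: le_trans lam1.
have E2 j : (j * 2 ^ r.+1 = j.*2 * 2 ^ r)%N by rewrite expnS mulnA muln2.
have Ki1 k : (i.*2 * 2 ^ r <= k < i.*2.+1 * 2 ^ r)%N -> K (y k).
  move=> /andP[k1 k2]; apply: Ki; rewrite !E2 k1/= (leq_trans k2)//.
  by rewrite leq_mul2r doubleS leqnSn orbT.
have Ki2 k : (i.*2.+1 * 2 ^ r <= k < i.*2.+2 * 2 ^ r)%N -> K (y k).
  move=> /andP[k1 k2]; apply: Ki; rewrite !E2 doubleS k2 andbT (leq_trans _ k1)//.
  by rewrite leq_mul2r leqnSn orbT.
have [N1 R1] := IH lenlam' i.*2 Ki1.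
have [N2 R2] := IH lenlam' i.*2.+1 Ki2.
have p2 : (0 < 2 ^ r)%N by rewrite expn_gt0.
have Ka : K (y (i.*2 * 2 ^ r)%N) by apply: Ki1; rewrite leqnn ltn_mul2r p2 /=.
have Kc : K (y (i.*2.+1 * 2 ^ r)%N) by apply: Ki2; rewrite leqnn ltn_mul2r p2 /=.
have vG := euler_velocity_step Ka Kc len1 N1.
have Rab : `|y (i.+1 * 2 ^ r.+1)%N - y (i * 2 ^ r.+1)%N
     - v (i * 2 ^ r.+1)%N *m (x (i.+1 * 2 ^ r.+1)%N - x (i * 2 ^ r.+1)%N)|
   <= B * len r.+1 `^ (al + be); last first.
  by split=> //; apply: yN_of_R => //; rewrite E2.
rewrite !E2 doubleS.
set a := (i.*2 * 2 ^ r)%N in N1 R1 Ka vG *.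
set c := (i.*2.+1 * 2 ^ r)%N in N1 R1 N2 R2 Kc vG *.
set b := (i.*2.+2 * 2 ^ r)%N in N2 R2 *.
have -> : y b - y a - v a *m (x b - x a) =
    (y c - y a - v a *m (x c - x a)) + (y b - y c - v c *m (x b - x c))
    + (v c - v a) *m (x b - x c).
  rewrite mulmxBl !mulmxBr; set p1 := v a *m x b; set p3 := v a *m x a.
  set p4 := v a *m x c; set p5 := v c *m x b; set p6 := v c *m x c.
  apply/matrixP => k l; rewrite !mxE; ring.
apply: le_trans (ler_normD _ _) _.
apply: le_trans (lerD (ler_normD _ _) (norm_mulmx _ _)) _.
have X1 : d%:R * `|v c - v a| * `|x b - x c| <= d%:R * H * G * len r `^ (al + be).
  rewrite -!mulrA ler_wpM2l// powRD ?(gt_eqF (len_gt0 _)) ?implybT//.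
  apply: (@le_trans _ _ ((G * len r `^ be) * (H * len r `^ al))).
    by rewrite ler_pM// xH.
  by rewrite le_eqVlt; apply/orP; left; apply/eqP; ring.
apply: le_trans (lerD (lerD R1 R2) X1) _.
rewrite lenS powRM// mulrA.
have -> : d%:R * H * G = B * (2 `^ (al + be) - 2).
  by rewrite /B /euler_B divfK// gt_eqF.
rewrite -/be le_eqVlt; apply/orP; left; apply/eqP; ring.
Qed.

Let al_gt1 : 0 < 2 `^ al - 1. Proof. by rewrite subr_gt0 powR2_gt1. Qed.
Let M_geN : N <= M.
Proof. by rewrite /M /euler_M ler_pdivlMr// ler_wpM2l// gerBl. Qed.
Let M_ge0 : 0 <= M. Proof. exact: le_trans M_geN. Qed.

(** A point of a block is reached by half a block, if it lies in the second
    half, and then by a chain in a block of half the size: the bounds form a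
    geometric series of ratio [2 ^ (- al)]. *)
Lemma euler_chain r : len r <= lam -> forall i k,
  (i * 2 ^ r <= k <= i.+1 * 2 ^ r)%N ->
  (forall j, (i * 2 ^ r <= j < k)%N -> K (y j)) ->
  `|y k - y (i * 2 ^ r)%N| <= M * len r `^ al.
Proof.
elim: r => [|r IH] lenlam i k.
  rewrite expn0 !muln1 => /andP[ik kSi] Ky.
  have [->|ik'] := eqVneq k i; first by rewrite subrr normr0 mulr_ge0 ?powR_ge0.
  have -> : k = i.+1 by apply/eqP; rewrite eqn_leq kSi ltn_neqAle eq_sym ik' ik.
  have [|] := @euler_block 0 lenlam i; last first.
    rewrite expn0 !muln1 => h _; apply: le_trans h _.
    by rewrite ler_wpM2r ?powR_ge0.
  move=> j; rewrite expn0 !muln1 ltnS => /andP[j1 j2]; apply: Ky; rewrite j1/=.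
  by rewrite (leq_ltn_trans j2)// ltn_neqAle eq_sym ik' ik.
move=> /andP[k1 k2] Ky.
have lenlam' : len r <= lam by apply: le_trans lenlam.
have E2 j : (j * 2 ^ r.+1 = j.*2 * 2 ^ r)%N by rewrite expnS mulnA muln2.
rewrite !E2 doubleS in k1 k2 Ky *.
have S2 j : (j.+1 * 2 ^ r = j * 2 ^ r + 2 ^ r)%N by rewrite mulSn addnC.
have [kc|ck] := leqP k (i.*2.+1 * 2 ^ r).
  apply: le_trans (_ : _ <= M * len r `^ al) _.
    by apply: IH => //; rewrite k1.
  by rewrite ler_wpM2l// ge0_ler_powR ?nnegrE ?(ltW al_gt0).
have [|N1 _] := @euler_block r lenlam' i.*2.
  move=> j /andP[j1 j2]; apply: Ky; rewrite j1/=.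
  exact: leq_trans j2 (ltnW ck).
have N2 : `|y k - y (i.*2.+1 * 2 ^ r)%N| <= M * len r `^ al.
  apply: IH => //; first by rewrite (ltnW ck).
  move=> j /andP[j1 j2]; apply: Ky; rewrite j2 andbT (leq_trans _ j1)//.
  by rewrite S2 leq_addr.
have -> : y k - y (i.*2 * 2 ^ r)%N = (y k - y (i.*2.+1 * 2 ^ r)%N) +
    (y (i.*2.+1 * 2 ^ r)%N - y (i.*2 * 2 ^ r)%N) by rewrite addrA subrK.
apply: le_trans (ler_normD _ _) _; apply: le_trans (lerD N2 N1) _.
rewrite lenS powRM// mulrA -mulrDl ler_wpM2r ?powR_ge0//.
have : N <= M * (2 `^ al - 1); last by rewrite mulrBr mulr1 lerBrDl.
rewrite /M /euler_M divfK ?gt_eqF// ler_peMr//.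
by rewrite ltW// -subr_gt0.
Qed.

(** By induction on [k]: [euler_chain] bounds the distance from the left end of
    the block as soon as all previous points are in [K]. *)
Lemma euler_stay r : len r <= lam -> forall i,
  (forall u, `|u - y (i * 2 ^ r)%N| <= M * len r `^ al -> K u) ->
  forall k, (i * 2 ^ r <= k <= i.+1 * 2 ^ r)%N -> K (y k).
Proof.
move=> lenlam i Ku; elim/ltn_ind => k IH /andP[k1 k2].
apply/Ku/euler_chain => //; first by rewrite k1.
by move=> j /andP[j1 j2]; apply: IH => //; rewrite j1/= (leq_trans (ltnW j2)).
Qed.

End EulerBlock.

(** * Compact exhaustion of an open set *)

Section NormedNear.
Context {R : realType} {V : normedModType R}.

Lemma near_norm_lt (x : V) eps : 0 < eps -> \forall t \near x, `|x - t| < eps.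
Proof. by move=> e0; apply: cvgr_dist_lt => //; exact: cvg_id. Qed.

Lemma open_norm (U : set V) y : open U -> U y ->
  exists2 r : R, 0 < r & forall w, `|w - y| < r -> U w.
Proof.
move=> oU Uy; have /nbhs_ballP[r /= r0 yrU] : nbhs y U by apply: open_nbhs_nbhs.
exists r => // w wy; apply: yrU; rewrite -ball_normE /= distrC.
exact: wy.
Qed.

Lemma nonexpansive_continuous (W : normedModType R) (f : V -> W) :
  (forall a b, `|f a - f b| <= `|a - b|) -> continuous f.
Proof.
move=> fab a; apply/cvgrPdist_lt => eps e0.
by apply: filterS (near_norm_lt a e0) => b; exact: le_lt_trans.
Qed.

Lemma compact_norm_le (K : set V) : compact K ->
  exists2 c : R, 0 <= c & forall y, K y -> `|y| <= c.
Proof.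
move=> cK; have [c [_ cP]] := compact_bounded cK.
exists (Num.max (c + 1) 0); first by rewrite le_max lexx orbT.
by move=> y /cP h; rewrite le_max h// ltrDl.
Qed.

End NormedNear.

Section CompactColumns.
Context {R : realType}.

Lemma trmx_norm m n (A : 'M[R]_(m, n)) : `|A^T| = `|A|.
Proof.
apply/eqP; rewrite eq_le; apply/andP; split; apply: mx_norm_leP => // i j.
  by rewrite mxE mx_norm_entry.
by have := mx_norm_entry A^T j i; rewrite mxE.
Qed.

Lemma trmx_continuous m n : continuous (trmx : 'M[R]_(m, n) -> 'M[R]_(n, m)).
Proof.
by apply: nonexpansive_continuous => A B; rewrite -linearB /= trmx_norm.
Qed.

Lemma bounded_closed_compact_col n (A : set 'cV[R]_n) c :
  (forall y, A y -> `|y| <= c) -> closed A -> compact A.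
Proof.
move=> Ac cA; have -> : A = (@trmx R 1 n) @` [set v | A v^T].
  apply/seteqP; split=> [y Ay|_ [v Av <-]]; last exact: Av.
  by exists y^T; rewrite /= trmxK.
apply: continuous_compact.
  exact/continuous_subspaceT/trmx_continuous.
apply: bounded_closed_compact.
  exists c; split; first exact: num_real.
  by move=> M cM v /Ac; rewrite trmx_norm => /le_trans; apply; apply: ltW.
by apply: closed_comp => // v _; exact: trmx_continuous.
Qed.

End CompactColumns.

Section Exhaustion.
Context {R : realType} {V : normedModType R}.
Variable U : set V.

(** For open [U], a compact exhaustion. *)
Definition exhaust (m : nat) : set V :=
  [set y | `|y| <= m%:R /\ forall w, `|w - y| < dy m -> U w].

Lemma exhaust_sub m : exhaust m `<=` U.
Proof. by move=> y [_]; apply; rewrite subrr normr0 dy_gt0. Qed.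

Lemma exhaust_closed m : closed (exhaust m).
Proof.
move=> y clKy; split.
  rewrite leNgt; apply/negP => ym; have r0 : 0 < `|y| - m%:R by rewrite subr_gt0.
  have [u [[um _]]] := clKy _ (nbhsx_ballx y _ r0).
  rewrite -ball_normE /= => yu.
  have := ler_normB u (u - y); rewrite opprB addrC subrK => yuu.
  have : `|y| < `|y|; last by rewrite ltxx.
  apply: le_lt_trans yuu _; rewrite distrC -ltrBrDl; apply: lt_le_trans yu _.
  by rewrite lerB.
move=> w wy.
have r0 : 0 < dy m - `|w - y| by rewrite subr_gt0.
have [u [[_ uU]]] := clKy _ (nbhsx_ballx y _ r0).
rewrite -ball_normE /= => yu; apply: uU.
have -> : w - u = (w - y) + (y - u) by rewrite addrA subrK.
by apply: le_lt_trans (ler_normD _ _) _; rewrite -ltrBrDl.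
Qed.

Lemma exhaust_near (C : set V) : open U -> compact C -> C `<=` U ->
  exists m delta, 0 < delta /\ forall y u, C y -> `|u - y| <= delta -> exhaust m u.
Proof.
move=> oU cC CU.
have [r r0 rU] : exists2 r : R, 0 < r & forall y, C y -> forall w, `|w - y| < r -> U w.
  have : \forall r \near 0^'+, C `<=` [set y | forall w, `|w - y| < r -> U w].
    move/compact_near_coveringP : cC; apply => y /CU Uy.
    have [r r0 yrU] := open_norm oU Uy.
    have r20 : 0 < r / 2 by rewrite divr_gt0.
    near=> y' s => w wy'; apply: yrU.
    have -> : w - y = (y' - y) + (w - y') by rewrite [RHS]addrC addrA subrK.
    have y'y : `|y' - y| < r / 2 by rewrite distrC; near: y'; apply: near_norm_lt.
    have sr : s <= r / 2 by near: s; exact: nbhs_right_le.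
    rewrite (splitr r); apply: le_lt_trans (ler_normD _ _) _.
    by rewrite ltrD// (lt_le_trans wy').
  move=> nearr; near (0:R)^'+ => r; exists r; first by near: r; exact: nbhs_right_gt.
  by near: r.
have [c _ c1] := compact_norm_le cC.
have r20 : 0 < r / 2 by rewrite divr_gt0.
have [n0 n0P] := dy_small r20.
pose m := maxn n0 (Num.truncn (c + r / 2)).+1.
exists m, (r / 2); split=> // y u Cy uy; split.
  have -> : u = (u - y) + y by rewrite subrK.
  apply: le_trans (ler_normD _ _) _; apply: le_trans (lerD uy (c1 _ Cy)) _.
  rewrite addrC; apply: le_trans (ltW (truncnS_gt _)) _.
  by rewrite ler_nat leq_maxr.
move=> w wu; apply: (rU y Cy).
have -> : w - y = (w - u) + (u - y) by rewrite addrA subrK.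
rewrite (splitr r); apply: le_lt_trans (ler_normD _ _) _; rewrite ltr_leD//.
apply: lt_le_trans wu _; apply: le_trans (ltW n0P).
by apply: dy_le; rewrite leq_maxl.
Unshelve. all: by end_near. Qed.

End Exhaustion.

Section ExhaustCompact.
Context {R : realType} {e : nat} (U : set 'cV[R]_e).

Lemma exhaust_compact m : compact (exhaust U m).
Proof.
by apply: (@bounded_closed_compact_col _ _ _ m%:R) => [y []//|]; exact: exhaust_closed.
Qed.

End ExhaustCompact.

(** * Hölder set-valued maps and selection of velocities *)

Section First.

(** Equal to [0] when [P] is empty. *)
Definition first (P : nat -> Prop) : nat :=
  if pselect (exists n, `[< P n >]) is left h then ex_minn h else 0%N.

Lemma firstP (P : nat -> Prop) : (exists n, P n) -> P (first P).
Proof.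
move=> [n Pn]; rewrite /first; case: pselect => [h|]; last first.
  by case; exists n; exact/asboolP.
by case: ex_minnP => m /asboolP.
Qed.

Lemma first_le (P : nat -> Prop) n : P n -> (first P <= n)%N.
Proof.
move=> Pn; rewrite /first; case: pselect => // h.
by case: ex_minnP => m _; apply; exact/asboolP.
Qed.

Lemma first_none (P : nat -> Prop) : (forall n, ~ P n) -> first P = 0%N.
Proof. by move=> nP; rewrite /first; case: pselect => // h; have [n /asboolP] := h; move/nP. Qed.

End First.

Section HolderMaps.
Context {R : realType} {X Y : normedModType R}.
Implicit Types (F : X -> set Y) (K : set X).

Lemma hausdorff_dist_lt (A B : set Y) (c : R) f : A f ->
  (hausdorff_dist A B < c%:E)%E -> exists2 g, B g & `|f - g| < c.
Proof.
move=> Af; rewrite /hausdorff_dist gt_max => /andP[supc _].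
have : (edist_inf B f < c%:E)%E.
  by apply: le_lt_trans supc; apply: ereal_sup_ubound; exists f.
move=> /ereal_inf_lt[_ [g Bg <-]].
rewrite /edist => /ereal_inf_lt[_ [r [/= r0 rfg] <-]]; rewrite lte_fin => rc.
exists g => //; apply: lt_trans rc.
by move: rfg; rewrite -ball_normE.
Qed.

(** The form in which the Hölder condition is used. Increasing the constant
    replaces the infimum in the Hausdorff distance by a point. *)
Lemma holder_on_selection gamma F K : holder_on gamma K F ->
  exists2 C : R, 0 <= C & forall a b f, K a -> K b -> F a f ->
    exists2 g, F b g & `|f - g| <= C * `|a - b| `^ gamma.
Proof.
rewrite /holder_on; set S := [set _ | _ in _] => Slt.
have [c c0 Sc] : exists2 c : R, 0 <= c & (ereal_sup S <= c%:E)%E.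
  case: (ereal_sup S) Slt => [r|//|] _; last by exists 0 => //; rewrite leNye.
  by exists (Num.max r 0); rewrite ?lee_fin le_max lexx ?orbT.
exists (c + 1); first by rewrite addr_ge0.
move=> a b f Ka Kb Fa; have [ab|ab] := eqVneq a b.
  by exists f; rewrite -?ab// [f - f]subrr normr0 mulr_ge0 ?addr_ge0 ?powR_ge0.
have rho0 : 0 < `|a - b| `^ gamma by rewrite powR_gt0// normr_gt0 subr_eq0.
have : (hausdorff_dist (F a) (F b) * ((`|a - b| `^ gamma)^-1)%:E <= c%:E)%E.
  by apply: le_trans Sc; apply: ereal_sup_ubound; exists (a, b).
rewrite lee_pdivrMr// -EFinM => hc.
have [||g Fg fg] := @hausdorff_dist_lt (F a) (F b) ((c + 1) * `|a - b| `^ gamma) f.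
- by [].
- by apply: le_lt_trans hc _; rewrite lte_fin ltr_pM2r// ltrDl.
- by exists g => //; exact: ltW.
Qed.

Lemma holder_values_bounded gamma F K y0 : K y0 -> (forall y, K y -> compact (F y)) ->
  compact K -> holder_on gamma K F -> 0 <= gamma ->
  exists2 L, 0 <= L & forall y f, K y -> F y f -> `|f| <= L.
Proof.
move=> K0 cF cK /holder_on_selection[C C0 hC] g0.
have [c c0 cF0] := compact_norm_le (cF _ K0).
have [k k0 kK] := compact_norm_le cK.
exists (C * (k + k) `^ gamma + c).
  by rewrite addr_ge0 ?mulr_ge0 ?powR_ge0.
move=> y f Ky Fy; have [g Fg fg] := hC y y0 f Ky K0 Fy.
have -> : f = (f - g) + g by rewrite subrK.
apply: le_trans (ler_normD _ _) _; rewrite lerD ?cF0//.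
apply: le_trans fg _; rewrite ler_wpM2l// ge0_ler_powR ?nnegrE ?addr_ge0//.
by apply: le_trans (ler_normB _ _) _; rewrite lerD ?kK.
Qed.

Lemma holder_closed_graph gamma F K y v : holder_on gamma K F -> 0 < gamma -> K y ->
  closed (F y) ->
  (forall eps, 0 < eps -> exists y' f, [/\ K y', F y' f, `|y' - y| < eps & `|f - v| < eps]) ->
  F y v.
Proof.
move=> /holder_on_selection[C C0 hC] g0 Ky clF lim; apply: clF => B /nbhs_ballP[r /= r0 rB].
have r20 : 0 < r / 2 by rewrite divr_gt0.
pose eps := Num.min (r / 2) ((r / 2 / (C + 1)) `^ gamma^-1).
have C1 : 0 < C + 1 by rewrite ltr_wpDl.
have eps0 : 0 < eps by rewrite lt_min r20 powR_gt0// divr_gt0.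
have [y' [f [Ky' Ff y'y fv]]] := lim _ eps0.
have [g Fg fg] := hC _ _ _ Ky' Ky Ff.
exists g; split=> //; apply: rB; rewrite -ball_normE /= distrC.
have -> : g - v = (g - f) + (f - v) by rewrite addrA subrK.
rewrite (splitr r); apply: le_lt_trans (ler_normD _ _) _.
rewrite ler_ltD//; last by apply: lt_le_trans fv _; rewrite ge_min lexx.
rewrite distrC; apply: le_trans fg _.
apply: le_trans (_ : (C + 1) * (r / 2 / (C + 1)) <= _); last first.
  by rewrite mulrC divfK// gt_eqF.
rewrite ler_pM ?powR_ge0// ?lerDl//.
have -> : r / 2 / (C + 1) = ((r / 2 / (C + 1)) `^ gamma^-1) `^ gamma.
  by rewrite powRVK// ltW// divr_gt0.
rewrite ge0_ler_powR ?nnegrE ?powR_ge0 ?(ltW g0)//.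
by apply: le_trans (ltW y'y) _; rewrite ge_min lexx orbT.
Qed.

End HolderMaps.

Section RationalMatrices.
Context {R : realType} {m n : nat}.

Definition ratmx (i : nat) : 'M[R]_(m, n) :=
  map_mx ratr (odflt (0 : 'M[rat]_(m, n)) (unpickle i)).

Lemma ratmx_dense (A : 'M[R]_(m, n)) eps : 0 < eps -> exists i, `|A - ratmx i| < eps.
Proof.
move=> e0.
have h i j : exists r : rat, `|A i j - ratr r| < eps.
  have lt : A i j < A i j + eps by rewrite ltrDl.
  have [r] := rat_in_itvoo lt; rewrite in_itv /= => /andP[r1 r2]; exists r.
  by rewrite distrC ger0_norm ?subr_ge0 ?(ltW r1)// ltrBlDl.
pose B : 'M[rat]_(m, n) := \matrix_(i, j) sval (cid (h i j)).
exists (pickle B); apply/mx_norm_ltP => // i j.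
by rewrite /ratmx pickleK /= !mxE; case: cid.
Qed.

End RationalMatrices.

Section Selection.
Context {R : realType} {X : normedModType R} {m n : nat}.
Variables (U : set X) (F : X -> set 'M[R]_(m, n)).
Implicit Types (y : X) (w : 'M[R]_(m, n)).

Definition near_value eps y (i : nat) : Prop :=
  U y /\ exists2 f, F y f & `|f - ratmx i| < eps.

Definition sel_good eps y w i : Prop :=
  near_value eps y i /\
  forall j, near_value eps y j -> `|ratmx i - w : 'M[R]_(m, n)| <= `|ratmx j - w| + eps.

(** An almost nearest point of [F y] to [w]. Rational matrices make it a
    countably valued function of [(y, w)], which is measurable as soon as the
    conditions [sel_good] are. *)
Definition sel eps y w : 'M[R]_(m, n) := ratmx (first (sel_good eps y w)).

Lemma sel_goodP eps y w : 0 < eps -> U y -> F y !=set0 ->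
  sel_good eps y w (first (sel_good eps y w)).
Proof.
move=> e0 Uy [f Ff]; apply: firstP.
pose D := [set `|ratmx j - w : 'M[R]_(m, n)| | j in near_value eps y].
have [j0 fj0] := ratmx_dense f e0.
have D0 : D !=set0 by exists `|ratmx j0 - w|, j0 => //; split=> //; exists f.
have lD : has_inf D by split=> //; exists 0 => _ [j _ <-].
have [_ [i gi <-] ilt] := inf_adherent e0 lD.
exists i; split=> // j gj; apply: le_trans (ltW ilt) _.
by rewrite lerD2r; apply: ge_inf; [exact: lD.2|exists j].
Qed.

Lemma sel_near eps y w : 0 < eps -> U y -> F y !=set0 ->
  exists2 f, F y f & `|f - sel eps y w| < eps.
Proof. by move=> e0 Uy F0; have [[_ [f Ff fi]] _] := sel_goodP w e0 Uy F0; exists f. Qed.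

(** One [eps] comes from near minimality among the rational matrices, the other
    one from the approximation of [f] by one of them. *)
Lemma sel_nearest eps y w f : 0 < eps -> U y -> F y f ->
  `|sel eps y w - w| <= `|f - w| + 2 * eps.
Proof.
move=> e0 Uy Ff; have F0 : F y !=set0 by exists f.
have [_ gi] := sel_goodP w e0 Uy F0; have [j fj] := ratmx_dense f e0.
apply: le_trans (gi j _) _; first by split=> //; exists f.
have -> : ratmx j - w = (ratmx j - f) + (f - w) by rewrite addrA subrK.
apply: le_trans (lerD (ler_normD _ _) (lexx _)) _.
by rewrite distrC in fj; lra.
Qed.

(** The conditions that define [sel] are open in [y], which makes [sel]
    measurable in [y]. *)
Lemma near_value_open gamma eps i : 0 < gamma ->
  (forall y, U y -> exists K, [/\ K `<=` U, holder_on gamma K F & \forall y' \near y, K y']) ->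
  open [set y | near_value eps y i].
Proof.
move=> gamma_gt0 locH; rewrite openE => y [Uy [f Ff fi]]; have [K [KU + nK]] := locH _ Uy.
move=> /holder_on_selection[C C0 hC].
pose r := eps - `|f - ratmx i|; have r0 : 0 < r by rewrite subr_gt0.
have C1 : 0 < C + 1 by rewrite ltr_wpDl.
pose del := (r / (C + 1)) `^ gamma^-1.
have del0 : 0 < del by rewrite powR_gt0// divr_gt0.
have Ky : K y by exact: nbhs_singleton nK.
near=> y'; have Ky' : K y' by near: y'.
split; first exact: KU; have [g Fg fg] := hC _ _ _ Ky Ky' Ff.
exists g => //; have -> : g - ratmx i = (g - f) + (f - ratmx i) by rewrite addrA subrK.
apply: le_lt_trans (ler_normD _ _) _; rewrite -ltrBrDr -/r distrC.
apply: le_lt_trans fg _.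
have rE : r / (C + 1) = del `^ gamma.
  by rewrite /del powRVK// ltW// divr_gt0.
apply: le_lt_trans (_ : _ <= C * (r / (C + 1))) _.
  have yy' : `|y - y'| < del by near: y'; apply: near_norm_lt.
  by rewrite ler_wpM2l// rE ge0_ler_powR ?nnegrE ?(ltW gamma_gt0) ?(ltW del0) ?(ltW yy').
by rewrite mulrA ltr_pdivrMr// mulrC ltr_pM2l// ltrDl.
Unshelve. all: by end_near. Qed.

End Selection.

(** * Limits of decided sequences *)

Section Limits.
Context {R : realType}.

(** Total and measurable extension of the limit of a real sequence. *)
Definition esup_lim (a : nat -> R) : R := fine (limn_esup (fun n => (a n)%:E)).

Lemma esup_limE a l : a n @[n --> \oo] --> l -> esup_lim a = l.
Proof.
move=> al; rewrite /esup_lim.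
have h : (fun n => (a n)%:E) @ \oo --> l%:E by apply/cvg_EFin => //; near=> n.
by have [_ ->] := cvg_limn_einf_sup h.
Unshelve. all: by end_near. Qed.

Lemma mx_cvg m n (A : nat -> 'M[R]_(m, n)) (L : 'M[R]_(m, n)) :
  (forall i j, A k i j @[k --> \oo] --> L i j) -> A k @[k --> \oo] --> L.
Proof.
move=> Aij; apply/cvgrPdist_lt => eps e0.
have : \forall k \near \oo, forall ij : 'I_m * 'I_n, `|L ij.1 ij.2 - A k ij.1 ij.2| < eps.
  apply: filter_forall => -[i j] /=.
  by have /cvgrPdist_lt/(_ _ e0) := Aij i j.
by apply: filterS => k h; apply/mx_norm_ltP => // i j; rewrite !mxE; apply: (h (i, j)).
Qed.

Definition mx_lim m n (A : nat -> 'M[R]_(m, n)) : 'M[R]_(m, n) :=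
  \matrix_(i, j) esup_lim (fun k => A k i j).

Lemma mx_limE m n (A : nat -> 'M[R]_(m, n)) (L : 'M[R]_(m, n)) :
  A k @[k --> \oo] --> L -> mx_lim A = L.
Proof.
move=> AL; apply/matrixP => i j; rewrite mxE; apply: esup_limE.
apply/cvgrPdist_lt => eps e0; move/cvgrPdist_lt : AL => /(_ _ e0).
by apply: filterS => k; move/(mx_norm_ltP _ e0)/(_ i j); rewrite !mxE.
Qed.

Definition decided (S : nat -> Prop) : Prop :=
  (\forall i \near \oo, S i) \/ (\forall i \near \oo, ~ S i).

(** The limit is the cut formed by the rational numbers that are eventually below
    the sequence. Deciding countably many questions thus replaces the extraction
    of a convergent subsequence, in a way that can be made measurable. *)
Lemma decided_cvg (a : nat -> R) (M : R) :
  (forall r : rat, decided (fun i => ratr r < a i)) ->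
  (\forall i \near \oo, `|a i| <= M) -> a i @[i --> \oo] --> esup_lim a.
Proof.
move=> dec bnd.
pose S := [set (ratr r : R) | r in [set r : rat | \forall i \near \oo, ratr r < a i]].
have ubS : ubound S M.
  move=> _ [r /= rP <-]; near \oo => i.
  apply: ltW; apply: (@lt_le_trans _ _ (a i)); first by near: i.
  by apply: le_trans (ler_norm _) _; near: i.
have supS : has_sup S.
  split; last by exists M.
  have lt : - M - 1 < - M by rewrite ltrBlDr ltrDl.
  have [r] := rat_in_itvoo lt; rewrite in_itv /= => /andP[_ r2].
  exists (ratr r), r => //=; apply: filterS bnd => i; rewrite ler_norml => /andP[h _].
  exact: lt_le_trans r2 h.
suff al : a i @[i --> \oo] --> sup S by rewrite (esup_limE al).
apply/cvgrPdist_lt => eps e0.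
have [_ [r /= rP <-] rlt] := sup_adherent e0 supS.
have lt : sup S < sup S + eps by rewrite ltrDl.
have [r'] := rat_in_itvoo lt; rewrite in_itv /= => /andP[r1 r2].
have r'P : \forall i \near \oo, ~ ratr r' < a i.
  have [h|//] := dec r'; have : ratr r' <= sup S; last by rewrite leNgt r1.
  by apply: ub_le_sup; [exact: supS.2|exists r'].
apply: filterS2 rP r'P => i h1 /negP; rewrite -leNgt => h2.
rewrite ltr_distlC; apply/andP; split; first exact: lt_trans h1.
exact: le_lt_trans r2.
Unshelve. all: by end_near. Qed.

End Limits.

(** * Euler schemes along the dyadic tree *)

Section EulerScheme.
Context {R : realType} {e d : nat}.
Variables (s : 'cV[R]_e -> 'M[R]_(e, d) -> 'M[R]_(e, d)) (xi : 'cV[R]_e).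
Variable x : nat -> 'cV[R]_d.

(** Clears the lowest bit of [k]: the left end of the dyadic interval whose
    midpoint is [k]. *)
Definition parent k := (k - 2 ^ logn 2 k)%N.

Lemma parentE r i : parent (i.*2.+1 * 2 ^ r) = (i.*2 * 2 ^ r)%N.
Proof.
have -> : parent (i.*2.+1 * 2 ^ r) = (i.*2.+1 * 2 ^ r - 2 ^ r)%N.
  rewrite /parent lognM ?expn_gt0// pfactorK//.
  by rewrite lognE /= dvdn2 /= odd_double.
by rewrite mulSn addnC addnK.
Qed.

Lemma parent_lt k : (parent k.+1 <= k)%N.
Proof. by rewrite /parent leq_subLR -add1n leq_add2r expn_gt0. Qed.

(** The values of the scheme up to the index [k] are all remembered, since the
    velocity at [k] depends on that at [parent k], which may be far in the
    past. *)
Fixpoint euler_hist k : nat -> 'cV[R]_e * 'M[R]_(e, d) :=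
  if k is k'.+1 then
    let h := euler_hist k' in
    let y := (h k').1 + (h k').2 *m (x k'.+1 - x k') in
    fun j => if j == k'.+1 then (y, s y (h (parent k'.+1)).2) else h j
  else fun=> (xi, s xi 0).

Definition euler k := euler_hist k k.

Lemma euler_histE k j : (j <= k)%N -> euler_hist k j = euler j.
Proof.
elim: k j => [|k IH] j; first by rewrite leqn0 => /eqP ->.
rewrite leq_eqVlt => /orP[/eqP->//|]; rewrite ltnS => jk.
by rewrite /= ltn_eqF// IH.
Qed.

Lemma eulerS k : euler k.+1 =
  let y := (euler k).1 + (euler k).2 *m (x k.+1 - x k) in
  (y, s y (euler (parent k.+1)).2).
Proof. by rewrite {1}/euler /= eqxx !euler_histE// parent_lt. Qed.

Lemma euler_positionS k :
  (euler k.+1).1 = (euler k).1 + (euler k).2 *m (x k.+1 - x k).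
Proof. by rewrite eulerS. Qed.

Lemma euler_velocityS k :
  (euler k.+1).2 = s (euler k.+1).1 (euler (parent k.+1)).2.
Proof. by rewrite eulerS. Qed.

End EulerScheme.

(** * Bounds that do not depend on the level of the scheme *)

Section DyadicIndices.
Context {R : realType}.

(** The index at level [n] of the [k]-th point of level [j]. *)
Definition refine n j k := (k * 2 ^ (n - j))%N.

Lemma refine_pt n j k : (j <= n)%N -> (refine n j k)%:R * dy n = k%:R * dy j :> R.
Proof.
move=> jn; rewrite natrM natrX -mulrA; congr (_ * _).
by rewrite -{2}(subnK jn) dyM.
Qed.

Lemma refine_double n j k : (j < n)%N -> refine n j.+1 k.*2 = refine n j k.
Proof. by move=> jn; rewrite /refine -muln2 -mulnA -expnS -subSn// subSS. Qed.

End DyadicIndices.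

Section SchemeBounds.
Context {R : realType} {e d : nat}.
Variables (U : set 'cV[R]_e) (F : 'cV[R]_e -> set 'M[R]_(e, d)).
Variables (al ga H : R) (X : R -> 'cV[R]_d) (xi : 'cV[R]_e).
Hypotheses (al_gt0 : 0 < al) (ga_gt0 : 0 < ga) (be_le1 : al * ga <= 1)
  (th_gt1 : 1 < al + al * ga) (H_ge0 : 0 <= H).
Hypotheses (F_compact : forall y, U y -> F y !=set0 /\ compact (F y))
  (F_holder : locally_holder ga U F).
Hypothesis X_holder : forall a b, 0 <= a -> a <= b ->
  `|X b - X a| <= H * (b - a) `^ al.
Hypothesis xi_U : U xi.

Definition scheme n := euler (sel U F (dy n)) xi (fun k => X (k%:R * dy n)).
Definition posn n k : 'cV[R]_e := (scheme n k).1.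
Definition velo n k : 'M[R]_(e, d) := (scheme n k).2.

Lemma posn0 n : posn n 0 = xi. Proof. by []. Qed.

(** Estimates for all schemes, as long as they remain in [K], at all scales finer
    than [dy j0]. Neither [j0] nor the constant [c] depends on the level [n]. *)
Record scheme_bounds (K : set 'cV[R]_e) (j0 : nat) (c : R) : Prop := SchemeBounds {
  sb_ge0 : 0 <= c;
  sb_velo : forall n k, K (posn n k) -> `|velo n k| <= c;
  sb_block : forall n j i, (j0 <= j <= n)%N ->
    (forall k, (refine n j i <= k < refine n j i.+1)%N -> K (posn n k)) ->
    `|posn n (refine n j i.+1) - posn n (refine n j i)| <= c * dy j `^ al;
  sb_rem : forall n j i, (j0 <= j <= n)%N ->
    (forall k, (refine n j i <= k < refine n j i.+1)%N -> K (posn n k)) ->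
    `|posn n (refine n j i.+1) - posn n (refine n j i) -
      velo n (refine n j i) *m (X (i.+1%:R * dy j) - X (i%:R * dy j))|
    <= c * dy j `^ (al + al * ga);
  sb_mid : forall n j i, (j0 <= j <= n)%N ->
    (forall k, (refine n j i.*2 <= k <= refine n j i.*2.+1)%N -> K (posn n k)) ->
    `|velo n (refine n j i.*2.+1) - velo n (refine n j i.*2)| <= c * dy j `^ (al * ga);
  sb_stay : forall n j i, (j0 <= j <= n)%N ->
    (forall u, `|u - posn n (refine n j i)| <= c * dy j `^ al -> K u) ->
    forall k, (refine n j i <= k <= refine n j i.+1)%N -> K (posn n k) }.

Lemma velo_near n k : U (posn n k) ->
  exists2 f, F (posn n k) f & `|f - velo n k| < dy n.
Proof.
rewrite /posn /velo /scheme; case: k => [|k] Uy.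
  by apply: sel_near => //; [exact: dy_gt0|exact: (F_compact xi_U).1].
by rewrite euler_velocityS; apply: sel_near => //; [exact: dy_gt0|exact: (F_compact Uy).1].
Qed.

(** The velocity at the parent is within [dy n] of a value of [F], which the
    Hölder condition moves to a value at the child; the velocity at the child
    is almost as close to the velocity at the parent as that value is. *)
Lemma velo_parent C K n r i : K `<=` U -> 0 <= C ->
  (forall a b f, K a -> K b -> F a f ->
    exists2 g, F b g & `|f - g| <= C * `|a - b| `^ ga) ->
  K (posn n (i.*2 * 2 ^ r)) -> K (posn n (i.*2.+1 * 2 ^ r)) ->
  `|velo n (i.*2.+1 * 2 ^ r) - velo n (i.*2 * 2 ^ r)| <=
  C * `|posn n (i.*2.+1 * 2 ^ r) - posn n (i.*2 * 2 ^ r)| `^ ga + 3 * dy n.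
Proof.
move=> KU C0 hC Ka Kc; set c := (i.*2.+1 * 2 ^ r)%N in Kc *.
have -> : velo n c = sel U F (dy n) (posn n c) (velo n (parent c)).
  rewrite /velo /posn; have : (0 < c)%N by rewrite muln_gt0 expn_gt0.
  by case: (c) => // k _; rewrite /scheme euler_velocityS.
rewrite parentE; set a := (i.*2 * 2 ^ r)%N in Ka *.
have [f Ff fv] := velo_near (KU _ Ka).
have [g Fg fg] := hC _ _ _ Ka Kc Ff.
apply: le_trans (sel_nearest _ (dy_gt0 n) (KU _ Kc) Fg) _.
have -> : g - velo n a = (g - f) + (f - velo n a) by rewrite addrA subrK.
apply: le_trans (lerD (ler_normD _ _) (lexx _)) _.
have fg' : `|g - f| <= C * `|posn n c - posn n a| `^ ga.
  by rewrite distrC [`|posn n c - _|]distrC.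
have -> : 3 * dy n = dy n + 2 * dy n :> R by ring.
by rewrite addrA lerD2r lerD// ltW.
Qed.

(** The level [j0] is such that the remainder over a block of length at most
    [dy j0] is at most the power [al] of its length, as [euler_block]
    requires. *)
Lemma scheme_boundsP (K : set 'cV[R]_e) : compact K -> K `<=` U ->
  exists j0 c, scheme_bounds K j0 c.
Proof.
move=> cK KU; have hK := F_holder cK KU.
have [C C0 hC] := holder_on_selection hK.
have [L0 L00 hL0] : exists2 L, 0 <= L & forall y f, K y -> F y f -> `|f| <= L.
  have [[y0 Ky0]|K0] := pselect (K !=set0); last first.
    by exists 0 => // y f Ky; case: K0; exists y.
  by apply: (holder_values_bounded Ky0 _ cK hK (ltW ga_gt0)) => y /KU /F_compact[].
pose L := L0 + 1; have L_ge0 : 0 <= L by rewrite addr_ge0.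
have vL n k : K (posn n k) -> `|velo n k| <= L.
  move=> Kk; have [f Ff fv] := velo_near (KU _ Kk).
  have -> : velo n k = f - (f - velo n k) by rewrite opprB addrCA subrr addr0.
  apply: le_trans (ler_normB _ _) _; rewrite lerD//; first exact: hL0 Ff.
  exact: le_trans (ltW fv) (dy_le1 _).
pose B := @euler_B R d al ga H L C; pose M := @euler_M R d al H L.
pose N := @euler_N R d H L; pose G := @euler_G R d ga H L C.
pose c := Num.max L (Num.max N (Num.max B (Num.max M G))).
have [Lc [Nc [Bc [Mc Gc]]]] : L <= c /\ N <= c /\ B <= c /\ M <= c /\ G <= c.
  by rewrite !le_max !lexx ?orbT.
have c0 : 0 <= c by exact: le_trans Lc.
have be_gt0 : 0 < al * ga by rewrite mulr_gt0.
have [j0 Hj0] := powR_dy_small1 be_gt0 (normr_ge0 B) (ltr01 : 0 < 1 :> R).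
have B_lam : B * dy j0 `^ (al * ga) <= 1.
  by apply: le_trans Hj0; rewrite ler_wpM2r ?powR_ge0// ler_norm.
have par n r i := @velo_parent C K n r i KU C0 hC.
have yS n k : posn n k.+1 = posn n k + velo n k *m (X (k.+1%:R * dy n) - X (k%:R * dy n)).
  exact: euler_positionS.
have xH n r i : `|X ((i.+1 * 2 ^ r)%N%:R * dy n) - X ((i * 2 ^ r)%N%:R * dy n)|
    <= H * block_len n r `^ al.
  have -> : block_len n r = (i.+1 * 2 ^ r)%N%:R * dy n - (i * 2 ^ r)%N%:R * dy n :> R.
    by rewrite -mulrBl -natrB ?leq_mul2r ?leqnSn ?orbT// -mulnBl subSnn mul1n natrX.
  by apply: X_holder; rewrite ?mulr_ge0 ?dy_ge0// ler_wpM2r ?dy_ge0// ler_nat leq_mul2r leqnSn orbT.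
have len_lam n j : (j0 <= j <= n)%N -> block_len n (n - j) <= dy j0 :> R.
  by move=> /andP[j0j jn]; rewrite block_lenE// dy_le.
have blk n := euler_block al_gt0 ga_gt0 be_le1 th_gt1 H_ge0 L_ge0 C0 (dy_le1 j0)
  B_lam (yS n) (vL n) (par n) (xH n).
exists j0, c; split=> //.
- by move=> n k /vL h; exact: le_trans h Lc.
- move=> n j i jj Kp; have [jn _] := andP jj.
  have [h _] := blk n _ (len_lam _ _ jj) i Kp.
  apply: le_trans h _; rewrite block_lenE ?(andP jj).2//.
  by rewrite ler_wpM2r ?powR_ge0.
- move=> n j i jj Kp; have [_ jn] := andP jj.
  have [_ h] := blk n _ (len_lam _ _ jj) i Kp.
  rewrite -(refine_pt _ jn) -(refine_pt i jn).
  apply: le_trans h _; rewrite block_lenE//.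
  by rewrite ler_wpM2r ?powR_ge0.
- move=> n j i jj Kp; have [_ jn] := andP jj.
  have lt12 : (refine n j i.*2 < refine n j i.*2.+1)%N.
    by rewrite ltn_mul2r expn_gt0 ltnSn.
  have Ka : K (posn n (refine n j i.*2)) by apply: Kp; rewrite leqnn ltnW.
  have Kc : K (posn n (refine n j i.*2.+1)) by apply: Kp; rewrite leqnn ltnW.
  have [|h _] := blk n _ (len_lam _ _ jj) i.*2.
    by move=> k /andP[k1 k2]; apply: Kp; rewrite k1 ltnW.
  have len1 : block_len n (n - j) <= 1 :> R by rewrite block_lenE// dy_le1.
  have := euler_velocity_step al_gt0 ga_gt0 be_le1 H_ge0 L_ge0 C0 (par n) Ka Kc len1 h.
  move=> h'; apply: le_trans h' _; rewrite block_lenE//.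
  by rewrite ler_wpM2r ?powR_ge0.
- move=> n j i jj Kb; have [_ jn] := andP jj.
  apply: (euler_stay al_gt0 ga_gt0 be_le1 th_gt1 H_ge0 L_ge0 C0 (dy_le1 j0)
    B_lam (yS n) (vL n) (par n) (xH n) (len_lam _ _ jj)) => u ub.
  apply: Kb; apply: le_trans ub _; rewrite block_lenE//.
  by rewrite ler_wpM2r ?powR_ge0.
Qed.

End SchemeBounds.

(** * Limits of the schemes at dyadic times *)

Section NormLimits.
Context {R : realType} {V : normedModType R}.

Lemma cvg_norm_le (u : nat -> V) l c : u i @[i --> \oo] --> l ->
  (\forall i \near \oo, `|u i| <= c) -> `|l| <= c.
Proof.
move=> /cvgrPdist_lt ul uc; rewrite leNgt; apply/negP => cl.
have e0 : 0 < `|l| - c by rewrite subr_gt0.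
near \oo => i.
have h1 : `|l - u i| < `|l| - c by near: i; exact: ul.
have h2 : `|u i| <= c by near: i.
have := ler_normD (l - u i) (u i); rewrite subrK; lra.
Unshelve. all: by end_near. Qed.

Lemma cvg_compact_mem (K : set V) (u : nat -> V) l : compact K -> u i @[i --> \oo] --> l ->
  (\forall i \near \oo, K (u i)) -> K l.
Proof.
move=> cK ul uK; have clK : closed K by apply: compact_closed => //; exact: norm_hausdorff.
exact: (closed_cvg _ clK uK).
Qed.

End NormLimits.

Lemma cvg_mulmxl {R : realType} m n p (A : nat -> 'M[R]_(m, n)) (L : 'M[R]_(m, n))
    (D : 'M[R]_(n, p)) :
  A i @[i --> \oo] --> L -> A i *m D @[i --> \oo] --> L *m D.
Proof.
move=> AL; apply/cvgrPdist_lt => eps e0.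
have D1 : 0 < n%:R * `|D| + 1 by rewrite ltr_wpDl// mulr_ge0.
move/cvgrPdist_lt : AL => /(_ (eps / (n%:R * `|D| + 1)) (divr_gt0 e0 D1)).
apply: filterS => i hi; rewrite -mulmxBl; apply: le_lt_trans (norm_mulmx _ _) _.
rewrite mulrAC; apply: le_lt_trans (_ : _ <= (n%:R * `|D| + 1) * `|L - A i|) _.
  by rewrite ler_wpM2r// lerDl.
by rewrite mulrC -ltr_pdivlMr.
Qed.

(** A solution known at the dyadic times below [S]: positions [yd j k] and
    velocities [ud j k] at time [k 2^-j], with their bounds at all scales. *)
Record dyadic_solution {R : realType} {e d : nat} (F : 'cV[R]_e -> set 'M[R]_(e, d))
    (al ga : R) (X : R -> 'cV[R]_d) (S : R) (K : set 'cV[R]_e) (j0 : nat) (c : R)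
    (yd : nat -> nat -> 'cV[R]_e) (ud : nat -> nat -> 'M[R]_(e, d)) : Prop :=
  DyadicSolution {
  ds_ge0 : 0 <= c;
  ds_K : forall j k, k%:R * dy j <= S -> K (yd j k);
  ds_F : forall j k, k%:R * dy j <= S -> F (yd j k) (ud j k);
  ds_velo : forall j k, k%:R * dy j <= S -> `|ud j k| <= c;
  ds_posn2 : forall j k, k%:R * dy j <= S -> yd j.+1 k.*2 = yd j k;
  ds_velo2 : forall j k, k%:R * dy j <= S -> ud j.+1 k.*2 = ud j k;
  ds_block : forall j k, (j0 <= j)%N -> k.+1%:R * dy j <= S ->
    `|yd j k.+1 - yd j k| <= c * dy j `^ al;
  ds_rem : forall j k, (j0 <= j)%N -> k.+1%:R * dy j <= S ->
    `|yd j k.+1 - yd j k - ud j k *m (X (k.+1%:R * dy j) - X (k%:R * dy j))|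
    <= c * dy j `^ (al + al * ga);
  ds_mid : forall j k, (j0 <= j)%N -> k.*2.+1%:R * dy j.+1 <= S ->
    `|ud j.+1 k.*2.+1 - ud j k| <= c * dy j.+1 `^ (al * ga) }.

Section LimitPath.
Context {R : realType} {e d : nat}.
Variables (U : set 'cV[R]_e) (F : 'cV[R]_e -> set 'M[R]_(e, d)).
Variables (al ga H : R) (X : R -> 'cV[R]_d) (xi : 'cV[R]_e).
Hypotheses (al_gt0 : 0 < al) (ga_gt0 : 0 < ga) (be_le1 : al * ga <= 1)
  (th_gt1 : 1 < al + al * ga) (H_ge0 : 0 <= H).
Hypotheses (F_compact : forall y, U y -> F y !=set0 /\ compact (F y))
  (F_holder : locally_holder ga U F).
Hypothesis X_holder : forall a b, 0 <= a -> a <= b ->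
  `|X b - X a| <= H * (b - a) `^ al.
Hypothesis xi_U : U xi.
Variable nn : nat -> nat.
Hypothesis nn_ge : forall i, (i <= nn i)%N.

Let posn := posn U F X xi.
Let velo := velo U F X xi.

Definition sub_posn j k i : 'cV[R]_e := posn (nn i) (refine (nn i) j k).
Definition sub_velo j k i : 'M[R]_(e, d) := velo (nn i) (refine (nn i) j k).
Definition lim_posn j k := mx_lim (sub_posn j k).
Definition lim_velo j k := mx_lim (sub_velo j k).

Definition stays (S : R) (K : set 'cV[R]_e) : Prop :=
  \forall i \near \oo, forall k, k%:R * dy (nn i) <= S -> K (posn (nn i) k).

Hypothesis decided_posn : forall j k a b (r : rat),
  decided (fun i => ratr r < sub_posn j k i a b).
Hypothesis decided_velo : forall j k a b (r : rat),
  decided (fun i => ratr r < sub_velo j k i a b).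

Section Stays.
Variables (S : R) (K : set 'cV[R]_e).
Hypotheses (cK : compact K) (KU : K `<=` U) (SK : stays S K).

Lemma near_nn j : \forall i \near \oo, (j <= nn i)%N.
Proof. by exists j => // i /= ji; apply: leq_trans (nn_ge i). Qed.

Lemma near_sub_posn j k : k%:R * dy j <= S -> \forall i \near \oo, K (sub_posn j k i).
Proof.
move=> kS; apply: filterS2 (near_nn j) SK => i ji; apply.
by rewrite refine_pt.
Qed.

Lemma cvg_sub_posn j k : k%:R * dy j <= S -> sub_posn j k i @[i --> \oo] --> lim_posn j k.
Proof.
move=> kS; have [c c0 hc] := compact_norm_le cK.
apply: mx_cvg => a b; rewrite mxE; apply: (@decided_cvg _ _ c) => //.
by apply: filterS (near_sub_posn kS) => i /hc; apply: le_trans; exact: mx_norm_entry.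
Qed.

Lemma cvg_sub_velo j k : k%:R * dy j <= S -> sub_velo j k i @[i --> \oo] --> lim_velo j k.
Proof.
have [j0 [c sb]] := scheme_boundsP al_gt0 ga_gt0 be_le1 th_gt1 H_ge0 F_compact F_holder
  X_holder xi_U cK KU.
move=> kS; apply: mx_cvg => a b; rewrite mxE; apply: (@decided_cvg _ _ c) => //.
apply: filterS (near_sub_posn kS) => i /(sb_velo sb).
by apply: le_trans; exact: mx_norm_entry.
Qed.

(** All bounds pass to the limit, and the velocities of the limit belong to [F]
    because [F] has a closed graph on [K]. *)
Lemma dyadic_solutionP : exists j0 c,
  dyadic_solution F al ga X S K j0 c lim_posn lim_velo.
Proof.
have [j0 [c sb]] := scheme_boundsP al_gt0 ga_gt0 be_le1 th_gt1 H_ge0 F_compact F_holder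
  X_holder xi_U cK KU.
have ptS j k l : (k <= l)%N -> l%:R * dy j <= S -> k%:R * dy j <= S.
  by move=> kl; apply: le_trans; rewrite ler_wpM2r ?dy_ge0// ler_nat.
have blockS j k l : (k <= l)%N -> l%:R * dy j <= S ->
    \forall i \near \oo, (j <= nn i)%N /\
      forall k', (k' <= refine (nn i) j l)%N -> K (posn (nn i) k').
  move=> kl lS; apply: filterS2 (near_nn j) SK => i ji h; split=> // k' k'l.
  apply: h; apply: le_trans lS; rewrite -(refine_pt _ ji).
  by rewrite ler_wpM2r ?dy_ge0// ler_nat.
have lbK j k : k%:R * dy j <= S -> K (lim_posn j k).
  by move=> kS; apply: cvg_compact_mem (cvg_sub_posn kS) (near_sub_posn kS).
exists j0, c; split=> //.
- exact: sb_ge0 sb.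
- move=> j k kS; have Kl := lbK _ _ kS.
  apply: (holder_closed_graph (F_holder cK KU) ga_gt0 Kl).
    by apply: compact_closed; [exact: norm_hausdorff|exact: (F_compact (KU Kl)).2].
  move=> eps e0; have e20 : 0 < eps / 2 by rewrite divr_gt0.
  have [m mP] := dy_small e20.
  near \oo => i.
  have Ki : K (sub_posn j k i) by near: i; exact: near_sub_posn.
  have [f Ff fv] := velo_near F_compact xi_U (KU Ki).
  exists (sub_posn j k i), f; split=> //.
    rewrite distrC; near: i.
    by have /cvgrPdist_lt/(_ _ e0) := cvg_sub_posn kS.
  have -> : f - lim_velo j k = (f - sub_velo j k i) + (sub_velo j k i - lim_velo j k).
    by rewrite addrA subrK.
  rewrite (splitr eps); apply: le_lt_trans (ler_normD _ _) _; rewrite ltrD//.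
    apply: lt_trans fv _; apply: le_lt_trans mP; apply: dy_le.
    by near: i; exact: near_nn.
  rewrite distrC; near: i.
  by have /cvgrPdist_lt/(_ _ e20) := cvg_sub_velo kS.
- move=> j k kS; apply: cvg_norm_le (cvg_sub_velo kS) _.
  by apply: filterS (near_sub_posn kS) => i /(sb_velo sb).
- move=> j k kS; apply: mx_limE; apply: cvg_trans (cvg_sub_posn kS).
  apply: near_eq_cvg; apply: filterS (near_nn j.+1) => i ji.
  by rewrite /sub_posn refine_double.
- move=> j k kS; apply: mx_limE; apply: cvg_trans (cvg_sub_velo kS).
  apply: near_eq_cvg; apply: filterS (near_nn j.+1) => i ji.
  by rewrite /sub_velo refine_double.
- move=> j k j0j kS; have kS' := ptS _ _ _ (leqnSn k) kS.
  apply: cvg_norm_le (cvgB (cvg_sub_posn kS) (cvg_sub_posn kS')) _.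
  apply: filterS (blockS _ _ _ (leqnn _) kS) => i [ji h].
  apply: (sb_block sb); first by rewrite j0j.
  by move=> k' /andP[_ /ltnW]; apply: h.
- move=> j k j0j kS; have kS' := ptS _ _ _ (leqnSn k) kS.
  pose D := X (k.+1%:R * dy j) - X (k%:R * dy j).
  have cD : sub_velo j k i *m D @[i --> \oo] --> lim_velo j k *m D.
    exact: cvg_mulmxl (cvg_sub_velo kS').
  apply: cvg_norm_le (cvgB (cvgB (cvg_sub_posn kS) (cvg_sub_posn kS')) cD) _.
  apply: filterS (blockS _ _ _ (leqnn _) kS) => i [ji h].
  apply: (sb_rem sb); first by rewrite j0j.
  by move=> k' /andP[_ /ltnW]; apply: h.
- move=> j k j0j kS; have kS' := ptS _ _ _ (leqnSn _) kS.
  have kS2 : k%:R * dy j <= S.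
    by move: kS'; rewrite -muln2 natrM -mulrA -dyS.
  apply: cvg_norm_le (cvgB (cvg_sub_velo kS) (cvg_sub_velo kS2)) _.
  apply: filterS (blockS _ _ _ (leqnn _) kS) => i [ji h].
  have E : sub_velo j k i = velo (nn i) (refine (nn i) j.+1 k.*2).
    by rewrite /sub_velo refine_double.
  rewrite /= [X in _ - X]E.
  apply: (sb_mid sb); first by rewrite (leq_trans j0j) ?leqnSn.
  by move=> k' /andP[_]; apply: h.
Unshelve. all: by end_near. Qed.

End Stays.

(** A scheme that starts a block of length [dy J] at distance [delta] from the
    complement of [K] stays in [K] over the block, as soon as the bound [sb_stay]
    at the scale [dy J] is less than [delta]; this only depends on [K] and
    [delta]. *)
Lemma stays_extend (K : set 'cV[R]_e) delta : compact K -> K `<=` U -> 0 < delta ->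
  exists J0, forall J S y, (J0 <= J)%N ->
  forall k, S = k%:R * dy J -> stays S K ->
  (\forall i \near \oo, `|sub_posn J k i - y| < delta) ->
  (forall u, `|u - y| <= 2 * delta -> K u) ->
  stays (k.+1%:R * dy J) K.
Proof.
move=> cK KU del0.
have [j0 [c sb]] := scheme_boundsP al_gt0 ga_gt0 be_le1 th_gt1 H_ge0 F_compact F_holder
  X_holder xi_U cK KU.
have [n0 n0P] := powR_dy_small al_gt0 (sb_ge0 sb) del0.
exists (maxn j0 n0) => J S y; rewrite geq_max => /andP[j0J n0J] k -> SK sy Ku.
apply: filterS3 (near_nn J) SK sy => i Ji h yi k' k'S.
have [k'k|kk'] := leqP k' (refine (nn i) J k).
  by apply: h; rewrite -(refine_pt _ Ji) ler_wpM2r ?dy_ge0// ler_nat.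
have jj : (j0 <= J <= nn i)%N by rewrite j0J Ji.
apply: (sb_stay sb jj (i := k)); last first.
  rewrite (ltnW kk')/= -(ler_nat R) -(ler_pM2r (dy_gt0 (nn i))).
  by rewrite refine_pt.
move=> u uy; apply: Ku.
have -> : u - y = (u - sub_posn J k i) + (sub_posn J k i - y) by rewrite addrA subrK.
apply: le_trans (ler_normD _ _) _; rewrite mulr2n mulrDl !mul1r lerD ?(ltW yi)//.
by apply: le_trans uy _; exact: n0P.
Qed.

End LimitPath.

(** * Paths obtained from values at dyadic times *)

Section DyadicFloor.
Context {R : realType}.
Implicit Types (s a b : R).

Definition fl j s : nat := Num.truncn (s / dy j).

Lemma fl_itv j s : 0 <= s -> (fl j s)%:R * dy j <= s < (fl j s).+1%:R * dy j.
Proof.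
move=> s0; have h : 0 <= s / dy j by rewrite divr_ge0 ?dy_ge0.
by rewrite -ler_pdivlMr ?dy_gt0// -ltr_pdivrMr ?dy_gt0// truncn_itv.
Qed.

Lemma fl_le j s : 0 <= s -> (fl j s)%:R * dy j <= s.
Proof. by move=> /(fl_itv j)/andP[]. Qed.

Lemma fl_gt j s : 0 <= s -> s < (fl j s).+1%:R * dy j.
Proof. by move=> /(fl_itv j)/andP[]. Qed.

Lemma fl_uniq j k s : k%:R * dy j <= s < k.+1%:R * dy j -> fl j s = k.
Proof.
by rewrite -ler_pdivlMr ?dy_gt0// -ltr_pdivrMr ?dy_gt0// => /truncn_def.
Qed.

Lemma fl_pt j k : fl j (k%:R * dy j) = k.
Proof. by apply: fl_uniq; rewrite lexx ltr_pM2r ?dy_gt0// ltr_nat ltnSn. Qed.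

Lemma fl_mono j a b : a <= b -> (fl j a <= fl j b)%N.
Proof. by move=> ab; apply: le_truncn; rewrite ler_wpM2r ?invr_ge0 ?dy_ge0. Qed.

Lemma flS j s : 0 <= s -> fl j.+1 s = (fl j s).*2 \/ fl j.+1 s = (fl j s).*2.+1.
Proof.
move=> s0; have /andP[h1 h2] := fl_itv j s0.
have E k : k%:R * dy j = k.*2%:R * dy j.+1 :> R.
  by rewrite -muln2 natrM -mulrA -dyS.
rewrite !E in h1 h2.
have [h|h] := ltP s ((fl j s).*2.+1%:R * dy j.+1); [left|right]; apply: fl_uniq.
  by rewrite h1.
by rewrite h -doubleS.
Qed.

Lemma fl_adj j a b : 0 <= a -> a <= b -> b - a <= dy j ->
  fl j b = fl j a \/ fl j b = (fl j a).+1.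
Proof.
move=> a0 ab bad; have b0 : 0 <= b := le_trans a0 ab.
have h1 := fl_mono j ab; have h2 := fl_gt j a0; have h3 := fl_le j b0.
have : (fl j b < (fl j a).+2)%N.
  rewrite -(ltr_nat R) -(ltr_pM2r (dy_gt0 j)); apply: le_lt_trans h3 _.
  rewrite -[in ltRHS]natr1 mulrDl mul1r; lra.
rewrite ltnS => h4; move: h1; rewrite leq_eqVlt => /orP[/eqP->|h1]; first by left.
by right; apply/eqP; rewrite eqn_leq h4.
Qed.

Lemma fl_right j s : 0 <= s ->
  exists2 del, 0 < del & forall s', s <= s' -> s' < s + del -> fl j s' = fl j s.
Proof.
move=> s0; exists ((fl j s).+1%:R * dy j - s); first by rewrite subr_gt0 fl_gt.
move=> s' ss'; rewrite addrC subrK => h; apply: fl_uniq.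
by rewrite h andbT (le_trans _ ss')// fl_le.
Qed.

Lemma fl_left j s : 0 < s ->
  exists k, exists2 del, 0 < del & forall s', s - del < s' -> s' < s -> fl j s' = k.
Proof.
move=> s0; have /andP[h1 h2] := fl_itv j (ltW s0).
have [h|h] := ltP ((fl j s)%:R * dy j) s.
  exists (fl j s), (s - (fl j s)%:R * dy j); first by rewrite subr_gt0.
  move=> s'; rewrite opprB addrCA subrr addr0 => h3 h4; apply: fl_uniq.
  by rewrite (ltW h3) (lt_trans h4).
case: (fl j s) h1 h2 h => [|k] h1 h2 h.
  by move: h; rewrite mul0r leNgt s0.
have E : s = k.+1%:R * dy j by apply/eqP; rewrite eq_le h h1.
exists k, (dy j); first exact: dy_gt0.
move=> s'; rewrite {1}E -natr1 mulrDl mul1r addrK => h3 h4; apply: fl_uniq.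
by rewrite (ltW h3) -E.
Qed.

End DyadicFloor.

Section DyadicPath.
Context {R : realType} {m n : nat}.
Variables (f : nat -> nat -> 'M[R]_(m, n)) (S c eta : R) (j0 : nat).
Hypotheses (eta_gt0 : 0 < eta) (c_ge0 : 0 <= c).
Hypothesis f_double : forall j k, k%:R * dy j <= S -> f j.+1 k.*2 = f j k.
Hypothesis f_mid : forall j k, (j0 <= j)%N -> k.*2.+1%:R * dy j.+1 <= S ->
  `|f j.+1 k.*2.+1 - f j k| <= c * dy j.+1 `^ eta.

(** Values are read at the dyadic floors, that is from the left. Under the
    hypothesis [f_mid], which compares a midpoint with its left end only, the
    path may jump at the dyadic points; it is càdlàg as a uniform limit of step
    functions. *)
Definition dyadic_path (s : R) : 'M[R]_(m, n) := mx_lim (fun j => f j (fl j s)).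

Definition path_const : R := c / (2 `^ eta - 1).

Let eta1 : 0 < 2 `^ eta - 1. Proof. by rewrite subr_gt0 powR2_gt1. Qed.
Lemma path_const_ge0 : 0 <= path_const.
Proof. by rewrite divr_ge0// ltW. Qed.

Lemma dyadic_path_step s j : 0 <= s <= S -> (j0 <= j)%N ->
  `|f j.+1 (fl j.+1 s) - f j (fl j s)| <= path_const * (dy j `^ eta - dy j.+1 `^ eta).
Proof.
move=> /andP[s0 sS] j0j.
have -> : path_const * (dy j `^ eta - dy j.+1 `^ eta) = c * dy j.+1 `^ eta.
  rewrite -powR_dyS -{2}[dy j.+1 `^ eta]mul1r -mulrBl mulrA divfK//.
  by rewrite gt_eqF.
have flS' := le_trans (fl_le j s0) sS; have := le_trans (fl_le j.+1 s0) sS.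
have [->|->] := flS j s0.
  by rewrite f_double// subrr normr0 mulr_ge0 ?powR_ge0.
exact: f_mid.
Qed.

Lemma dyadic_path_steps s j l : 0 <= s <= S -> (j0 <= j)%N ->
  `|f (j + l)%N (fl (j + l) s) - f j (fl j s)| <=
  path_const * (dy j `^ eta - dy (j + l) `^ eta).
Proof.
move=> sS j0j; elim: l => [|l IH].
  by rewrite addn0 !subrr normr0 mulr0.
have h := @dyadic_path_step s (j + l)%N sS (leq_trans j0j (leq_addr _ _)).
rewrite addnS; move: (j + l)%N IH h => i IH h.
have -> : f i.+1 (fl i.+1 s) - f j (fl j s) =
  (f i.+1 (fl i.+1 s) - f i (fl i s)) + (f i (fl i s) - f j (fl j s)).
  by rewrite addrA subrK.
apply: le_trans (ler_normD _ _) _; apply: le_trans (lerD h IH) _.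
by rewrite -mulrDr addrC addrA subrK.
Qed.

Lemma dyadic_path_cvg s : 0 <= s <= S -> f j (fl j s) @[j --> \oo] --> dyadic_path s.
Proof.
move=> sS; apply: mx_cvg => a b; rewrite mxE.
set u := fun j => _; suff : cvg (u j @[j --> \oo]) by move=> h; rewrite (esup_limE h).
apply/cauchy_cvgP/cauchy_exP => eps e0.
have e1 : 0 < eps by [].
have [i0 i0P] := powR_dy_small eta_gt0 path_const_ge0 (divr_gt0 e1 (ltr0Sn R 1)).
pose j := maxn i0 j0; exists (u j); exists j => // i /= ji.
rewrite -ball_normE /= distrC.
have := @dyadic_path_steps s j (i - j) sS (leq_maxr _ _); rewrite subnKC// => h.
apply: le_lt_trans (_ : _ <= `|f i (fl i s) - f j (fl j s)|) _.
  by have := mx_norm_entry (f i (fl i s) - f j (fl j s)) a b; rewrite !mxE.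
apply: le_lt_trans h _; apply: le_lt_trans (_ : _ <= path_const * dy j `^ eta) _.
  by rewrite ler_wpM2l ?path_const_ge0// gerBl powR_ge0.
apply: le_lt_trans (i0P _ (leq_maxl _ _)) _.
by rewrite ltr_pdivrMr// ltr_pMr// ltr1n.
Qed.

Lemma dyadic_path_dist s j : 0 <= s <= S -> (j0 <= j)%N ->
  `|dyadic_path s - f j (fl j s)| <= path_const * dy j `^ eta.
Proof.
move=> sS j0j.
apply: cvg_norm_le (cvgB (dyadic_path_cvg sS) (cvg_cst (f j (fl j s)))) _.
exists j => // i /= ji.
have := @dyadic_path_steps s j (i - j) sS j0j; rewrite subnKC// => h.
apply: le_trans h _.
by rewrite ler_wpM2l ?path_const_ge0// gerBl powR_ge0.
Qed.

Lemma dyadic_path_pt j k : k%:R * dy j <= S -> dyadic_path (k%:R * dy j) = f j k.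
Proof.
move=> kS; apply: mx_limE.
have E l : fl (j + l) (k%:R * dy j : R) = (k * 2 ^ l)%N.
  have <- : (k * 2 ^ l)%N%:R * dy (j + l) = k%:R * dy j :> R.
    by rewrite natrM natrX -mulrA addnC dyM.
  exact: fl_pt.
have fE l : f (j + l)%N (k * 2 ^ l)%N = f j k.
  elim: l => [|l IH]; first by rewrite addn0 expn0 muln1.
  rewrite addnS expnSr mulnA muln2 f_double//.
  by rewrite natrM natrX -mulrA addnC dyM.
have cc : (fun=> f j k) i @[i --> \oo] --> f j k by exact: cvg_cst.
apply: cvg_trans cc; apply: near_eq_cvg.
exists j => // i /= ji; by rewrite -(subnKC ji) E fE.
Qed.

End DyadicPath.

(** * Position and velocity at all times *)

Section SolutionPath.
Context {R : realType} {e d : nat}.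
Variables (F : 'cV[R]_e -> set 'M[R]_(e, d)).
Variables (al ga S : R) (X : R -> 'cV[R]_d) (K : set 'cV[R]_e) (j0 : nat) (c : R).
Variables (yd : nat -> nat -> 'cV[R]_e) (ud : nat -> nat -> 'M[R]_(e, d)).
Hypotheses (al_gt0 : 0 < al) (ga_gt0 : 0 < ga).
Hypotheses (cK : compact K) (hK : holder_on ga K F) (F_closed : forall y, K y -> closed (F y)).
Hypothesis sol : dyadic_solution F al ga X S K j0 c yd ud.

Let be := al * ga.
Let be_gt0 : 0 < be. Proof. by rewrite mulr_gt0. Qed.
Let c_ge0 : 0 <= c := ds_ge0 sol.
Let Y := dyadic_path yd.
Let V := dyadic_path ud.

Let half_pt j k : k.*2.+1%:R * dy j.+1 <= S -> k.*2%:R * dy j.+1 <= S.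
Proof. by apply: le_trans; rewrite ler_wpM2r ?dy_ge0// ler_nat leqnSn. Qed.

Let pt_double j k : k.*2%:R * dy j.+1 = k%:R * dy j :> R.
Proof. by rewrite -muln2 natrM -mulrA -dyS. Qed.

Let yd_mid j k : (j0 <= j)%N -> k.*2.+1%:R * dy j.+1 <= S ->
  `|yd j.+1 k.*2.+1 - yd j k| <= c * dy j.+1 `^ al.
Proof.
move=> j0j kS; have := half_pt kS; rewrite pt_double => kS'.
by rewrite -(ds_posn2 sol kS'); apply: (ds_block sol); rewrite ?(leq_trans j0j).
Qed.

Lemma posn_cvg s : 0 <= s <= S -> yd j (fl j s) @[j --> \oo] --> Y s.
Proof. by move=> sS; apply: (dyadic_path_cvg al_gt0 c_ge0 (ds_posn2 sol) yd_mid sS). Qed.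

Lemma velo_cvg s : 0 <= s <= S -> ud j (fl j s) @[j --> \oo] --> V s.
Proof.
by move=> sS; apply: (dyadic_path_cvg be_gt0 c_ge0 (ds_velo2 sol) (ds_mid sol) sS).
Qed.

Lemma posn_dist s j : 0 <= s <= S -> (j0 <= j)%N ->
  `|Y s - yd j (fl j s)| <= path_const c al * dy j `^ al.
Proof. exact: (dyadic_path_dist al_gt0 c_ge0 (ds_posn2 sol) yd_mid). Qed.

Lemma velo_dist s j : 0 <= s <= S -> (j0 <= j)%N ->
  `|V s - ud j (fl j s)| <= path_const c be * dy j `^ be.
Proof. exact: (dyadic_path_dist be_gt0 c_ge0 (ds_velo2 sol) (ds_mid sol)). Qed.

Lemma posn_pt j k : k%:R * dy j <= S -> Y (k%:R * dy j) = yd j k.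
Proof. exact: (dyadic_path_pt (ds_posn2 sol)). Qed.

Let flS s j : 0 <= s <= S -> (fl j s)%:R * dy j <= S.
Proof. by move=> /andP[s0 sS]; apply: le_trans sS; apply: fl_le. Qed.

Lemma posn_K s : 0 <= s <= S -> K (Y s).
Proof.
move=> sS; apply: cvg_compact_mem cK (posn_cvg sS) _.
by apply: nearW => j; apply: (ds_K sol); apply: flS.
Qed.

Lemma velo_bnd s : 0 <= s <= S -> `|V s| <= c.
Proof.
move=> sS; apply: cvg_norm_le (velo_cvg sS) _.
by apply: nearW => j; apply: (ds_velo sol); apply: flS.
Qed.

Lemma velo_F s : 0 <= s <= S -> F (Y s) (V s).
Proof.
move=> sS; have Ks := posn_K sS; apply: (holder_closed_graph hK ga_gt0 Ks (F_closed Ks)).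
move=> eps e0; near \oo => j.
exists (yd j (fl j s)), (ud j (fl j s)); split.
- by apply: (ds_K sol); apply: flS.
- by apply: (ds_F sol); apply: flS.
- by rewrite distrC; near: j; have /cvgrPdist_lt/(_ _ e0) := posn_cvg sS.
- by rewrite distrC; near: j; have /cvgrPdist_lt/(_ _ e0) := velo_cvg sS.
Unshelve. all: by end_near. Qed.

Lemma dy_scale (r : R) : 0 < r -> r <= 1 -> exists2 j, dy j.+1 < r & r <= dy j.
Proof.
move=> r0 r1; have [n nP] := dy_small r0.
pose P k : Prop := dy k.+1 < r.
have Pn : P n by apply: le_lt_trans nP; apply: dy_le.
have Pf : P (first P) by apply: firstP; exists n.
exists (first P) => //; case Ef : (first P) => [|k]//.
rewrite leNgt; apply/negP => Pk.
by have := @first_le P k Pk; rewrite Ef ltnn.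
Qed.

(** The level is chosen such that [b - a] is comparable with the mesh; the floors
    of [a] and [b] are then equal or adjacent. *)
Lemma posn_holder : exists2 c1, 0 <= c1 & forall a b, 0 <= a -> a <= b -> b <= S ->
  `|Y b - Y a| <= c1 * (b - a) `^ al.
Proof.
have [B B0 yb] := compact_norm_le cK.
pose c' := path_const c al; have c'0 : 0 <= c' := path_const_ge0 al_gt0 c_ge0.
pose c1 := (c' + c + c') * 2 `^ al + (B + B) / dy j0 `^ al.
have m0 : 0 <= (c' + c + c') * 2 `^ al.
  by apply: mulr_ge0; rewrite ?powR_ge0// addr_ge0// addr_ge0.
have n0 : 0 <= (B + B) / dy j0 `^ al by rewrite divr_ge0 ?powR_ge0// addr_ge0.
have c10 : 0 <= c1 by exact: addr_ge0.
exists c1 => // a b a0 ab bS; have b0 : 0 <= b := le_trans a0 ab.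
have aS : a <= S := le_trans ab bS.
have [Ya Yb] : K (Y a) /\ K (Y b) by split; apply: posn_K; rewrite ?a0 ?b0.
have [abj|jab] := leP (b - a) (dy j0); last first.
  apply: le_trans (ler_normB _ _) _; apply: le_trans (lerD (yb _ Yb) (yb _ Ya)) _.
  apply: le_trans (_ : _ <= (B + B) / dy j0 `^ al * (b - a) `^ al) _.
    rewrite mulrAC ler_pdivlMr ?powR_gt0 ?dy_gt0// ler_wpM2l ?addr_ge0//.
    rewrite ge0_ler_powR ?nnegrE ?dy_ge0 ?(ltW al_gt0) ?subr_ge0 ?(ltW jab)//.
  by rewrite ler_wpM2r ?powR_ge0// lerDr.
have [->|ab'] := eqVneq b a; first by rewrite subrr normr0 mulr_ge0 ?powR_ge0.
have r0 : 0 < b - a by rewrite subr_gt0 lt_neqAle eq_sym ab' ab.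
have [j j1 j2] := dy_scale r0 (le_trans abj (dy_le1 _)).
have j0j : (j0 <= j)%N.
  rewrite leqNgt; apply/negP => jj0; have := lt_le_trans j1 abj.
  by rewrite ltNge dy_le.
have [aS' bS'] : 0 <= a <= S /\ 0 <= b <= S by rewrite a0 b0 aS bS.
have fab : `|yd j (fl j b) - yd j (fl j a)| <= c * dy j `^ al.
  have [->|E] := fl_adj a0 ab j2; first by rewrite subrr normr0 mulr_ge0 ?powR_ge0.
  by have := flS j bS'; rewrite E; apply: (ds_block sol).
have -> : Y b - Y a = (Y b - yd j (fl j b)) + (yd j (fl j b) - yd j (fl j a))
    - (Y a - yd j (fl j a)).
  by rewrite [in RHS]addrA subrK opprB [in RHS]addrA subrK.
apply: le_trans (ler_normB _ _) _.
apply: le_trans (lerD (le_trans (ler_normD _ _) (lerD (posn_dist bS' j0j) fab)) (posn_dist aS' j0j)) _.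
rewrite -/c' -!mulrDl -powR_dyS mulrA.
apply: le_trans (_ : _ <= (c' + c + c') * 2 `^ al * (b - a) `^ al) _.
  rewrite ler_wpM2l//.
  by rewrite ge0_ler_powR ?nnegrE ?dy_ge0 ?(ltW al_gt0) ?(ltW j1) ?(ltW r0).
by rewrite ler_wpM2r ?powR_ge0// lerDl.
Unshelve. all: by end_near. Qed.

End SolutionPath.

(** * Variation of the velocity *)

Section VariationSums.
Context {R : realType} {W : normedModType R}.
Implicit Types (f : R -> W) (s t : seq R) (E : set R) (p : R).

Definition var_sum p f s : R := \sum_(k < (size s).-1) `|f s`_k.+1 - f s`_k| `^ p.

Lemma var_sum_cons p f a b t :
  var_sum p f (a :: b :: t) = `|f b - f a| `^ p + var_sum p f (b :: t).
Proof. by rewrite /var_sum /= big_ord_recl. Qed.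

(** The function [g] controls the powers of the increments up to an error [eps]
    at each step. *)
Lemma var_sum_le p f E (g : R -> R) eps a t :
  (forall u v, E u -> E v -> u < v -> `|f v - f u| `^ p <= g v - g u + eps) ->
  path <%R a t -> [set` a :: t] `<=` E ->
  var_sum p f (a :: t) <= g (last a t) - g a + (size t)%:R * eps.
Proof.
move=> h; elim: t a => [|b t IH] a /=.
  by rewrite /var_sum big_ord0 subrr mul0r addr0.
move=> /andP[ab bt] tE; rewrite var_sum_cons.
have Ea : E a by apply: tE; rewrite /= mem_head.
have Eb : E b by apply: tE; rewrite /= in_cons mem_head orbT.
have tE' : [set` b :: t] `<=` E.
  by move=> u ub; apply: tE; rewrite /= in_cons ub orbT.
apply: le_trans (lerD (h _ _ Ea Eb ab) (IH b bt tE')) _.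
rewrite -natr1 mulrDl mul1r; lra.
Qed.

Lemma Vp_of_var_sum p f E M : 0 <= p ->
  (forall s, sorted <%R s -> [set` s] `<=` E -> var_sum p f s <= M) -> Vp p E f.
Proof.
move=> p0 hM; rewrite /Vp /= /pvariation.
apply: (@le_lt_trans _ _ (M `^ p^-1)%:E); last exact: ltry.
apply: ge_ereal_sup => _ [s [ss sE] <-]; rewrite lee_fin.
have v0 : 0 <= var_sum p f s by apply: sumr_ge0 => k _; exact: powR_ge0.
have h := hM s ss sE.
by apply: ge0_ler_powR; rewrite ?invr_ge0 ?nnegrE// (le_trans v0).
Qed.

Lemma Vp_comp p f E D (Phi : R -> R) M : 0 <= p ->
  (forall s, sorted <%R s -> [set` s] `<=` D -> var_sum p f s <= M) ->
  (forall a, E a -> D (Phi a)) ->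
  (forall a b, E a -> E b -> a < b -> Phi a < Phi b) ->
  Vp p E (f \o Phi).
Proof.
move=> p0 hM ED inc; apply: (@Vp_of_var_sum _ _ _ M) => // s ss sE.
have -> : var_sum p (f \o Phi) s = var_sum p f (map Phi s).
  rewrite /var_sum size_map; apply: eq_bigr => k _.
  have ks : (k.+1 < size s)%N by rewrite -ltn_predRL.
  by rewrite (nth_map 0)// (nth_map 0)// ltnW.
apply: hM.
  case: s ss sE => [//|a t] /=; elim: t a => [//|b t IH] a /= /andP[ab bt] tE.
  have Ea : E a by apply: tE; rewrite /= mem_head.
  have Eb : E b by apply: tE; rewrite /= in_cons mem_head orbT.
  rewrite inc//= IH// => u ub; apply: tE.
  by rewrite /= in_cons ub orbT.
by move=> _ /= /mapP[u us ->]; apply/ED/sE.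
Qed.

Lemma var_sum_holder p f al c S : 0 <= p -> al * p = 1 -> 0 <= S -> 0 <= c ->
  (forall a b, 0 <= a -> a <= b -> b <= S -> `|f b - f a| <= c * (b - a) `^ al) ->
  forall s, sorted <%R s -> [set` s] `<=` `[0, S] -> var_sum p f s <= c `^ p * S.
Proof.
move=> p0 alp S0 c0 hf [|a t] ss sE.
  by rewrite /var_sum /= big_ord0 mulr_ge0 ?powR_ge0.
have := @var_sum_le p f `[0, S]%classic (fun u => c `^ p * u) 0 a t _ ss sE.
have aS : `[0, S]%classic a by apply: sE; rewrite /= mem_head.
have lS : `[0, S]%classic (last a t) by apply: sE; rewrite /= mem_last.
rewrite mulr0 addr0 => h; apply: le_trans (h _) _.
  move=> u v; rewrite /= !in_itv /= => /andP[u0 uS] /andP[v0 vS] uv; rewrite addr0.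
  apply: le_trans (_ : _ <= (c * (v - u) `^ al) `^ p) _.
    by rewrite ge0_ler_powR ?nnegrE ?mulr_ge0 ?powR_ge0// hf// ltW.
  by rewrite powRM ?powR_ge0// -powRrM alp powRr1 ?mulrBr// subr_ge0 ltW.
move: aS lS; rewrite /= !in_itv /= => /andP[a0 _] /andP[_ lS].
rewrite -mulrBr ler_wpM2l ?powR_ge0//; lra.
Qed.

End VariationSums.

Section VelocityVariation.
Context {R : realType} {W : normedModType R}.
Variables (V : R -> W) (ud : nat -> nat -> W) (S c c' be p : R) (j0 : nat).
Hypotheses (be_gt0 : 0 < be) (bep : 1 < be * p) (S_ge0 : 0 <= S).
Hypothesis V_bnd : forall s, 0 <= s <= S -> `|V s| <= c.
Hypothesis V_dist : forall s j, 0 <= s <= S -> (j0 <= j)%N ->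
  `|V s - ud j (fl j s)| <= c' * dy j `^ be.

Let p_gt0 : 0 < p.
Proof. by rewrite -(pmulr_rgt0 _ be_gt0) (lt_trans _ bep). Qed.
Let A : R := Num.max (2 * c / dy j0 `^ be) (2 * c' * 2 `^ be).
Let rho := be * p.
Let g J (s : R) : R := A `^ p * \sum_(j < J) dy j `^ rho * (fl j s)%:R.

Let c0 : 0 <= c.
Proof. by apply: le_trans (V_bnd (s := 0) _) => //; rewrite lexx. Qed.

Let A0 : 0 <= A.
Proof. by rewrite le_max divr_ge0 ?powR_ge0// mulr_ge0. Qed.

Let jump_bound a b j : 0 <= a -> a < b -> b <= S -> (j0 <= j)%N ->
  (forall i, (j0 <= i < j)%N -> fl i a = fl i b) ->
  `|V b - V a| <= A * dy j `^ be.
Proof.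
move=> a0 ab bS j0j eqf; have aS : 0 <= a <= S by rewrite a0 (le_trans (ltW ab)).
have bS' : 0 <= b <= S by rewrite bS (le_trans a0 (ltW ab)).
move: j0j; rewrite leq_eqVlt => /orP[/eqP<-|].
  apply: le_trans (ler_normB _ _) _; apply: le_trans (lerD (V_bnd bS') (V_bnd aS)) _.
  rewrite -ler_pdivrMr ?powR_gt0 ?dy_gt0// le_max; apply/orP; left.
  by rewrite -mulr2n mulr_natl.
case: j eqf => [//|j] eqf; rewrite ltnS => j0j.
have -> : V b - V a = (V b - ud j (fl j b)) - (V a - ud j (fl j a)).
  by rewrite eqf ?j0j ?ltnSn// opprB addrA subrK.
apply: le_trans (ler_normB _ _) _.
apply: le_trans (lerD (V_dist bS' j0j) (V_dist aS j0j)) _.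
rewrite -powR_dyS -mulrDl mulrA ler_wpM2r ?powR_ge0// le_max; apply/orP; right.
by rewrite -mulr2n mulr_natl.
Qed.

Let g_mono J a b : a <= b -> g J a <= g J b.
Proof.
move=> ab; rewrite ler_wpM2l ?powR_ge0// ler_sum// => j _.
by rewrite ler_wpM2l ?powR_ge0// ler_nat fl_mono.
Qed.

Let g_jump J a b j : a <= b -> (j < J)%N -> fl j a != fl j b ->
  A `^ p * dy j `^ rho <= g J b - g J a.
Proof.
move=> ab jJ fab; rewrite /g -mulrBr ler_wpM2l ?powR_ge0// -sumrB.
rewrite (bigD1 (Ordinal jJ))//= -[leLHS]addr0 lerD//.
  rewrite -mulrBr ler_peMr ?powR_ge0// -natrB ?fl_mono// ler1n subn_gt0.
  by rewrite ltn_neqAle fab fl_mono.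
apply: sumr_ge0 => i _.
by rewrite -mulrBr mulr_ge0 ?powR_ge0// subr_ge0 ler_nat fl_mono.
Qed.

Let incr_bound J a b : (j0 <= J)%N -> 0 <= a -> a < b -> b <= S ->
  `|V b - V a| `^ p <= g J b - g J a + A `^ p * dy J `^ rho.
Proof.
move=> j0J a0 ab bS.
have pw j : `|V b - V a| <= A * dy j `^ be -> `|V b - V a| `^ p <= A `^ p * dy j `^ rho.
  move=> h; rewrite /rho powRrM -powRM ?powR_ge0//.
  by rewrite ge0_ler_powR ?nnegrE ?mulr_ge0 ?powR_ge0 ?(ltW p_gt0).
pose P i : Prop := (j0 <= i)%N /\ fl i a != fl i b.
have [[i [iJ Pi]]|nP] := pselect (exists i, (i < J)%N /\ P i).
  have [j0f ff] : P (first P) by apply: firstP; exists i.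
  have fJ : (first P < J)%N by apply: leq_ltn_trans iJ; exact: first_le.
  apply: le_trans (pw (first P) _) _.
    apply: jump_bound => // k /andP[j0k kf]; apply/eqP/negP => /negP kab.
    by have := @first_le P k (conj j0k kab); rewrite leqNgt kf.
  apply: le_trans (g_jump (ltW ab) fJ ff) _.
  by rewrite lerDl mulr_ge0 ?powR_ge0.
apply: le_trans (pw J _) _.
  apply: jump_bound => // k /andP[j0k kJ]; apply/eqP/negP => /negP kab.
  by apply: nP; exists k.
by rewrite lerDr subr_ge0 g_mono// ltW.
Qed.

Let ka := rho - 1.
Let ka_gt0 : 0 < ka. Proof. by rewrite subr_gt0. Qed.
Let geo_bound J : \sum_(j < J) dy j `^ ka <= 2 `^ ka / (2 `^ ka - 1) :> R.
Proof.
have k1 : 0 < 2 `^ ka - 1 :> R by rewrite subr_gt0 powR2_gt1.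
suff : \sum_(j < J) dy j `^ ka <= 2 `^ ka / (2 `^ ka - 1) * (1 - dy J `^ ka) :> R.
  move/le_trans; apply; rewrite ler_piMr ?divr_ge0 ?powR_ge0 ?(ltW k1)//.
  by rewrite gerBl powR_ge0.
elim: J => [|J IH]; first by rewrite big_ord0 /dy expr0 powR1 subrr mulr0.
rewrite big_ord_recr /=; apply: le_trans (lerD IH (lexx _)) _.
rewrite -powR_dyS; set u := dy J.+1 `^ ka; set t := 2 `^ ka in k1 *.
rewrite le_eqVlt; apply/orP; left; apply/eqP; field.
by rewrite gt_eqF.
Qed.

Let g_bound J s : 0 <= s -> g J s <= A `^ p * (2 `^ ka / (2 `^ ka - 1)) * s.
Proof.
move=> s0; rewrite -mulrA ler_wpM2l ?powR_ge0//.
apply: le_trans (_ : _ <= (\sum_(j < J) dy j `^ ka) * s) _; last first.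
  by rewrite ler_wpM2r// geo_bound.
rewrite mulr_suml ler_sum// => j _.
have -> : rho = ka + 1 by rewrite /ka subrK.
rewrite powRD ?(gt_eqF (dy_gt0 _)) ?implybT// powRr1 ?dy_ge0// -mulrA.
by rewrite ler_wpM2l ?powR_ge0// mulrC fl_le.
Qed.

(** Let [j] be the first level, from [j0] on, at which the floors of [a] and [b]
    differ. If [j0 < j], the two velocities are close to the same value of level
    [j - 1], and in any case they are at distance at most [A 2 ^ (- j be)]; and
    the [p]-th power of this number is at most the increment from [a] to [b] of the nondecreasing step function
    [A ^ p sum_(j < J) 2 ^ (- j be p) fl j]. As [1 < be p], the total increment
    of this function is bounded independently of [J]. Increments that are
    invisible at the levels below [J] contribute an error that vanishes as [J]
    grows. *)
Lemma velo_var_sum : exists M, forall s, sorted <%R s -> [set` s] `<=` `[0, S] ->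
  var_sum p V s <= M.
Proof.
exists (A `^ p * (2 `^ ka / (2 `^ ka - 1)) * S + 1) => s ss sE.
have k1 : 0 < 2 `^ ka - 1 :> R by rewrite subr_gt0 powR2_gt1.
case: s ss sE => [|a t] ss sE.
  rewrite /var_sum /= big_ord0 addr_ge0// mulr_ge0// mulr_ge0 ?powR_ge0// divr_ge0 ?powR_ge0//.
  exact: ltW.
have rho_gt0 : 0 < rho by rewrite (lt_trans _ bep).
have [J1 hJ] := powR_dy_small rho_gt0 (mulr_ge0 (ler0n R (size t)) (powR_ge0 A p)) ltr01.
pose J := maxn J1 j0.
have := @var_sum_le _ _ p V `[0, S]%classic (g J) (A `^ p * dy J `^ rho) a t _ ss sE.
move=> h; apply: le_trans (h _) _.
  move=> u v; rewrite /= !in_itv /= => /andP[u0 uS] /andP[v0 vS] uv.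
  by apply: incr_bound => //; rewrite leq_maxr.
have aS : `[0, S]%classic a by apply: sE; rewrite /= mem_head.
have lS : `[0, S]%classic (last a t) by apply: sE; rewrite /= mem_last.
move: aS lS; rewrite /= !in_itv /= => /andP[a0 _] /andP[l0 lS].
rewrite lerD//; last by rewrite mulrA hJ// leq_maxl.
have ga : 0 <= g J a.
  rewrite mulr_ge0 ?powR_ge0// sumr_ge0// => j _.
  by rewrite mulr_ge0 ?powR_ge0.
apply: le_trans (_ : _ <= g J (last a t)) _; first by rewrite gerBl.
apply: le_trans (g_bound _ l0) _.
by rewrite ler_wpM2l// mulr_ge0 ?powR_ge0// divr_ge0 ?powR_ge0// ltW.
Qed.

End VelocityVariation.

(** * Sums over partitions *)

Section PartitionSums.
Context {R : realType} {W : zmodType}.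
Implicit Types (h : R -> R -> W) (a b : R) (t : seq R).

Definition part_sum h a t : W := \sum_(k < size t) h (a :: t)`_k t`_k.

Lemma part_sum_nil h a : part_sum h a [::] = 0.
Proof. by rewrite /part_sum big_ord0. Qed.

Lemma part_sum_cons h a b t : part_sum h a (b :: t) = h a b + part_sum h b t.
Proof. by rewrite /part_sum /= big_ord_recl. Qed.

Lemma eq_part_sum (E : set R) h h' a t : [set` a :: t] `<=` E ->
  (forall u w, E u -> E w -> h u w = h' u w) -> part_sum h a t = part_sum h' a t.
Proof.
move=> + hh; elim: t a => [|b t IH] a tE; first by rewrite !part_sum_nil.
rewrite !part_sum_cons IH; last by move=> u ub; apply: tE; rewrite /= in_cons ub orbT.
by rewrite hh//; apply: tE => /=; rewrite ?mem_head// in_cons mem_head orbT.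
Qed.

Lemma part_sumB h h' a t :
  part_sum (fun u w => h u w - h' u w) a t = part_sum h a t - part_sum h' a t.
Proof. by rewrite /part_sum sumrB. Qed.

Lemma part_sum_sum n (h : 'I_n -> R -> R -> W) a t :
  part_sum (fun u w => \sum_i h i u w) a t = \sum_i part_sum (h i) a t.
Proof. by rewrite /part_sum exchange_big. Qed.

(** The last point of the partition [a :: t] when all of them lie before [tau]. *)
Fixpoint first_after (tau a : R) t : R :=
  if tau <= a then a else if t is b :: t' then first_after tau b t' else a.

Lemma part_sum_after (G : R -> W) tau a t : path <%R a t ->
  part_sum (fun u w => if tau <= u then G w - G u else 0) a t =
  G (last a t) - G (first_after tau a t).
Proof.
elim: t a => [|b t IH] a /=; first by rewrite part_sum_nil if_same subrr.
move=> /andP[ab bt]; rewrite part_sum_cons IH//.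
have [taua|] := leP tau a; last by rewrite add0r.
have -> : first_after tau b t = b.
  by case: (t) => [|? ?] /=; rewrite (le_trans taua (ltW ab)).
by rewrite addrC addrA subrK.
Qed.

End PartitionSums.

Section FirstAfter.
Context {R : realType}.
Implicit Types (tau a b : R) (t : seq R).

Lemma path_le_last a t : path <%R a t -> a <= last a t.
Proof.
elim: t a => [|b t IH] a //= /andP[ab /IH]; exact: le_trans (ltW ab).
Qed.

Lemma mem_path_le_last a t u : path <%R a t -> u \in a :: t -> u <= last a t.
Proof.
elim: t a => [|b t IH] a; first by rewrite inE => _ /eqP->.
move=> abt; rewrite inE => /orP[/eqP->|ub]; first exact: path_le_last.
by apply: IH ub; case/andP: abt.
Qed.

Lemma first_after_itv tau a t : path <%R a t -> a <= first_after tau a t <= last a t.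
Proof.
elim: t a => [|b t IH] a /=; first by rewrite if_same lexx.
move=> /andP[ab bt]; have [_|_] := leP tau a.
  by rewrite lexx (le_trans (ltW ab))// path_le_last.
by have /andP[h ->] := IH b bt; rewrite (le_trans (ltW ab)).
Qed.

Lemma first_after_mono tau tau' a t : path <%R a t -> tau <= tau' ->
  first_after tau a t <= first_after tau' a t.
Proof.
elim: t a => [|b t IH] a /=; first by rewrite !if_same.
move=> /andP[ab bt] tt'; have [ta|at_] := leP tau a.
  have [//|_] := leP tau' a; have /andP[h _] := first_after_itv tau' bt.
  exact: le_trans (ltW ab) h.
by rewrite [tau' <= a]leNgt (lt_le_trans at_ tt') /=; apply: IH.
Qed.

Lemma first_after_gt tau a t : path <%R a t -> last a t < tau ->
  first_after tau a t = last a t.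
Proof.
elim: t a => [|b t IH] a /=; first by rewrite if_same.
move=> /andP[ab bt] lt; rewrite leNgt (le_lt_trans _ lt) ?IH//.
by rewrite (le_trans (ltW ab))// path_le_last.
Qed.

Lemma first_after_dist tau a t eta : path <%R a t -> a <= tau <= last a t ->
  0 <= eta -> (forall k, (k < size t)%N -> t`_k - (a :: t)`_k <= eta) ->
  tau <= first_after tau a t <= tau + eta.
Proof.
elim: t a => [|b t IH] a /=.
  by move=> _ /andP[h1 h2] eta0 _; rewrite if_same h2 (le_trans h1)// lerDl.
move=> /andP[ab bt] /andP[h1 h2] eta0 gap.
have [h3|h3] := leP tau a; first by rewrite h3 (le_trans h1)// lerDl.
have [h4|h4] := leP b tau.
  by apply: IH; rewrite ?h4// => k kt; apply: (gap k.+1).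
have -> : first_after tau b t = b.
  by case: (t) => [|? ?] /=; rewrite (ltW h4).
rewrite (ltW h4)/=; have /= := gap 0%N isT.
by rewrite lerBlDl => /le_trans; apply; rewrite lerD2r ltW.
Qed.

Lemma mesh_gap a t eta k : mesh a t < eta -> (k < size t)%N -> t`_k - (a :: t)`_k <= eta.
Proof.
move=> me kt; apply: le_trans (ltW me).
exact: (le_bigmax 0 (fun i : 'I_(size t) => t`_i - (a :: t)`_i) (Ordinal kt)).
Qed.

End FirstAfter.

(** * Young integral of a càdlàg dyadic path against a Hölder path *)

Section YoungPath.
Context {R : realType} {e d : nat}.
Variables (al be H S c : R) (X : R -> 'cV[R]_d) (j0 : nat).
Variable ud : nat -> nat -> 'M[R]_(e, d).
Hypotheses (al_gt0 : 0 < al) (al_le1 : al <= 1) (be_gt0 : 0 < be)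
  (th_gt1 : 1 < al + be) (H_ge0 : 0 <= H) (c_ge0 : 0 <= c).
Hypothesis X_holder : forall a b, 0 <= a -> a <= b ->
  `|X b - X a| <= H * (b - a) `^ al.
Hypothesis ud_double : forall j k, k%:R * dy j <= S -> ud j.+1 k.*2 = ud j k.
Hypothesis ud_mid : forall j k, (j0 <= j)%N -> k.*2.+1%:R * dy j.+1 <= S ->
  `|ud j.+1 k.*2.+1 - ud j k| <= c * dy j.+1 `^ be.

Let V := dyadic_path ud.
Let ka := al + be - 1.
Let ka_gt0 : 0 < ka. Proof. by rewrite subr_gt0. Qed.
Let ka1 : 0 < 2 `^ ka - 1 :> R. Proof. by rewrite subr_gt0 powR2_gt1. Qed.

Variables (s : R) (t : seq R).
Hypotheses (s_itv : 0 <= s <= S) (t_path : path <%R 0 t) (t_last : last 0 t = s).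

Let s_ge0 : 0 <= s. Proof. by case/andP: s_itv. Qed.

Let t_itv : [set` (0 : R) :: t] `<=` [set u | 0 <= u <= s].
Proof.
move=> u /=; rewrite -t_last; elim: t (0 : R) t_path u => [|b l IH] a /=.
  by move=> _ u; rewrite inE => /eqP ->; rewrite lexx.
move=> /andP[ab bl] u; rewrite inE => /orP[/eqP->|/(IH b bl) /andP[bu ->]].
  by rewrite lexx (le_trans (ltW ab))// path_le_last.
by rewrite (le_trans (ltW ab)).
Qed.

Let w j i := first_after (i%:R * dy j) 0 t.

Let w_itv j i : 0 <= w j i <= s.
Proof. by rewrite -t_last; apply: first_after_itv. Qed.

Let w_mono j i : w j i <= w j i.+1.
Proof. by apply: first_after_mono => //; rewrite ler_wpM2r ?dy_ge0// ler_nat. Qed.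

(** For a step function of level [j], the terms of a sum over a partition are
    grouped according to the dyadic interval that contains the left end, and
    telescope in each group. *)
Lemma level_sum j (G : nat -> 'M[R]_(e, d)) :
  part_sum (fun u u' => G (fl j u) *m (X u' - X u)) 0 t =
  \sum_(i < (fl j s).+1) G i *m (X (w j i.+1) - X (w j i)).
Proof.
pose ind i u u' := if i%:R * dy j <= u then X u' - X u else 0.
rewrite (@eq_part_sum _ _ [set u | 0 <= u <= s] _
  (fun u u' => \sum_(i < (fl j s).+1) G i *m (ind i u u' - ind i.+1 u u'))) //.
  rewrite part_sum_sum; apply: eq_bigr => i _.
  have -> : part_sum (fun u u' => G i *m (ind i u u' - ind i.+1 u u')) 0 t =
      G i *m part_sum (fun u u' => ind i u u' - ind i.+1 u u') 0 t.
    by rewrite /part_sum mulmx_sumr.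
  rewrite part_sumB !part_sum_after// -/(w j i) -/(w j i.+1).
  by congr (_ *m _); rewrite opprB addrC addrA subrK.
move=> u u' /= /andP[u0 us] _.
have fu : (fl j u < (fl j s).+1)%N by rewrite ltnS fl_mono.
have ub k : (k%:R * dy j <= u) = (k <= fl j u)%N.
  by rewrite -ler_pdivlMr ?dy_gt0// truncn_ge_nat// divr_ge0 ?dy_ge0.
rewrite (bigD1 (Ordinal fu))//= big1 ?addr0.
  by rewrite /ind !ub leqnn ltnn subr0.
move=> i /eqP iu; rewrite /ind !ub.
have [h|h|h] := ltngtP i (fl j u).
- by rewrite /= subrr mulmx0.
- by rewrite /= subrr mulmx0.
- by case: iu; apply: val_inj.
Qed.

Let level_const := d%:R * c * H * (2 * S + 1).

Let Sj j := part_sum (fun u u' => ud j (fl j u) *m (X u' - X u)) 0 t.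

(** A power is at most affine: this bounds the increments of [X] between
    successive groups of a partition, which may be longer than the mesh [del],
    while their lengths have a bounded sum. *)
Let powR_split (x del : R) : 0 <= x -> 0 < del ->
  x `^ al <= del `^ al + del `^ al / del * x.
Proof.
move=> x0 del0; have [xd|dx] := leP x del.
  apply: le_trans (_ : _ <= del `^ al) _.
    by rewrite ge0_ler_powR ?nnegrE ?(ltW al_gt0) ?(ltW del0).
  by rewrite lerDl mulr_ge0// divr_ge0 ?powR_ge0// ltW.
apply: le_trans (_ : _ <= del `^ al / del * x) _; last first.
  by rewrite lerDr powR_ge0.
have x0' : 0 < x := lt_trans del0 dx.
have E (y : R) : 0 < y -> y `^ al = y * y `^ (al - 1).
  move=> y0; rewrite -{2}[y]powRr1 ?(ltW y0)// -powRD ?(gt_eqF y0) ?implybT//.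
  by rewrite addrC subrK.
rewrite !E// [del * _]mulrC mulfK ?gt_eqF// mulrC ler_wpM2r ?(ltW x0')//.
rewrite -[al - 1]opprB !powRN lef_pV2 ?posrE ?powR_gt0//.
by rewrite ge0_ler_powR ?nnegrE ?(ltW x0') ?(ltW del0) ?(ltW dx)// subr_ge0.
Qed.

Let level_step j : (j0 <= j)%N -> `|Sj j.+1 - Sj j| <= level_const * dy j.+1 `^ ka.
Proof.
move=> j0j; pose D i := ud j.+1 i - ud j i./2.
have -> : Sj j.+1 - Sj j = part_sum (fun u u' => D (fl j.+1 u) *m (X u' - X u)) 0 t.
  rewrite /Sj -part_sumB; apply: (@eq_part_sum _ _ [set u | 0 <= u <= s]) => //.
  move=> u u' /= /andP[u0 us] _; rewrite -mulmxBl /D.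
  by have [->|->] := flS j u0; rewrite /= ?uphalf_double ?doubleK.
rewrite level_sum; set n := (fl j.+1 s).+1; set del := dy j.+1 : R.
have del0 : 0 < del := dy_gt0 _.
apply: le_trans (ler_norm_sum _ _ _) _.
have Db i : i%:R * del <= S -> `|D i| <= c * del `^ be.
  rewrite /D; have := odd_double_half i; case: (odd i) => /= <-; last first.
    rewrite add0n doubleK => iS; rewrite ud_double ?subrr ?normr0 ?mulr_ge0 ?powR_ge0//.
    by move: iS; rewrite -muln2 natrM -mulrA -dyS.
  by rewrite add1n /= uphalf_double; apply: ud_mid.
have ns : (fl j.+1 s)%:R * del <= s by rewrite fl_le.
apply: le_trans (_ : _ <= \sum_(i < n) d%:R * (c * del `^ be) *
    (H * (del `^ al + del `^ al / del * (w j.+1 i.+1 - w j.+1 i)))) _.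
  apply: ler_sum => i _; apply: le_trans (norm_mulmx _ _) _.
  have wi := w_mono j.+1 i; have /andP[wi0 _] := w_itv j.+1 i.
  apply: ler_pM => //.
    rewrite ler_wpM2l//; apply: Db; apply: le_trans (le_trans ns _).
      by rewrite ler_wpM2r ?(ltW del0)// ler_nat -ltnS.
    by case/andP: s_itv.
  apply: le_trans (X_holder wi0 wi) _; rewrite ler_wpM2l//.
  by apply: powR_split; rewrite ?subr_ge0.
rewrite -mulr_sumr -mulr_sumr big_split /= -mulr_sumr sumr_const card_ord.
rewrite -(big_mkord xpredT (fun i => w j.+1 i.+1 - w j.+1 i)) telescope_sumr//.
have /andP[_ wn] := w_itv j.+1 n; have /andP[w0 _] := w_itv j.+1 0.
have sS : s <= S by case/andP: s_itv.
have kaE : del `^ ka = del `^ be * (del `^ al / del).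
  rewrite mulrA -powRD ?(gt_eqF del0) ?implybT// addrC /ka.
  by rewrite powRB ?(gt_eqF del0) ?implybT// powRr1// ltW.
rewrite kaE /level_const.
set p := del `^ al / del; set D' := del `^ be.
have p0 : 0 <= p by rewrite divr_ge0 ?powR_ge0// ltW.
have -> : d%:R * (c * D') * (H * (del `^ al *+ n + p * (w j.+1 n - w j.+1 0%N))) =
    (d%:R * c * H * D') * (p * (n%:R * del + (w j.+1 n - w j.+1 0%N))).
  have -> : del `^ al *+ n = p * (n%:R * del).
    by rewrite mulrCA /p divfK ?gt_eqF// mulr_natl.
  ring.
have -> : d%:R * c * H * (2 * S + 1) * (D' * p) = d%:R * c * H * D' * (p * (2 * S + 1)).
  by ring.
rewrite ler_wpM2l ?mulr_ge0 ?powR_ge0// ler_wpM2l//.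
have nd : n%:R * del <= s + 1.
  by rewrite -natr1 mulrDl mul1r lerD// dy_le1.
lra.
Qed.

Let level_const_ge0 : 0 <= level_const.
Proof.
have S0 : 0 <= S by case/andP: s_itv => _; apply: le_trans.
by rewrite !mulr_ge0// addr_ge0// mulr_ge0.
Qed.

Let level_steps j l : (j0 <= j)%N ->
  `|Sj (j + l) - Sj j| <= path_const level_const ka * (dy j `^ ka - dy (j + l) `^ ka).
Proof.
move=> j0j; elim: l => [|l IH]; first by rewrite addn0 !subrr normr0 mulr0.
have h := @level_step (j + l)%N (leq_trans j0j (leq_addr _ _)).
rewrite addnS; move: (j + l)%N IH h => i IH h.
have -> : Sj i.+1 - Sj j = (Sj i.+1 - Sj i) + (Sj i - Sj j) by rewrite addrA subrK.
apply: le_trans (ler_normD _ _) _; apply: le_trans (lerD h IH) _.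
have -> : level_const * dy i.+1 `^ ka = path_const level_const ka * (dy i `^ ka - dy i.+1 `^ ka).
  rewrite -(powR_dyS ka i) -{3}[dy i.+1 `^ ka]mul1r -mulrBl mulrA divfK//.
  by rewrite gt_eqF.
by rewrite -mulrDr addrC addrA subrK.
Qed.

(** From the level [j] to the level [j + 1], the step function changes by at most
    [c 2 ^ (- (j + 1) be)], and the increments of [X] over the groups of the
    partition sum to a multiple of [2 ^ ((j + 1) (1 - al))]. As [1 < al + be],
    the corrections form a convergent geometric series. The bound is independent
    of the partition. *)
Lemma young_sum_level j : (j0 <= j)%N ->
  `|young_sum V X 0 t - part_sum (fun u u' => ud j (fl j u) *m (X u' - X u)) 0 t|
  <= path_const level_const ka * dy j `^ ka.
Proof.
move=> j0j; have Scvg : Sj i @[i --> \oo] --> young_sum V X 0 t.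
  rewrite -[young_sum _ _ _ _]/(part_sum (fun u u' => V u *m (X u' - X u)) 0 t) /Sj.
  suff gen l a : [set` a :: l] `<=` [set u | 0 <= u <= s] ->
      part_sum (fun u u' => ud i (fl i u) *m (X u' - X u)) a l @[i --> \oo] -->
      part_sum (fun u u' => V u *m (X u' - X u)) a l by exact: gen t_itv.
  elim: l a => [|b l IH] a tE.
    rewrite part_sum_nil; under eq_fun do rewrite part_sum_nil; exact: cvg_cst.
  rewrite part_sum_cons; under eq_fun do rewrite part_sum_cons.
  apply: cvgD; last by apply: IH => u ub; apply: tE; rewrite /= in_cons ub orbT.
  apply: cvg_mulmxl; apply: (dyadic_path_cvg be_gt0 c_ge0 ud_double ud_mid).
  have /andP[a0 as_] : 0 <= a <= s by apply: tE; rewrite /= mem_head.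
  by rewrite a0 (le_trans as_)//; case/andP: s_itv.
apply: cvg_norm_le (cvgB Scvg (cvg_cst (Sj j))) _.
exists j => // i /= ji.
have := @level_steps j (i - j)%N j0j; rewrite subnKC// => h.
apply: le_trans h _.
by rewrite ler_wpM2l ?path_const_ge0// gerBl powR_ge0.
Qed.

End YoungPath.

Section YoungIntegralPath.
Context {R : realType} {e d : nat}.
Variables (F : 'cV[R]_e -> set 'M[R]_(e, d)).
Variables (al ga H S : R) (X : R -> 'cV[R]_d) (K : set 'cV[R]_e) (j0 : nat) (c : R).
Variables (yd : nat -> nat -> 'cV[R]_e) (ud : nat -> nat -> 'M[R]_(e, d)).
Hypotheses (al_gt0 : 0 < al) (al_le1 : al <= 1) (ga_gt0 : 0 < ga)
  (th_gt1 : 1 < al + al * ga) (H_ge0 : 0 <= H).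
Hypothesis X_holder : forall a b, 0 <= a -> a <= b ->
  `|X b - X a| <= H * (b - a) `^ al.
Hypothesis sol : dyadic_solution F al ga X S K j0 c yd ud.

Let be := al * ga.
Let be_gt0 : 0 < be. Proof. by rewrite mulr_gt0. Qed.
Let ka := al + be - 1.
Let ka_gt0 : 0 < ka. Proof. by rewrite subr_gt0. Qed.
Let c_ge0 : 0 <= c := ds_ge0 sol.
Let Y := dyadic_path yd.
Let V := dyadic_path ud.

Section Partition.
Variables (s : R) (J : nat) (cY : R).
Hypotheses (s_itv : 0 <= s <= S) (j0J : (j0 <= J)%N).
Hypothesis Y_dist : `|Y s - yd J (fl J s)| <= cY * dy J `^ al.

Let m := fl J s.
Let del : R := dy J.
Let s_ge0 : 0 <= s. Proof. by case/andP: s_itv. Qed.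
Let del_gt0 : 0 < del := dy_gt0 J.
Let ptS i : (i <= m)%N -> i%:R * del <= s.
Proof.
move=> im; apply: le_trans (fl_le J s_ge0).
by rewrite ler_wpM2r ?(ltW del_gt0)// ler_nat.
Qed.
Let ptSS i : (i <= m)%N -> i%:R * del <= S.
Proof. by move=> /ptS /le_trans; apply; case/andP: s_itv. Qed.

Let tau i : R := if (i <= m)%N then i%:R * del else s.

(** Along the dyadic partition of level [J] the sum of the linearizations differs
    from the increment of the position by [2 ^ J] remainders of the order of
    [2 ^ (- J (al + be))]. *)
Lemma dyadic_sum_dist :
  `|\sum_(i < m.+1) ud J i *m (X (tau i.+1) - X (tau i)) - (Y s - Y 0)| <=
  S * c * del `^ ka + (d%:R * c * H + cY) * del `^ al.
Proof.
have -> : Y s - Y 0 = \sum_(i < m) (yd J i.+1 - yd J i) + (Y s - yd J m).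
  rewrite -(big_mkord xpredT (fun i => yd J i.+1 - yd J i)) telescope_sumr//.
  have -> : Y 0 = yd J 0%N.
    rewrite -(@posn_pt _ _ _ _ _ _ _ _ _ _ _ _ _ sol J 0%N) ?mul0r//.
    by apply: le_trans (_ : s <= S); case/andP: s_itv.
  by rewrite [RHS]addrC addrA subrK.
rewrite big_ord_recr /=; have -> : tau m.+1 = s by rewrite /tau ltnn.
have -> : tau m = m%:R * del by rewrite /tau leqnn.
set A := \sum_(i < m) _; set B := \sum_(i < m) _; set D := ud J m *m _.
have -> : A + D - (B + (Y s - yd J m)) = (A - B) + (D - (Y s - yd J m)).
  by rewrite opprD addrACA.
apply: le_trans (ler_normD _ _) _; apply: lerD.
  rewrite /A /B -sumrB; apply: le_trans (ler_norm_sum _ _ _) _.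
  apply: le_trans (_ : _ <= \sum_(i < m) c * del `^ (al + be)) _.
    apply: ler_sum => i _; rewrite /tau (ltnW (ltn_ord i)) (ltn_ord i) distrC.
    by apply: (ds_rem sol) => //; apply: ptSS.
  rewrite sumr_const card_ord.
  have -> : c * del `^ (al + be) *+ m = (m%:R * del) * (c * del `^ ka).
    have -> : al + be = ka + 1 by rewrite /ka subrK.
    rewrite powRD ?(gt_eqF del_gt0) ?implybT// powRr1 ?(ltW del_gt0)//.
    by rewrite -mulr_natl; ring.
  rewrite -[leRHS]mulrA ler_wpM2r ?mulr_ge0 ?powR_ge0//.
  exact: ptSS.
apply: le_trans (ler_normB _ _) _; rewrite mulrDl; apply: lerD => //.
apply: le_trans (norm_mulmx _ _) _; rewrite -!mulrA ler_wpM2l// ler_pM//.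
  by apply: (ds_velo sol); apply: ptSS.
apply: le_trans (X_holder _ _) _; rewrite ?mulr_ge0 ?(ltW del_gt0) ?ptS//.
rewrite ler_wpM2l// ge0_ler_powR ?nnegrE ?(ltW al_gt0) ?(ltW del_gt0)//.
  by rewrite subr_ge0 ptS.
by rewrite lerBlDr -[X in X + _]mul1r -mulrDl addrC natr1 ltW ?fl_gt.
Qed.

Variables (t : seq R) (eta : R).
Hypotheses (t_path : path <%R 0 t) (t_last : last 0 t = s) (t_mesh : mesh 0 t < eta).

Let eta_ge0 : 0 <= eta.
Proof.
by apply: le_trans (ltW t_mesh); exact: bigmax_ge_id.
Qed.

Let tau_after i : (i <= m.+1)%N ->
  `|X (first_after (i%:R * del) 0 t) - X (tau i)| <= H * eta `^ al.
Proof.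
rewrite /tau; have [im _|mi im] := leqP i m; last first.
  have -> : i = m.+1 by apply/eqP; rewrite eqn_leq im.
  rewrite first_after_gt// ?t_last ?subrr ?normr0 ?mulr_ge0 ?powR_ge0//.
  exact: fl_gt.
have id : 0 <= i%:R * del by rewrite mulr_ge0// ltW.
have /andP[h1 h2] : i%:R * del <= first_after (i%:R * del) 0 t <= i%:R * del + eta.
  apply: first_after_dist => //; first by rewrite id t_last ptS.
  by move=> k; apply: mesh_gap.
apply: le_trans (X_holder id h1) _; rewrite ler_wpM2l// ge0_ler_powR ?nnegrE ?(ltW al_gt0)//.
  by rewrite subr_ge0.
by rewrite lerBlDl.
Qed.

(** Grouping the terms of a partition of mesh [eta] moves every dyadic point by at
    most [eta]. *)
Lemma level_sum_dist :
  `|part_sum (fun u u' => ud J (fl J u) *m (X u' - X u)) 0 t -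
    \sum_(i < m.+1) ud J i *m (X (tau i.+1) - X (tau i))|
  <= m.+1%:R * (d%:R * c * (2 * H)) * eta `^ al.
Proof.
rewrite (level_sum _ t_path t_last)// -sumrB.
apply: le_trans (ler_norm_sum _ _ _) _.
apply: le_trans (_ : _ <= \sum_(i < m.+1) d%:R * c * (2 * H * eta `^ al)) _; last first.
  by rewrite sumr_const card_ord -[leLHS]mulr_natl !mulrA.
apply: ler_sum => i _; rewrite -mulmxBr; apply: le_trans (norm_mulmx _ _) _.
rewrite -!mulrA ler_wpM2l// ler_pM//.
  by apply: (ds_velo sol); apply: ptSS; rewrite -ltnS ltn_ord.
have h1 := @tau_after i.+1 (ltn_ord i); have h2 := @tau_after i (ltnW (ltn_ord i)).
rewrite -/del; set a := X (first_after _ _ _) in h1 *; set b := X (first_after _ _ _) in h2 *.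
have -> : a - b - (X (tau i.+1) - X (tau i)) = (a - X (tau i.+1)) - (b - X (tau i)).
  by apply/matrixP => k l; rewrite !mxE; ring.
apply: le_trans (ler_normB _ _) _; apply: le_trans (lerD h1 h2) _.
by rewrite mulr2n mulrDl mul1r.
Qed.

End Partition.

(** The Young sum is compared with that of the step function of level [J],
    uniformly in the partition; then the partition is replaced by the dyadic one,
    as [J] is fixed and the mesh small; and the dyadic sum is compared with the
    increment of the position. *)
Lemma young_integral_path s : 0 <= s <= S -> is_young_integral V X 0 s (Y s - Y 0).
Proof.
move=> sS; have S0 : 0 <= S by case/andP: sS => ?; apply: le_trans.
pose cY := path_const c al.
have Yd j : (j0 <= j)%N -> `|Y s - yd j (fl j s)| <= cY * dy j `^ al.
  exact: (posn_dist al_gt0 sol sS).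
pose C1 := path_const (d%:R * c * H * (2 * S + 1)) ka + S * c.
pose C2 := d%:R * c * H + cY.
have L0 : 0 <= d%:R * c * H * (2 * S + 1) by rewrite !mulr_ge0// addr_ge0// mulr_ge0.
have C10 : 0 <= C1.
  by apply: addr_ge0; [exact: path_const_ge0|exact: mulr_ge0].
have C20 : 0 <= C2.
  by apply: addr_ge0; [rewrite !mulr_ge0|exact: path_const_ge0].
move=> B /nbhs_ballP[eps /= e0 epsB].
have e40 : 0 < eps / 4 by rewrite divr_gt0.
have [J1 hJ1] := powR_dy_small ka_gt0 C10 e40.
have [J2 hJ2] := powR_dy_small al_gt0 C20 e40.
pose J := maxn j0 (maxn J1 J2).
pose C3 := (fl J s).+1%:R * (d%:R * c * (2 * H)).
have C30 : 0 <= C3 by rewrite !mulr_ge0.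
have [k hk] := powR_dy_small1 al_gt0 C30 e40.
exists (dy k); first exact: dy_gt0.
move=> t [[tp /eqP tl] tm] /=; apply: epsB; rewrite -ball_normE /=.
have h1 := young_sum_level al_gt0 al_le1 be_gt0 th_gt1 H_ge0 c_ge0 X_holder
  (ds_velo2 sol) (ds_mid sol) sS tp tl (leq_maxl j0 _ : (j0 <= J)%N).
have h2 := @level_sum_dist s J sS t (dy k) tp tl tm.
have h3 := dyadic_sum_dist sS (leq_maxl _ _ : (j0 <= J)%N) (Yd J (leq_maxl _ _)).
have h4 : C1 * dy J `^ ka <= eps / 4 by apply: hJ1; rewrite !leq_max leqnn orbT.
have h5 : C2 * dy J `^ al <= eps / 4 by apply: hJ2; rewrite !leq_max leqnn !orbT.
move: h1 h2 h3; set a := young_sum _ _ _ _; set b := part_sum _ _ _; set g := \sum_(i < _) _.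
set z := Y s - Y 0 => h1 h2 h3.
rewrite distrC; have -> : a - z = (a - b) + ((b - g) + (g - z)).
  by rewrite [b - g + _]addrA subrK addrA subrK.
apply: le_lt_trans (ler_normD _ _) _.
apply: le_lt_trans (lerD h1 (le_trans (ler_normD _ _) (lerD h2 h3))) _.
rewrite -/C2 -/C3; move: h4 h5 hk; rewrite /C1 mulrDl.
set u1 := path_const _ _ * _; set u2 := S * c * _; set u3 := C2 * _; set u4 := C3 * _.
lra.
Qed.

End YoungIntegralPath.

(** * A clock for paths of finite variation *)

Section RationalVariation.
Context {R : realType} {W : normedModType R}.
Variables (q T : R) (x : R -> W).
Hypotheses (q_ge1 : 1 <= q) (q_le2 : q <= 2) (T_gt0 : 0 < T).
Hypothesis x_cont : {within `[0, T], continuous x}.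
Hypothesis x_var : Vp q `[0, T] x.

Let q_gt0 : 0 < q. Proof. exact: lt_le_trans q_ge1. Qed.

(** There are countably many rational subdivisions, so that a supremum over them
    depends measurably on the path; for a continuous path they are enough. *)
Definition rat_subdiv (D : set R) (s : seq R) : Prop :=
  sorted <%R s /\ forall u, u \in s -> D u /\ exists r : rat, u = ratr r.

Definition rat_var (D : set R) : R := sup [set var_sum q x s | s in rat_subdiv D].

Lemma var_sum_bounded : exists2 M, 0 <= M &
  forall s, sorted <%R s -> [set` s] `<=` `[0, T] -> var_sum q x s <= M.
Proof.
move: x_var; rewrite /Vp /= /pvariation; set A := [set _ | _ in _] => Alt.
have [P P0 PA] : exists2 P : R, 0 <= P & (ereal_sup A <= P%:E)%E.
  case: (ereal_sup A) Alt => [r|//|] _; last by exists 0 => //; rewrite leNye.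
  by exists (Num.max r 0); rewrite ?lee_fin le_max lexx ?orbT.
exists (P `^ q); first exact: powR_ge0.
move=> s ss sT; have v0 : 0 <= var_sum q x s by apply: sumr_ge0 => k _; exact: powR_ge0.
have : (((var_sum q x s) `^ q^-1)%:E <= P%:E)%E.
  by apply: le_trans PA; apply: ereal_sup_ubound; exists s.
rewrite lee_fin => h.
have -> : var_sum q x s = (var_sum q x s `^ q^-1) `^ q.
  by rewrite powRVK.
by rewrite ge0_ler_powR ?nnegrE ?powR_ge0 ?(ltW q_gt0).
Qed.

Lemma rat_subdiv_itv D s : D `<=` `[0, T] -> rat_subdiv D s -> [set` s] `<=` `[0, T].
Proof. by move=> DT [_ sD] u /= us; apply: DT; case: (sD u us). Qed.

Lemma rat_var_has_sup D : D `<=` `[0, T] ->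
  has_sup [set var_sum q x s | s in rat_subdiv D].
Proof.
move=> DT; split; first by exists (var_sum q x [::]), [::].
have [M _ hM] := var_sum_bounded.
exists M => _ [s sD <-]; apply: hM; [by case: sD|exact: rat_subdiv_itv sD].
Qed.

Lemma rat_var_ub D s : D `<=` `[0, T] -> rat_subdiv D s -> var_sum q x s <= rat_var D.
Proof.
by move=> DT sD; apply: ub_le_sup; [exact: (rat_var_has_sup DT).2|exists s].
Qed.

Lemma rat_var_le D M : (forall s, rat_subdiv D s -> var_sum q x s <= M) -> rat_var D <= M.
Proof.
move=> hM; apply: ge_sup; first by exists (var_sum q x [::]), [::].
by move=> _ [s sD <-]; exact: hM.
Qed.

Lemma rat_var_adherent D eps : D `<=` `[0, T] -> 0 < eps ->
  exists2 s, rat_subdiv D s & rat_var D - eps < var_sum q x s.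
Proof.
move=> DT e0; have [_ [s sD <-] lt] := sup_adherent e0 (rat_var_has_sup DT).
by exists s.
Qed.

Lemma rat_subdiv_sub D D' s : D `<=` D' -> rat_subdiv D s -> rat_subdiv D' s.
Proof. by move=> DD' [ss sD]; split=> // u /sD[/DD']. Qed.

Lemma var_sum_cat a t1 b t2 : var_sum q x (a :: t1 ++ b :: t2) =
  var_sum q x (a :: t1) + `|x b - x (last a t1)| `^ q + var_sum q x (b :: t2).
Proof.
elim: t1 a => [|a' t1 IH] a.
  by rewrite /= var_sum_cons {2}/var_sum /= big_ord0 add0r.
by rewrite /= var_sum_cons IH var_sum_cons !addrA.
Qed.

Lemma var_sum1 a : var_sum q x [:: a] = 0.
Proof. by rewrite /var_sum /= big_ord0. Qed.

Lemma var_sum_ge0 s : 0 <= var_sum q x s.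
Proof. by apply: sumr_ge0 => k _; exact: powR_ge0. Qed.

Lemma rat_subdiv_cat D s1 s2 : rat_subdiv D s1 -> rat_subdiv D s2 ->
  (forall u u', u \in s1 -> u' \in s2 -> u < u') -> rat_subdiv D (s1 ++ s2).
Proof.
move=> [ss1 h1] [ss2 h2] h12; split; last first.
  by move=> u; rewrite mem_cat => /orP[/h1|/h2].
case: s1 ss1 h1 h12 => [//|a t1] ss1 h1 h12.
rewrite /= cat_path; apply/andP; split=> //.
case: s2 ss2 h2 h12 => [//|b t2] /= ss2 h2 h12; rewrite ss2 andbT.
by apply: h12; rewrite ?mem_last ?mem_head.
Qed.

Lemma var_sum_cat_ge s1 s2 : var_sum q x s1 + var_sum q x s2 <= var_sum q x (s1 ++ s2).
Proof.
case: s1 => [|a t1]; first by rewrite /var_sum /= big_ord0 add0r.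
case: s2 => [|b t2]; first by rewrite cats0 /var_sum /= big_ord0 addr0.
by rewrite cat_cons var_sum_cat lerD2r lerDl powR_ge0.
Qed.

Lemma rat_subdiv2 (D : set R) (a b : rat) : D (ratr a) -> D (ratr b) ->
  (ratr a : R) < ratr b -> rat_subdiv D [:: ratr a; ratr b].
Proof.
move=> Da Db ab; split; first by rewrite /= ab.
by move=> u; rewrite !inE => /orP[]/eqP->; split=> //; [exists a|exists b].
Qed.

Lemma x_near t eps : 0 <= t <= T -> 0 < eps -> exists2 del, 0 < del &
  forall u, 0 <= u <= T -> `|u - t| < del -> `|x u - x t| < eps.
Proof.
move=> tT e0; have tI : t \in `[0, T]%classic by rewrite inE /= in_itv /=.
have : x @ within `[0, T] (nbhs t) --> x t.
  by have := (subspace_continuousP _ _).1 x_cont t; apply; rewrite /= in_itv.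
move=> /cvgrPdist_lt/(_ _ e0) /nbhs_ballP[del /= d0 h]; exists del => // u uT ut.
rewrite distrC; apply: h; last by rewrite /= in_itv.
by rewrite /= -ball_normE /= distrC.
Qed.

(** The interval is open at [t], which makes the variation continuous from the
    left; adding [t] makes the clock strictly increasing. *)
Definition clock t : R := t + rat_var `[0, t[.

Let itv_sub t : t <= T -> `[0, t[%classic `<=` `[0, T]%classic.
Proof.
move=> tT u /=; rewrite !in_itv /= => /andP[-> ut].
by rewrite (le_trans (ltW ut)).
Qed.

Lemma rat_var_mono a b : a <= b -> b <= T -> rat_var `[0, a[ <= rat_var `[0, b[.
Proof.
move=> ab bT; apply: rat_var_le => s sa; apply: rat_var_ub; first exact: itv_sub.
apply: rat_subdiv_sub sa => u /=; rewrite !in_itv /= => /andP[-> /lt_le_trans]; exact.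
Qed.

Lemma clock0 : clock 0 = 0.
Proof.
rewrite /clock add0r; apply/eqP; rewrite eq_le; apply/andP; split.
  apply: rat_var_le => -[|a t] [_ h]; first by rewrite /var_sum /= big_ord0.
  by have [] := h a (mem_head _ _); rewrite /= in_itv /= => /andP[a0 /(le_lt_trans a0)]; rewrite ltxx.
apply: le_trans (var_sum_ge0 [::]) _.
by apply: rat_var_ub => //; apply: itv_sub; exact: ltW.
Qed.

(** By continuity of [x] it suffices to consider rational points strictly between
    [a] and [b], which may be added to any subdivision of [[0, a)]. *)
Lemma clock_incr a b : 0 <= a -> a < b -> b <= T ->
  b - a + `|x b - x a| `^ q <= clock b - clock a.
Proof.
move=> a0 ab bT; rewrite /clock.
set ga := rat_var `[0, a[; set gb := rat_var `[0, b[.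
have step (a' b' : rat) : a < ratr a' -> (ratr a' : R) < ratr b' -> (ratr b' : R) < b ->
    ga + `|x (ratr b') - x (ratr a')| `^ q <= gb.
  move=> aa' ab' bb'; rewrite -lerBrDr; apply: rat_var_le => s sa; rewrite lerBrDr.
  have D2 : rat_subdiv `[0, b[ [:: ratr a' : R; ratr b'].
    apply: rat_subdiv2; rewrite //= in_itv /=; apply/andP; split.
    - exact: le_trans (ltW aa').
    - exact: lt_trans bb'.
    - by apply: le_trans a0 _; apply: ltW; exact: lt_trans aa' ab'.
    - exact: bb'.
  have -> : `|x (ratr b') - x (ratr a')| `^ q = var_sum q x [:: ratr a'; ratr b'].
    by rewrite var_sum_cons var_sum1 addr0.
  apply: le_trans (var_sum_cat_ge _ _) _; apply: rat_var_ub; first exact: itv_sub.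
  apply: rat_subdiv_cat D2 _.
    apply: rat_subdiv_sub sa => u /=; rewrite !in_itv /= => /andP[-> ua] /=.
    exact: lt_trans ab.
  move=> u u' /(sa.2)[]; rewrite /= in_itv /= => /andP[_ ua] _.
  rewrite !inE => /orP[]/eqP->; first exact: lt_trans aa'.
  by apply: lt_trans ua (lt_trans aa' ab').
have gab : ga <= gb by apply: rat_var_mono => //; exact: ltW.
suff : `|x b - x a| `^ q <= gb - ga by lra.
suff xab : `|x b - x a| <= (gb - ga) `^ q^-1.
  have -> : gb - ga = ((gb - ga) `^ q^-1) `^ q.
    by rewrite powRVK// subr_ge0.
  by rewrite ge0_ler_powR ?nnegrE ?powR_ge0 ?(ltW q_gt0).
apply/ler_addgt0Pr => eps e0; have e20 : 0 < eps / 2 by rewrite divr_gt0.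
have aT : 0 <= a <= T by rewrite a0 (le_trans (ltW ab)).
have bT' : 0 <= b <= T by rewrite bT (le_trans a0 (ltW ab)).
have [da da0 hda] := x_near aT e20; have [db db0 hdb] := x_near bT' e20.
have lt1 : a < Num.min ((a + b) / 2) (a + da) by rewrite lt_min ltrDl da0 andbT; lra.
have lt2 : Num.max ((a + b) / 2) (b - db) < b by rewrite gt_max ltrBlDr ltrDl db0 andbT; lra.
have [a'] := rat_in_itvoo lt1; rewrite in_itv /= lt_min => /andP[a1 /andP[a2 a3]].
have [b'] := rat_in_itvoo lt2; rewrite in_itv /= gt_max => /andP[/andP[b2 b3] b1].
have a'b' : (ratr a' : R) < ratr b' by exact: lt_trans a2 b2.
have xa' : `|x (ratr a') - x a| < eps / 2.
  apply: hda; last by rewrite gtr0_norm ?subr_gt0// ltrBlDl.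
  by rewrite (le_trans a0 (ltW a1)) (le_trans (ltW (lt_trans a'b' b1))).
have xb' : `|x (ratr b') - x b| < eps / 2.
  apply: hdb; last by rewrite distrC gtr0_norm ?subr_gt0// ltrBlDr -ltrBlDl.
  by rewrite (le_trans (ltW b1))// (le_trans a0 (ltW (lt_trans a1 a'b'))).
have st := step a' b' a1 a'b' b1.
have h : `|x (ratr b') - x (ratr a')| <= (gb - ga) `^ q^-1.
  have -> : `|x (ratr b') - x (ratr a')| = (`|x (ratr b') - x (ratr a')| `^ q) `^ q^-1.
    by rewrite powRKV.
  by rewrite ge0_ler_powR ?nnegrE ?powR_ge0 ?invr_ge0 ?subr_ge0 ?(ltW q_gt0)// lerBrDl.
have subr_via (p r u w : W) : u - w = (p - r) - (p - u) + (r - w).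
  by rewrite opprB [p - r + _]addrC !subrKA.
rewrite (subr_via (x (ratr b')) (x (ratr a'))).
apply: le_trans (ler_normD _ _) _; apply: le_trans (lerD (ler_normB _ _) (lexx _)) _.
by rewrite (splitr eps) addrA !lerD// ltW.
Qed.

Lemma clock_lt a b : 0 <= a -> a < b -> b <= T -> clock a < clock b.
Proof.
move=> a0 ab bT; rewrite -subr_gt0; apply: lt_le_trans (clock_incr a0 ab bT).
by rewrite ltr_wpDr ?powR_ge0// subr_gt0.
Qed.

(** A finite subdivision of [[0, t)] that almost attains the supremum ends
    before [t]. *)
Lemma clock_left t eps : 0 < t -> t <= T -> 0 < eps ->
  exists2 del, 0 < del & forall u, 0 <= u -> t - del < u -> u <= t -> clock t - clock u <= eps.
Proof.
move=> t0 tT e0; have e20 : 0 < eps / 2 by rewrite divr_gt0.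
have [s sD hs] := rat_var_adherent (itv_sub tT) e20.
pose l := last 0 s.
have lt : l < t.
  rewrite /l; case: (s) sD => [//|a r] [_ h] /=.
  by have [] := h _ (mem_last a r); rewrite /= in_itv /= => /andP[].
have sl u : u \in s -> u <= l.
  rewrite /l; case: (s) sD => [//|a r] [ar _] us.
  exact: mem_path_le_last ar us.
exists (Num.min (eps / 2) (t - l)); first by rewrite lt_min e20 subr_gt0.
move=> u u0 + ut; rewrite ltrBlDr -ltrBlDl lt_min => /andP[h1 h2].
have lu : l < u by lra.
have su : rat_subdiv `[0, u[ s.
  split; first by case: sD.
  move=> w ws; have [wt wr] := sD.2 w ws; split=> //.
  move: wt; rewrite /= !in_itv /= => /andP[-> _] /=.
  exact: le_lt_trans (sl _ ws) lu.
have := rat_var_ub (itv_sub (le_trans ut tT)) su.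
rewrite /clock; set gt := rat_var _ in hs *; set gu := rat_var _.
move: hs; set v := var_sum _ _ _; lra.
Qed.

(** Uniform continuity of the power [q] on bounded sets, obtained from
    [(1 + z) ^ q <= (1 + z) ^ 2 <= 1 + 3 z] for [z <= 1]. *)
Let powR_continuous_bound B eps : 0 <= B -> 0 < eps -> exists2 w0, 0 < w0 &
  forall A w, 0 <= A -> A <= B -> 0 <= w -> w <= w0 -> (A + w) `^ q <= A `^ q + eps.
Proof.
move=> B0 e0; pose h := (eps `^ q^-1) / 2.
have h0 : 0 < h by rewrite divr_gt0 ?powR_gt0.
have Bq : 0 <= B `^ q := powR_ge0 _ _.
have C0 : 0 < 3 * B `^ q + 1 by rewrite ltr_wpDl// mulr_ge0.
exists (Num.min h (h * Num.min 1 (eps / (3 * B `^ q + 1)))).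
  by rewrite lt_min h0/= mulr_gt0// lt_min ltr01 divr_gt0.
move=> A w A0 AB w0; rewrite le_min => /andP[wh].
rewrite mulrC -ler_pdivrMr// le_min => /andP[wh1 wh2].
have [Ah|hA] := leP A h.
  apply: le_trans (_ : _ <= (eps `^ q^-1) `^ q) _.
    rewrite ge0_ler_powR ?nnegrE ?powR_ge0 ?(ltW q_gt0) ?addr_ge0//.
    by rewrite [leRHS]splitr lerD.
  by rewrite powRVK ?(ltW e0)// lerDr powR_ge0.
have Agt : 0 < A := lt_trans h0 hA.
have -> : A + w = A * (1 + w / A) by rewrite mulrDr mulr1 mulrCA divff ?gt_eqF// mulr1.
have wA0 : 0 <= w / A by rewrite divr_ge0.
have wA : w / A <= w / h by rewrite ler_wpM2l// lef_pV2 ?posrE// ltW.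
rewrite powRM ?addr_ge0//.
have E : (1 + w / A) `^ q <= 1 + 3 * (w / h).
  apply: le_trans (_ : (1 + w / A) `^ 2 <= _).
    by rewrite ler_powR// lerDl.
  rewrite powR_mulrn ?addr_ge0// expr2; set z := w / A in wA0 wA *; set y := w / h in wA wh1 *.
  have : z * z <= z by rewrite ler_piMr// (le_trans wA).
  lra.
apply: le_trans (ler_wpM2l (powR_ge0 A q) E) _.
rewrite mulrDr mulr1 lerD2l.
have AqB : A `^ q <= B `^ q by rewrite ge0_ler_powR ?nnegrE ?(ltW q_gt0).
have wh0 : 0 <= w / h by rewrite divr_ge0// ltW.
apply: le_trans (_ : (3 * B `^ q + 1) * (w / h) <= _); last first.
  by rewrite mulrC -ler_pdivlMr.
rewrite mulrCA mulrA ler_wpM2r//.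
apply: le_trans (_ : 3 * B `^ q <= _); last by rewrite lerDl.
by rewrite ler_wpM2l.
Qed.

(** A subdivision of [(t, T)] that attains the supremum up to [eps] leaves at most
    [eps] to the subdivisions that lie before its first point. *)
Let rat_var_right t eps : 0 <= t -> t < T -> 0 < eps ->
  exists2 h, t < h <= T & rat_var `]t, h[ <= eps.
Proof.
move=> t0 tT e0.
have DT h : h <= T -> `]t, h[%classic `<=` `[0, T]%classic.
  move=> hT u /=; rewrite !in_itv /= => /andP[tu uh].
  by rewrite (le_trans t0 (ltW tu)) (le_trans (ltW uh)).
have [[|b r] sD hs] := rat_var_adherent (DT _ (lexx T)) e0.
  exists T; first by rewrite tT lexx.
  by move: hs; rewrite /var_sum /= big_ord0 ltrBlDr add0r => /ltW.
have := sD.2 b (mem_head _ _); rewrite /= in_itv /= => -[/andP[tb bT] _].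
exists b; first by rewrite tb ltW.
apply: rat_var_le => s sb.
have h : var_sum q x (s ++ b :: r) <= rat_var `]t, T[.
  apply: rat_var_ub; first exact: DT.
  apply: (rat_subdiv_cat _ sD).
    apply: rat_subdiv_sub sb => u /=; rewrite !in_itv /= => /andP[-> ub] /=.
    exact: lt_trans bT.
  move=> u u' /(sb.2)[]; rewrite /= in_itv /= => /andP[_ ub] _.
  rewrite inE => /orP[/eqP->//|u'r]; apply: (lt_trans ub).
  have := sD.1; rewrite /= (path_sortedE lt_trans) => /andP[/allP + _].
  by apply.
have h2 := var_sum_cat_ge s (b :: r).
move: hs h h2; set v1 := var_sum q x (_ :: _); set v2 := var_sum q x (_ ++ _).
set v3 := var_sum q x s; set v4 := rat_var _; lra.
Qed.

(** The point [t] may be added to a subdivision as it is a limit of rational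
    points from the left. *)
Let rat_var_last t a r : 0 <= t -> t <= T -> rat_subdiv `[0, t] (a :: r) ->
  var_sum q x (a :: r) + `|x t - x (last a r)| `^ q <= rat_var `[0, t[.
Proof.
move=> t0 tT sD.
have lt_case a' r' : rat_subdiv `[0, t[ (a' :: r') ->
    var_sum q x (a' :: r') + `|x t - x (last a' r')| `^ q <= rat_var `[0, t[.
  move=> sD'; set l := last a' r'; set G := rat_var `[0, t[; set v := var_sum _ _ _.
  have := sD'.2 _ (mem_last a' r'); rewrite /= in_itv /= -/l => -[/andP[l0 lt_] _].
  have vG : v <= G by apply: rat_var_ub => //; apply: itv_sub.
  rewrite -lerBrDl.
  suff h : `|x t - x l| <= (G - v) `^ q^-1.
    have -> : G - v = ((G - v) `^ q^-1) `^ q.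
      by rewrite powRVK// subr_ge0.
    by rewrite ge0_ler_powR ?nnegrE ?powR_ge0 ?(ltW q_gt0).
  apply/ler_addgt0Pr => eps e0.
  have [del d0 hdel] := x_near (t := t) (ltac:(by rewrite t0 tT) : 0 <= t <= T) e0.
  have ltm : Num.max l (t - del) < t by rewrite gt_max lt_ ltrBlDr ltrDl.
  have [b] := rat_in_itvoo ltm; rewrite in_itv /= gt_max => /andP[/andP[lb b1] bt].
  have b0 : 0 <= ratr b :> R by rewrite (le_trans l0 (ltW lb)).
  have xb : `|x (ratr b) - x t| < eps.
    apply: hdel; first by rewrite b0 (le_trans (ltW bt)).
    by rewrite distrC gtr0_norm ?subr_gt0// ltrBlDr -ltrBlDl.
  have h : v + `|x (ratr b) - x l| `^ q <= G.
    have -> : v + `|x (ratr b) - x l| `^ q = var_sum q x ((a' :: r') ++ [:: ratr b]).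
      by rewrite cat_cons var_sum_cat var_sum1 addr0.
    apply: rat_var_ub; first exact: itv_sub.
    apply: (rat_subdiv_cat sD').
      split=> // u; rewrite inE => /eqP->; split; last by exists b.
      by rewrite /= in_itv /= b0.
    move=> u u' us; rewrite inE => /eqP->; apply: le_lt_trans lb.
    exact: mem_path_le_last sD'.1 us.
  have h' : `|x (ratr b) - x l| <= (G - v) `^ q^-1.
    have -> : `|x (ratr b) - x l| = (`|x (ratr b) - x l| `^ q) `^ q^-1.
      by rewrite powRKV.
    by rewrite ge0_ler_powR ?nnegrE ?powR_ge0 ?invr_ge0 ?subr_ge0 ?(ltW q_gt0)// lerBrDl.
  have -> : x t - x l = (x t - x (ratr b)) + (x (ratr b) - x l) by rewrite subrKA.
  apply: le_trans (ler_normD _ _) _; rewrite addrC lerD//.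
  by rewrite distrC ltW.
have h0 := sD.2 _ (mem_last a r); move: h0; rewrite /= in_itv /= => -[/andP[l0 lt_] _].
have ltr_le u : u \in belast a r -> u < last a r.
  have := sD.1 => /= pr.
  elim: (r) (a) pr => [//|c r2 IH] a2 /= /andP[ac cr].
  rewrite inE => /orP[/eqP->|]; last exact: IH.
  apply: (lt_le_trans ac).
  by elim: (r2) (c) cr => [//|c' r3 IH'] c2 /= /andP[/ltW + /IH']; apply: le_trans.
move: lt_; rewrite le_eqVlt => /orP[/eqP lE|lt_]; last first.
  apply: lt_case; split; first exact: sD.1.
  move=> u us; have [u1 u2] := sD.2 u us; split=> //.
  move: u1; rewrite /= !in_itv /= => /andP[-> _] /=.
  move: us; rewrite lastI mem_rcons inE => /orP[/eqP->//|/ltr_le h].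
  exact: lt_trans lt_.
rewrite lE subrr normr0 powR0 ?gt_eqF// addr0.
case: (lastP r) lE ltr_le sD => [|r' b] lE ltr_le sD.
  by rewrite var_sum1; apply: le_trans (var_sum_ge0 [::]) _; apply: rat_var_ub => //; exact: itv_sub.
rewrite last_rcons in lE ltr_le.
rewrite -cats1 var_sum_cat var_sum1 addr0 lE.
apply: lt_case; split.
  by have := sD.1; rewrite /= rcons_path => /andP[].
move=> u us; have [|u1 u2] := sD.2 u.
  by rewrite -rcons_cons mem_rcons inE us orbT.
split=> //; move: u1; rewrite /= !in_itv /= => /andP[-> _] /=.
by rewrite -lE; apply: ltr_le; rewrite belast_rcons.
Qed.

(** A subdivision of [[0, u)] consists of a part before [t], a part after [t], and
    one increment across [t]. By continuity of [x], the latter is almost the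
    increment that ends at [t], so that together with the part before [t] it
    contributes at most the variation on [[0, t)]; the part after [t] is small by
    [rat_var_right]. *)
Lemma clock_right t eps : 0 <= t -> t < T -> 0 < eps ->
  exists2 del, 0 < del & forall u, t <= u -> u < t + del -> u <= T ->
    clock u - clock t <= eps.
Proof.
move=> t0 tT e0; have e30 : 0 < eps / 3 by rewrite divr_gt0.
have [h /andP[th hT] hr] := rat_var_right t0 tT e30.
set G := rat_var `[0, t[.
have G0 : 0 <= G.
  by apply: le_trans (var_sum_ge0 [::]) _; apply: rat_var_ub => //; apply: itv_sub; exact: ltW.
have B0 : 0 <= G `^ q^-1 := powR_ge0 _ _.
have [w0 w00 hw] := powR_continuous_bound B0 e30.
have tT' : 0 <= t <= T by rewrite t0 ltW.
have [del d0 hdel] := x_near tT' w00.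
pose del' := Num.min (Num.min del (eps / 3)) (h - t).
have d'0 : 0 < del' by rewrite !lt_min d0 e30 subr_gt0.
exists del' => // u tu; rewrite -ltrBlDl !lt_min => /andP[/andP[u1 u2] u3] uT.
suff : rat_var `[0, u[ <= G + eps / 3 + eps / 3 by rewrite /clock -/G; lra.
apply: rat_var_le => s sD.
have ssort := sD.1.
pose s1 := [seq y <- s | y <= t]; pose s2 := [seq y <- s | t < y].
have sE : s = s1 ++ s2.
  rewrite /s1 /s2; elim: (s) ssort => [//|a r IH] /= pr.
  have sr : sorted <%R r by exact: path_sorted pr.
  have [at_|ta] := leP a t; first by rewrite /= {1}(IH sr).
  have ar := pr; rewrite (path_sortedE lt_trans) in ar; case/andP: ar => /allP ar _.
  rewrite (_ : [seq y <- r | y <= t] = [::]) /=; last first.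
    apply/eqP; rewrite -(negbK (_ == _)) -has_filter; apply/hasPn => y /ar ay.
    by rewrite -ltNge (lt_trans ta).
  rewrite (_ : [seq y <- r | t < y] = r)//; apply/all_filterP/allP => y /ar.
  exact: lt_trans.
have D1 : rat_subdiv `[0, t] s1.
  split; first by apply: sorted_filter => //; exact: lt_trans.
  move=> y; rewrite mem_filter => /andP[yt /sD.2[y1 y2]]; split=> //.
  by move: y1; rewrite /= !in_itv /= => /andP[-> _].
have D2 : rat_subdiv `]t, h[ s2.
  split; first by apply: sorted_filter => //; exact: lt_trans.
  move=> y; rewrite mem_filter => /andP[yt /sD.2[y1 y2]]; split=> //.
  move: y1; rewrite /= !in_itv /= yt => /andP[_ yu] /=.
  by apply: lt_trans yu _; rewrite ltrBrDl addrC subrK in u3.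
have hT' : `]t, h[%classic `<=` `[0, T]%classic.
  move=> y /=; rewrite !in_itv /= => /andP[y1 y2].
  by rewrite (le_trans t0 (ltW y1)) (le_trans (ltW y2)).
have v2 : var_sum q x s2 <= eps / 3 by apply: le_trans hr; exact: rat_var_ub.
rewrite sE; case: s1 D1 {sE} => [|a r] D1.
  rewrite cat0s; apply: le_trans v2 _; rewrite lerDr addr_ge0 ?(ltW e30)//.
have vlast := rat_var_last t0 (ltW tT) D1; rewrite -/G in vlast.
case Es2 : s2 D2 v2 => [|b r2] D2 v2.
  rewrite cats0; apply: le_trans (_ : _ <= G) _.
    by apply: le_trans vlast; rewrite lerDl powR_ge0.
  by rewrite -addrA lerDl addr_ge0 ?(ltW e30).
rewrite cat_cons var_sum_cat.
have [/= + _] := D2.2 b (mem_head _ _); rewrite in_itv /= => /andP[tb bh].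
have bu : b < u.
  have : b \in s2 by rewrite Es2 mem_head.
  by rewrite mem_filter => /andP[_ /sD.2[]]; rewrite /= in_itv /= => /andP[].
have xb : `|x b - x t| < w0.
  apply: hdel; first by rewrite (le_trans t0 (ltW tb)) (le_trans (ltW bu)).
  rewrite gtr0_norm ?subr_gt0//; apply: lt_trans u1; by rewrite ltrD2r.
set A := `|x t - x (last a r)| in vlast *.
have A0 : 0 <= A by exact: normr_ge0.
have AG : A <= G `^ q^-1.
  have -> : A = (A `^ q) `^ q^-1 by rewrite powRKV.
  rewrite ge0_ler_powR ?nnegrE ?powR_ge0 ?invr_ge0 ?(ltW q_gt0)//.
  by apply: le_trans vlast; rewrite lerDr var_sum_ge0.
have cross : `|x b - x (last a r)| `^ q <= A `^ q + eps / 3.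
  apply: le_trans (hw A _ (normr_ge0 _) AG (normr_ge0 _) (ltW xb)).
  rewrite ge0_ler_powR ?nnegrE ?addr_ge0 ?(ltW q_gt0)//.
  have -> : x b - x (last a r) = (x t - x (last a r)) + (x b - x t).
    by rewrite [RHS]addrC subrKA.
  exact: ler_normD.
move: vlast cross v2.
set v1 := var_sum _ _ _; set v3 := var_sum _ _ _; set z1 := _ `^ q; set z2 := _ `^ q.
lra.
Qed.

Lemma clock_continuous t eps : 0 <= t <= T -> 0 < eps ->
  exists2 del, 0 < del & forall u, 0 <= u <= T -> `|u - t| < del ->
    `|clock u - clock t| < eps.
Proof.
move=> /andP[t0 tT] e0; have e20 : 0 < eps / 2 by rewrite divr_gt0.
have e2e : eps / 2 < eps by rewrite ltr_pdivrMr// ltr_pMr// ltr1n.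
have cle a b : 0 <= a -> a <= b -> b <= T -> clock a <= clock b.
  move=> a0; rewrite le_eqVlt => /orP[/eqP->//|ab bT].
  by apply: ltW; exact: clock_lt.
have [d1 d10 h1] : exists2 del, 0 < del & forall u, 0 <= u -> t - del < u -> u <= t ->
    clock t - clock u <= eps / 2.
  move: t0; rewrite le_eqVlt => /orP[/eqP<-|t0]; last exact: clock_left.
  exists 1 => // u u0 _ u0'; have -> : u = 0 by apply/eqP; rewrite eq_le u0 u0'.
  by rewrite subrr ltW.
have [d2 d20 h2] : exists2 del, 0 < del & forall u, t <= u -> u < t + del -> u <= T ->
    clock u - clock t <= eps / 2.
  move: tT; rewrite le_eqVlt => /orP[/eqP tT|tT]; last exact: clock_right.
  exists 1 => // u tu _ uT; have -> : u = t by apply/eqP; rewrite eq_le tu tT uT.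
  by rewrite subrr ltW.
exists (Num.min d1 d2) => [|u /andP[u0 uT]]; first by rewrite lt_min d10.
rewrite lt_min => /andP[u1 u2]; apply: le_lt_trans e2e.
have [ut|tu] := leP u t.
  rewrite distrC ger0_norm ?subr_ge0 ?cle//; apply: h1 => //.
  by move: u1; rewrite distrC ger0_norm ?subr_ge0// ltrBlDr -ltrBlDl.
rewrite ger0_norm ?subr_ge0 ?cle ?(ltW tu)//; apply: h2 => //; first exact: ltW.
by move: u2; rewrite gtr0_norm ?subr_gt0// ltrBlDl.
Qed.

End RationalVariation.

(** * Change of time *)

Section TimeChange.
Context {R : realType} {W : normedModType R}.
Variables (q T : R) (x : R -> W).
Hypotheses (q_ge1 : 1 <= q) (q_le2 : q <= 2) (T_gt0 : 0 < T).
Hypothesis x_cont : {within `[0, T], continuous x}.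
Hypothesis x_var : Vp q `[0, T] x.

Let q_gt0 : 0 < q. Proof. exact: lt_le_trans q_ge1. Qed.

(** Normalized to map [[0, T]] onto [[0, 1]]. *)
Definition unit_clock t : R := clock q x t / clock q x T.
Definition clock_inv s : R := sup [set t | 0 <= t <= T /\ unit_clock t <= s].
(** The path run at the speed of its variation; it is Hölder with exponent
    [q^-1], and stopped after the time [1]. *)
Definition slow s : W := x (clock_inv s).

Let L := clock q x T.
Let L_gt0 : 0 < L.
Proof.
have := clock_lt q_ge1 x_cont x_var (lexx 0) T_gt0 (lexx T).
by rewrite (clock0 q_ge1 T_gt0 x_var).
Qed.

Lemma unit_clock0 : unit_clock 0 = 0.
Proof. by rewrite /unit_clock (clock0 q_ge1 T_gt0 x_var) mul0r. Qed.

Lemma unit_clockT : unit_clock T = 1.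
Proof. by rewrite /unit_clock divff// gt_eqF. Qed.

Lemma unit_clock_lt a b : 0 <= a -> a < b -> b <= T -> unit_clock a < unit_clock b.
Proof. by move=> a0 ab bT; rewrite ltr_pM2r ?invr_gt0//; exact: (clock_lt q_ge1 x_cont x_var). Qed.

Lemma unit_clock_le a b : 0 <= a -> a <= b -> b <= T -> unit_clock a <= unit_clock b.
Proof.
move=> a0; rewrite le_eqVlt => /orP[/eqP->//|ab bT].
by apply: ltW; exact: unit_clock_lt.
Qed.

Lemma unit_clock_itv t : 0 <= t <= T -> 0 <= unit_clock t <= 1.
Proof.
move=> /andP[t0 tT]; rewrite -{1}unit_clock0 -unit_clockT.
by rewrite !unit_clock_le.
Qed.

Lemma unit_clock_inj a b : 0 <= a <= T -> 0 <= b <= T ->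
  unit_clock a <= unit_clock b -> a <= b.
Proof.
move=> /andP[a0 aT] /andP[b0 bT]; apply: contraTT; rewrite -!ltNge => ba.
exact: unit_clock_lt.
Qed.

Lemma unit_clock_continuous t eps : 0 <= t <= T -> 0 < eps ->
  exists2 del, 0 < del & forall u, 0 <= u <= T -> `|u - t| < del ->
    `|unit_clock u - unit_clock t| < eps.
Proof.
move=> tT e0; have eL : 0 < eps * L by rewrite mulr_gt0.
have [del d0 h] := clock_continuous q_ge1 q_le2 x_cont x_var tT eL.
exists del => // u uT ut; rewrite /unit_clock -mulrBl normrM.
by rewrite [`|L^-1|]gtr0_norm ?invr_gt0// ltr_pdivrMr// h.
Qed.

Lemma unit_clock_within : {within `[0, T], continuous unit_clock}.
Proof.
apply/subspace_continuousP => t; rewrite /= in_itv /= => tT.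
apply/cvgrPdist_lt => eps e0; have [del d0 h] := unit_clock_continuous tT e0.
apply: (@filterS _ (nbhs t) _ (ball t del)); last exact: nbhsx_ballx.
move=> u; rewrite -ball_normE /= => tu; rewrite in_itv /= => uT.
by rewrite distrC; apply: h => //; rewrite distrC.
Qed.

Lemma unit_clock_uniform eps : 0 < eps -> exists2 del, 0 < del &
  forall a b, 0 <= a -> a <= b -> b <= T -> b - a < del ->
    unit_clock b - unit_clock a < eps.
Proof.
move=> e0; have e20 : 0 < eps / 2 by rewrite divr_gt0.
have : \forall del \near 0^'+, `[0, T]%classic `<=`
    [set a | forall b, a <= b -> b <= T -> b - a < del -> 0 <= a -> unit_clock b - unit_clock a < eps].
  have cT := @segment_compact _ 0 T; move/compact_near_coveringP : cT; apply.
  move=> t; rewrite /= in_itv /= => tT.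
  have [del d0 h] := unit_clock_continuous tT e20.
  have d20 : 0 < del / 2 by rewrite divr_gt0.
  near=> a r => /= b ab bT bar a0.
  have h1 : `|a - t| < del / 2 by rewrite distrC; near: a; exact: (nbhsx_ballx t _ d20).
  have h2 : r <= del / 2 by near: r; exact: nbhs_right_le.
  have ha : `|unit_clock a - unit_clock t| < eps / 2.
    apply: h; first by rewrite a0 (le_trans ab).
    by apply: lt_le_trans h1 _; rewrite ler_pdivrMr// ler_peMr ?ler1n// ltW.
  have hb : `|unit_clock b - unit_clock t| < eps / 2.
    apply: h; first by rewrite bT (le_trans a0 ab).
    rewrite (splitr del) (_ : b - t = (b - a) + (a - t)); last by rewrite subrKA.
    apply: le_lt_trans (ler_normD _ _) _; rewrite ltrD//.
    by rewrite ger0_norm ?subr_ge0// (lt_le_trans bar).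
  rewrite (_ : unit_clock b - unit_clock a =
    (unit_clock b - unit_clock t) - (unit_clock a - unit_clock t)); last first.
    by rewrite opprB subrKA.
  apply: le_lt_trans (ler_norm _) _; rewrite (splitr eps).
  by apply: le_lt_trans (ler_normB _ _) _; rewrite ltrD.
move=> H; near (0:R)^'+ => del; exists del; first by near: del; exact: nbhs_right_gt.
move=> a b a0 ab bT ba; have : `[0, T]%classic a by rewrite /= in_itv /= a0 (le_trans ab).
have HT : `[0, T]%classic `<=`
    [set a | forall b, a <= b -> b <= T -> b - a < del -> 0 <= a -> unit_clock b - unit_clock a < eps].
  by near: del.
by move=> /HT; apply.
Unshelve. all: by end_near. Qed.

Lemma clock_inv_spec s : 0 <= s ->
  0 <= clock_inv s <= T /\ unit_clock (clock_inv s) = Num.min s 1.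
Proof.
move=> s0; have m0 : 0 <= Num.min s 1 by rewrite le_min s0 ler01.
have [] := @IVT _ unit_clock 0 T (Num.min s 1) (ltW T_gt0) unit_clock_within.
  rewrite unit_clock0 unit_clockT (min_idPl _) ?ler01// (max_idPr _) ?ler01//.
  by rewrite m0 ge_min lexx orbT.
move=> t; rewrite in_itv /= => tT Et.
suff -> : clock_inv s = t by [].
rewrite /clock_inv; have ub : ubound [set t | 0 <= t <= T /\ unit_clock t <= s] t.
  move=> u [uT us]; apply: unit_clock_inj => //; rewrite Et le_min us /=.
  by case/andP: (unit_clock_itv uT).
have tin : [set t | 0 <= t <= T /\ unit_clock t <= s] t.
  by split=> //; rewrite Et ge_min lexx.
apply/eqP; rewrite eq_le; apply/andP; split.
  by apply: ge_sup => //; exists t.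
by apply: ub_le_sup => //; exists t.
Qed.

Lemma unit_clockK t : 0 <= t <= T -> clock_inv (unit_clock t) = t.
Proof.
move=> tT; have /andP[c0 c1] := unit_clock_itv tT.
have [iT E] := clock_inv_spec c0.
rewrite (min_idPl c1) in E.
by apply/eqP; rewrite eq_le; apply/andP; split; apply: unit_clock_inj; rewrite ?E.
Qed.

Lemma slow_clock t : 0 <= t <= T -> slow (unit_clock t) = x t.
Proof. by move=> tT; rewrite /slow unit_clockK. Qed.

Lemma clock_inv_ge s t : 0 <= s -> 0 <= t <= T -> (t <= clock_inv s) = (unit_clock t <= s).
Proof.
move=> s0 tT; have [iT E] := clock_inv_spec s0; apply/idP/idP => [ti|ts].
  apply: le_trans (_ : unit_clock (clock_inv s) <= _); last by rewrite E ge_min lexx.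
  by apply: unit_clock_le => //; [case/andP: tT|case/andP: iT].
apply: unit_clock_inj => //; rewrite E le_min ts /=.
by case/andP: (unit_clock_itv tT).
Qed.

(** The increment of the clock dominates the [q]-th power of the increment of
    the path. *)
Lemma slow_holder a b : 0 <= a -> a <= b ->
  `|slow b - slow a| <= L `^ q^-1 * (b - a) `^ q^-1.
Proof.
move=> a0 ab; have b0 := le_trans a0 ab.
have [/andP[ia0 iaT] Ea] := clock_inv_spec a0; have [/andP[ib0 ibT] Eb] := clock_inv_spec b0.
have iab : clock_inv a <= clock_inv b.
  rewrite clock_inv_ge ?ia0// Ea; apply: le_trans ab; by rewrite ge_min lexx.
have ba0 : 0 <= b - a by rewrite subr_ge0.
rewrite /slow; move: iab; rewrite le_eqVlt => /orP[/eqP->|iab].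
  by rewrite subrr normr0 mulr_ge0 ?powR_ge0.
have := clock_incr q_ge1 x_cont x_var ia0 iab ibT => h.
rewrite -powRM ?(ltW L_gt0)//.
have -> : `|x (clock_inv b) - x (clock_inv a)| =
    (`|x (clock_inv b) - x (clock_inv a)| `^ q) `^ q^-1.
  by rewrite powRKV.
rewrite ge0_ler_powR ?nnegrE ?powR_ge0 ?invr_ge0 ?(ltW q_gt0) ?mulr_ge0 ?(ltW L_gt0)//.
apply: le_trans (_ : clock q x (clock_inv b) - clock q x (clock_inv a) <= _).
  by apply: le_trans h; rewrite lerDr subr_ge0 ltW.
have cE u : clock q x u = L * unit_clock u by rewrite /unit_clock mulrC divfK// gt_eqF.
rewrite !cE -mulrBr ler_wpM2l ?(ltW L_gt0)// Ea Eb.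
have [b1|b1] := leP b 1; have [a1|a1] := leP a 1; lra.
Qed.

End TimeChange.

Section YoungTransport.
Context {R : realType} {e d : nat}.
Variables (q T : R) (x : R -> 'cV[R]_d).
Hypotheses (q_ge1 : 1 <= q) (q_le2 : q <= 2) (T_gt0 : 0 < T).
Hypothesis x_cont : {within `[0, T], continuous x}.
Hypothesis x_var : Vp q `[0, T] x.

(** The clock maps partitions to partitions with the same Young sums, and small
    meshes to small meshes as it is uniformly continuous. *)
Lemma young_time_change (V : R -> 'M[R]_(e, d)) t l : 0 <= t <= T ->
  is_young_integral V (slow q T x) 0 (unit_clock q T x t) l ->
  is_young_integral (V \o unit_clock q T x) x 0 t l.
Proof.
move=> /andP[t0 tT] yV B /yV[del /= d0 delB].
have [eta eta0 h] := unit_clock_uniform q_ge1 q_le2 T_gt0 x_cont x_var d0.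
exists eta => // s [[ps /eqP sl] sm].
have Phi0 : unit_clock q T x 0 = 0 by exact: (unit_clock0 q_ge1 T_gt0 x_var).
have Phi_lt := unit_clock_lt q_ge1 T_gt0 x_cont x_var.
have XPhi := slow_clock q_ge1 q_le2 T_gt0 x_cont x_var.
move: (unit_clock q T x) (slow q T x) h Phi0 Phi_lt XPhi delB => Phi X h Phi0 Phi_lt XPhi delB.
suff gen a r : 0 <= a -> path <%R a r -> last a r <= T ->
    [/\ path <%R (Phi a) (map Phi r), last (Phi a) (map Phi r) = Phi (last a r),
    (forall k, (k < size r)%N -> r`_k - (a :: r)`_k < eta) ->
      forall k, (k < size r)%N -> (map Phi r)`_k - (Phi a :: map Phi r)`_k < del &
    young_sum (V \o Phi) x a r = young_sum V X (Phi a) (map Phi r)].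
  have [h1 h2 h3 h4] := gen 0 s (lexx 0) ps (ltac:(by rewrite sl) : last 0 s <= T).
  rewrite Phi0 in h1 h2 h3 h4.
  rewrite /preimage /mkset h4; apply: delB; split.
    by split=> //; rewrite h2 sl.
  rewrite /mesh; apply: bigmax_lt => // -[k ks] _.
  have ks' : (k < size s)%N by rewrite -(size_map Phi).
  apply: h3 => // i is_.
  apply: le_lt_trans sm.
  exact: (le_bigmax 0 (fun i : 'I_(size s) => s`_i - (0 :: s)`_i) (Ordinal is_)).
elim: r a => [|b r IH] a a0 /=; first by split=> //; rewrite /young_sum /= !big_ord0.
move=> /andP[ab br] lT.
have b0 : 0 <= b by rewrite (le_trans a0)// ltW.
have bT : b <= T by apply: le_trans lT; exact: path_le_last.
have aT : a <= T by rewrite (le_trans (ltW ab)).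
have [h1 h2 h3 h4] := IH b b0 br lT.
split=> //.
- by rewrite h1 andbT; apply: Phi_lt.
- move=> gap [|k] /= kr; first by apply: h => //; [exact: ltW|exact: (gap 0%N)].
  by apply: h3 => // i ir; apply: (gap i.+1).
- have E (v : R -> 'M[R]_(e, d)) (y : R -> 'cV[R]_d) u u' r' :
      young_sum v y u (u' :: r') = v u *m (y u' - y u) + young_sum v y u' r'.
    exact: (part_sum_cons (fun w w' => v w *m (y w' - y w))).
  by rewrite !E h4 !XPhi// ?b0 ?a0.
Qed.

End YoungTransport.

(** * The solution for a given starting point and driver *)

Section LocalSolution.
Context {R : realType} {e d : nat}.
Variables (T q gamma H : R) (U : set 'cV[R]_e) (F : 'cV[R]_e -> set 'M[R]_(e, d)).
Variables (xi : 'cV[R]_e) (x : R -> 'cV[R]_d) (Phi : R -> R) (X : R -> 'cV[R]_d).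
Variable nn : nat -> nat.
Hypotheses (T_gt0 : 0 < T) (q_range : 1 <= q < 2) (gamma_range : q - 1 < gamma <= 1)
  (H_ge0 : 0 <= H).
Hypothesis U_open : open U.
Hypotheses (F_compact : forall y, U y -> F y !=set0 /\ compact (F y))
  (F_holder : locally_holder gamma U F).
Hypothesis xi_U : U xi.
Hypotheses (Phi0 : Phi 0 = 0) (PhiT : Phi T = 1).
Hypothesis Phi_lt : forall a b, 0 <= a -> a < b -> b <= T -> Phi a < Phi b.
Hypothesis Phi_cont : forall t eps, 0 <= t <= T -> 0 < eps ->
  exists2 del, 0 < del & forall u, 0 <= u <= T -> `|u - t| < del -> `|Phi u - Phi t| < eps.
Hypothesis X_holder : forall a b, 0 <= a -> a <= b -> `|X b - X a| <= H * (b - a) `^ q^-1.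
Hypothesis young : forall (V : R -> 'M[R]_(e, d)) t l, 0 <= t <= T ->
  is_young_integral V X 0 (Phi t) l -> is_young_integral (V \o Phi) x 0 t l.
Hypothesis clock_onto : forall s, 0 <= s -> s <= 1 -> exists2 t, 0 <= t <= T & Phi t = s.

Let yd := lim_posn U F X xi nn.
Let ud := lim_velo U F X xi nn.
Let remains := stays U F X xi nn.

Hypothesis nn_ge : forall i, (i <= nn i)%N.
Hypothesis decided_posn : forall j k a b (r : rat),
  decided (fun i => ratr r < sub_posn U F X xi nn j k i a b).
Hypothesis decided_velo : forall j k a b (r : rat),
  decided (fun i => ratr r < sub_velo U F X xi nn j k i a b).

Let al := q^-1.
Let be := al * gamma.
Let q_gt0 : 0 < q. Proof. by case/andP: q_range => h _; exact: lt_le_trans h. Qed.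
Let al_gt0 : 0 < al. Proof. by rewrite invr_gt0. Qed.
Let al_le1 : al <= 1. Proof. by rewrite invf_le1//; case/andP: q_range. Qed.
Let ga_gt0 : 0 < gamma.
Proof. by case/andP: q_range => q1 _; case/andP: gamma_range => + _; lra. Qed.
Let be_le1 : be <= 1.
Proof.
case/andP: gamma_range => _ g1; apply: le_trans al_le1.
by rewrite /be ler_piMr// ltW.
Qed.
Let be_gt0 : 0 < be. Proof. exact: mulr_gt0. Qed.
Let th_gt1 : 1 < al + al * gamma.
Proof.
rewrite -[X in X + _]mulr1 -mulrDr -ltr_pdivrMl// invrK mulr1.
by case/andP: gamma_range => + _; lra.
Qed.

Definition position t : 'cV[R]_e := dyadic_path yd (Phi t).
Definition velocity t : 'M[R]_(e, d) := dyadic_path ud (Phi t).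

(** The limit is controlled only while the schemes remain in a compact subset
    of [U]. *)
Definition lifetime : set R := [set t | 0 <= t <= T /\
  exists j k m, Phi t <= k%:R * dy j /\ remains (k%:R * dy j) (exhaust U m)].

Let Phi_le a b : 0 <= a -> a <= b -> b <= T -> Phi a <= Phi b.
Proof.
move=> a0; rewrite le_eqVlt => /orP[/eqP->//|ab bT].
by apply: ltW; exact: Phi_lt.
Qed.

Let Phi_ge0 t : 0 <= t -> t <= T -> 0 <= Phi t.
Proof. by move=> t0 tT; rewrite -Phi0; apply: Phi_le. Qed.

Lemma lifetime_down t u : lifetime t -> 0 <= u -> u <= t -> lifetime u.
Proof.
move=> [/andP[t0 tT] [j [k [m [tk sk]]]]] u0 ut; split; first by rewrite u0 (le_trans ut).
by exists j, k, m; split=> //; apply: le_trans tk; apply: Phi_le.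
Qed.

Lemma lifetime0 : lifetime 0.
Proof.
split; first by rewrite lexx ltW.
have [m [del [d0 h]]] := @exhaust_near _ _ U [set xi] U_open (@compact_set1 _ xi)
  (ltac:(by move=> _ ->)).
exists 0%N, 0%N, m; rewrite Phi0 mul0r; split=> //.
rewrite /remains /stays; apply: nearW => i [|k]; last first.
  by rewrite leNgt mulr_gt0 ?dy_gt0.
by move=> _; rewrite posn0; apply: (h xi) => //; rewrite subrr normr0 ltW.
Qed.

(** The limit at the last point where the schemes are known to stay in a member
    of the exhaustion is interior to a larger member. *)
Let stays_more j k m : remains (k%:R * dy j) (exhaust U m) ->
  exists j' k' m', k%:R * dy j < k'%:R * dy j' :> R /\ remains (k'%:R * dy j') (exhaust U m').
Proof.
move=> sk; have [m' [del [d0 h]]] := exhaust_near U_open (@exhaust_compact _ _ U m) (@exhaust_sub _ _ U m).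
have Km y : exhaust U m y -> exhaust U m' y.
  by move=> my; apply: (h y) => //; rewrite subrr normr0 ltW.
have d20 : 0 < del / 2 by rewrite divr_gt0.
have [J0 hJ0] := stays_extend al_gt0 ga_gt0 be_le1 th_gt1 H_ge0 F_compact F_holder
  X_holder xi_U nn_ge (@exhaust_compact _ _ U m') (@exhaust_sub _ _ U m') d20.
pose J := maxn J0 j.
have E : (refine J j k)%:R * dy J = k%:R * dy j :> R by rewrite refine_pt// leq_maxr.
exists J, (refine J j k).+1, m'; split.
  by rewrite -E ltr_pM2r ?dy_gt0// ltr_nat.
have kS : (refine J j k)%:R * dy J <= k%:R * dy j :> R by rewrite E.
have cv := cvg_sub_posn nn_ge decided_posn (@exhaust_compact _ _ U m) sk kS.
apply: (hJ0 J _ (lim_posn U F X xi nn J (refine J j k)) (leq_maxl _ _) _ erefl).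
- by move: sk; rewrite E /remains /stays; apply: filterS => i hi k' /hi /Km.
- by have /cvgrPdistC_lt/(_ _ d20) := cv.
- move=> u; rewrite mulrC divfK// => ul; apply: h ul.
  by apply: cvg_compact_mem (@exhaust_compact _ _ U m) cv _; exact: near_sub_posn kS.
Qed.

Lemma lifetime_open t : lifetime t -> t < T -> exists2 u, lifetime u & t < u.
Proof.
move=> [/andP[t0 tT] [j [k [m [tk sk]]]]] tltT.
have [j' [k' [m' [kk' sk']]]] := stays_more sk.
have e0 : 0 < k'%:R * dy j' - Phi t by rewrite subr_gt0 (le_lt_trans tk).
have [del d0 h] := Phi_cont (ltac:(by rewrite t0 tT) : 0 <= t <= T) e0.
pose u := Num.min T (t + del / 2).
have tu : t < u by rewrite lt_min tltT ltrDl divr_gt0.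
have uT : u <= T by rewrite ge_min lexx.
have u0 : 0 <= u := le_trans t0 (ltW tu).
exists u => //; split; first by rewrite u0.
exists j', k', m'; split=> //.
have : `|Phi u - Phi t| < k'%:R * dy j' - Phi t.
  apply: h; first by rewrite u0.
  rewrite gtr0_norm ?subr_gt0// ltrBlDl; apply: le_lt_trans (_ : t + del / 2 < _).
    by rewrite ge_min lexx orbT.
  by rewrite ltrD2l ltr_pdivrMr// ltr_pMr// ltr1n.
by rewrite gtr0_norm ?subr_gt0 ?Phi_lt// ltrD2r => /ltW.
Qed.

Let life_has_sup : has_sup lifetime.
Proof. by split; [exists 0; exact: lifetime0|exists T => t [/andP[]]]. Qed.

Lemma lifetime_sup : 0 < sup lifetime <= T.
Proof.
apply/andP; split; last by apply: ge_sup; [exact: life_has_sup.1|move=> t [/andP[]]].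
have [u lu u0] := lifetime_open lifetime0 T_gt0.
by apply: lt_le_trans u0 _; apply: ub_le_sup lu; exact: life_has_sup.2.
Qed.

Lemma lifetime_initial : initial_interval (sup lifetime) lifetime.
Proof.
have ubl t : lifetime t -> t <= sup lifetime.
  by move=> lt; apply: ub_le_sup lt; exact: life_has_sup.2.
have below t : 0 <= t -> t < sup lifetime -> lifetime t.
  move=> t0 ts; have e0 : 0 < sup lifetime - t by rewrite subr_gt0.
  have [u lu] := sup_adherent e0 life_has_sup; rewrite opprB addrC subrK => tu.
  by apply: lifetime_down lu t0 (ltW tu).
have [ls|nls] := pselect (lifetime (sup lifetime)); [left|right].
  apply/seteqP; split=> t /=; rewrite in_itv /=.
    by move=> lt; rewrite ubl// andbT; case: lt => /andP[].
  by move=> /andP[t0 ts]; exact: lifetime_down ls t0 ts.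
apply/seteqP; split=> t /=; rewrite in_itv /=.
  move=> lt; rewrite lt_neqAle ubl// andbT.
  have t0 : 0 <= t by case: lt => /andP[].
  by rewrite t0 /=; apply/eqP => E; apply: nls; rewrite -E.
by move=> /andP[t0 ts]; exact: below.
Qed.

Let solution_at t : lifetime t -> exists S m j0 c, [/\ 0 <= Phi t <= S,
  remains S (exhaust U m), (exists k j, S = k%:R * dy j) &
  dyadic_solution F al gamma X S (exhaust U m) j0 c yd ud].
Proof.
move=> [/andP[t0 tT] [j [k [m [tk sk]]]]].
have [j0 [c sol]] := dyadic_solutionP al_gt0 ga_gt0 be_le1 th_gt1 H_ge0 F_compact F_holder
  X_holder xi_U nn_ge decided_posn decided_velo (@exhaust_compact _ _ U m)
  (@exhaust_sub _ _ U m) sk.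
exists (k%:R * dy j), m, j0, c; split=> //; first by rewrite Phi_ge0.
by exists k, j.
Qed.

Let closed_F m y : exhaust U m y -> closed (F y).
Proof.
move=> /exhaust_sub /F_compact[_]; apply: compact_closed; exact: norm_hausdorff.
Qed.

Let holder_exhaust m : holder_on gamma (exhaust U m) F.
Proof. exact: F_holder (@exhaust_compact _ _ U m) (@exhaust_sub _ _ U m). Qed.

Lemma position_velocity t : lifetime t -> U (position t) /\ F (position t) (velocity t).
Proof.
move=> /solution_at[S [m [j0 [c [tS _ _ sol]]]]]; split.
  exact: exhaust_sub (posn_K al_gt0 (@exhaust_compact _ _ U m) sol tS).
exact: (velo_F al_gt0 ga_gt0 (@exhaust_compact _ _ U m) (holder_exhaust m) (@closed_F m) sol tS).
Qed.

Let position0 : dyadic_path yd 0 = xi.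
Proof.
have [S [m [j0 [c [/andP[_ tS] _ _ sol]]]]] := solution_at lifetime0.
have := @posn_pt _ _ _ _ _ _ _ _ _ _ _ _ _ sol 0%N 0%N; rewrite mul0r => -> //.
  apply: mx_limE; have -> : sub_posn U F X xi nn 0 0 = fun=> xi.
    by apply/funext => i; rewrite /sub_posn /refine mul0n posn0.
  exact: cvg_cst.
by rewrite -Phi0.
Qed.

Lemma position_young t : lifetime t ->
  exists2 l, is_young_integral velocity x 0 t l & position t = xi + l.
Proof.
move=> lt; have [S [m [j0 [c [tS _ _ sol]]]]] := solution_at lt.
exists (dyadic_path yd (Phi t) - dyadic_path yd 0).
  apply: (@young (dyadic_path ud)); first by case: lt.
  exact: (young_integral_path al_gt0 al_le1 ga_gt0 th_gt1 H_ge0 X_holder sol tS).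
by rewrite position0 addrC subrK.
Qed.

Let Phi_on u t S : 0 <= u <= T -> u <= t -> lifetime t -> Phi t <= S -> 0 <= Phi u <= S.
Proof.
move=> /andP[u0 uT] ut [/andP[t0 tT] _] tS.
by rewrite Phi_ge0//= (le_trans _ tS)// Phi_le.
Qed.

Lemma position_holder t : lifetime t -> exists2 c1, 0 <= c1 &
  forall a b, 0 <= a -> a <= b -> b <= t ->
  `|position b - position a| <= c1 * (Phi b - Phi a) `^ al.
Proof.
move=> lt; have [S [m [j0 [c [/andP[t0 tS] _ _ sol]]]]] := solution_at lt.
have [c1 c10 h] := posn_holder al_gt0 (@exhaust_compact _ _ U m) sol.
have tT : t <= T by case: lt => /andP[].
exists c1 => // a b a0 ab bt; have bT := le_trans bt tT.
apply: h; first exact: Phi_ge0 (le_trans ab bT).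
- exact: Phi_le.
- by apply: le_trans tS; apply: Phi_le => //; exact: le_trans ab.
Qed.

(** At a time of the lifetime other than [T] the bounds of the limit path hold on
    a neighbourhood, since the lifetime extends beyond it. *)
Let life_bound t : lifetime t -> exists2 t2, lifetime t2 & t <= t2 /\
  exists2 del, 0 < del & forall u, lifetime u -> `|u - t| < del -> u <= t2.
Proof.
move=> lt; have tT : t <= T by case: lt => /andP[].
move: tT; rewrite le_eqVlt => /orP[/eqP tT|tT].
  exists t => //; split=> //; exists 1 => // u [/andP[_ uT] _] _.
  by rewrite tT.
have [t2 lt2 tt2] := lifetime_open lt tT.
exists t2 => //; split; first exact: ltW.
exists (t2 - t); first by rewrite subr_gt0.
by move=> u _ /ltr_normlW; rewrite ltrD2r => /ltW.
Qed.

Lemma position_continuous : {within lifetime, continuous position}.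
Proof.
apply/subspace_continuousP => t lt.
have [t2 lt2 [tt2 [del d0 hb]]] := life_bound lt.
have [c1 c10 hc] := position_holder lt2.
apply/cvgrPdist_lt => eps e0.
have c11 : 0 < c1 + 1 by rewrite ltr_wpDl.
have w0 : 0 < (eps / (c1 + 1)) `^ al^-1 by rewrite powR_gt0// divr_gt0.
have tT : 0 <= t <= T by case: lt.
have [del2 d20 hPhi] := Phi_cont tT w0.
have dd : 0 < Num.min del del2 by rewrite lt_min d0.
apply: (@filterS _ (nbhs t) _ (ball t (Num.min del del2))); last exact: nbhsx_ballx.
move=> u; rewrite -ball_normE /= lt_min distrC => /andP[u1 u2] lu.
have ut2 := hb u lu u1; have uT : 0 <= u <= T by case: lu.
have key a b : 0 <= a -> a <= b -> b <= t2 -> `|Phi b - Phi a| < (eps / (c1 + 1)) `^ al^-1 ->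
    `|position b - position a| < eps.
  move=> a0 ab bt2 hab; apply: le_lt_trans (hc a b a0 ab bt2) _.
  apply: le_lt_trans (_ : _ <= c1 * (eps / (c1 + 1))) _; last first.
    by rewrite mulrA ltr_pdivrMr// mulrC ltr_pM2l// ltrDl.
  rewrite ler_wpM2l//.
  have -> : eps / (c1 + 1) = ((eps / (c1 + 1)) `^ al^-1) `^ al.
    by rewrite powRVK// ltW// divr_gt0.
  have bT : b <= T by apply: le_trans bt2 _; case: lt2 => /andP[].
  rewrite ge0_ler_powR ?nnegrE ?powR_ge0 ?(ltW al_gt0)//.
    by rewrite subr_ge0 Phi_le.
  by apply: le_trans (ler_norm _) (ltW hab).
have hP := hPhi u uT u2.
have [ut|tu] := leP u t.
  by apply: key; rewrite // ?(andP uT).1// distrC.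
rewrite distrC; apply: key => //; [by case/andP: tT|exact: ltW].
Qed.

Let compact_life K : compact K -> K `<=` lifetime -> exists2 t, lifetime t &
  forall u, K u -> u <= t.
Proof.
move=> cK KI; have [[u0 Ku0]|K0] := pselect (K !=set0); last first.
  by exists 0; [exact: lifetime0|move=> u Ku; case: K0; exists u].
have hs : has_sup K by apply: compact_has_sup => //; exists u0.
exists (sup K); last by move=> u Ku; apply: ub_le_sup Ku; exact: hs.2.
apply: KI; apply: (compact_closed _ cK); first exact: Rhausdorff.
by apply: closure_sup; [exact: hs.1|exact: hs.2].
Qed.

Lemma position_variation : Vp_loc q lifetime position.
Proof.
move=> K cK KI; have [t lt Kt] := compact_life cK KI.
have [S [m [j0 [c [/andP[t0 tS] _ _ sol]]]]] := solution_at lt.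
have [c1 c10 h] := posn_holder al_gt0 (@exhaust_compact _ _ U m) sol.
apply: (@Vp_comp _ _ _ (dyadic_path yd) K `[0, S]%classic Phi (c1 `^ q * S)).
- exact: ltW.
- by apply: (var_sum_holder (ltW q_gt0) _ (le_trans t0 tS) c10 h); rewrite mulVf ?gt_eqF.
- move=> a Ka; rewrite /= in_itv /=; apply: (Phi_on (t := t)) => //.
    by case: (KI a Ka).
  exact: Kt.
- move=> a b Ka Kb ab; apply: Phi_lt => //.
    by case: (KI a Ka) => /andP[].
  by case: (KI b Kb) => /andP[].
Qed.

Lemma velocity_variation p : q / gamma < p -> Vp_loc p lifetime velocity.
Proof.
move=> qp K cK KI; have [t lt Kt] := compact_life cK KI.
have [S [m [j0 [c [/andP[t0 tS] _ _ sol]]]]] := solution_at lt.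
have p0 : 0 < p by apply: lt_trans qp; rewrite divr_gt0.
have bep : 1 < be * p.
  rewrite /be /al -mulrA -ltr_pdivrMl ?invr_gt0// invrK mulr1 mulrC.
  by rewrite -ltr_pdivrMr.
have [M hM] := velo_var_sum be_gt0 bep (le_trans t0 tS)
  (fun s hs => velo_bnd al_gt0 ga_gt0 sol hs)
  (fun s j hs hj => velo_dist al_gt0 ga_gt0 sol hs hj).
apply: (@Vp_comp _ _ _ (dyadic_path ud) K `[0, S]%classic Phi M) => //.
- exact: ltW.
- move=> a Ka; rewrite /= in_itv /=; apply: (Phi_on (t := t)) => //.
    by case: (KI a Ka).
  exact: Kt.
- move=> a b Ka Kb ab; apply: Phi_lt => //.
    by case: (KI a Ka) => /andP[].
  by case: (KI b Kb) => /andP[].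
Qed.

(** The velocity is uniformly close to the step functions of the levels [j],
    which are constant on both sides of every point. *)
Lemma velocity_cadlag : cadlag lifetime velocity.
Proof.
move=> t lt; have [t2 lt2 [tt2 [del d0 hb]]] := life_bound lt.
have [S [m [j0 [c [/andP[t20 t2S] _ _ sol]]]]] := solution_at lt2.
have tT : 0 <= t <= T by case: lt.
have PS u : 0 <= u <= T -> u <= t2 -> 0 <= Phi u <= S.
  by move=> uT ut2; exact: Phi_on lt2 t2S.
pose c' := path_const c be; have c'0 : 0 <= c' := path_const_ge0 be_gt0 (ds_ge0 sol).
have fine eps : 0 < eps -> exists2 j, (j0 <= j)%N & c' * dy j `^ be < eps.
  move=> e0; have e20 : 0 < eps / 2 by rewrite divr_gt0.
  have [n hn] := powR_dy_small be_gt0 c'0 e20.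
  exists (maxn j0 n); first exact: leq_maxl.
  apply: le_lt_trans (hn _ (leq_maxr _ _)) _.
  by rewrite ltr_pdivrMr// ltr_pMr// ltr1n.
have vd u j : 0 <= u <= T -> u <= t2 -> (j0 <= j)%N ->
    `|velocity u - ud j (fl j (Phi u))| <= c' * dy j `^ be.
  by move=> uT ut2 j0j; apply: (velo_dist al_gt0 ga_gt0 sol) => //; exact: PS.
have Pt0 : 0 <= Phi t by case/andP: (PS t tT tt2).
split.
  apply/cvgrPdist_lt => eps e0; have e20 : 0 < eps / 2 by rewrite divr_gt0.
  have [j j0j hj] := fine _ e20.
  have [ds ds0 hds] := fl_right j Pt0.
  have [del2 d20 hPhi] := Phi_cont tT ds0.
  have dd : 0 < Num.min del del2 by rewrite lt_min d0.
  apply: (@filterS _ (nbhs t) _ (ball t (Num.min del del2))); last exact: nbhsx_ballx.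
  move=> u; rewrite -ball_normE /= lt_min distrC => /andP[u1 u2] tu lu.
  have uT : 0 <= u <= T by case: lu.
  have fE : fl j (Phi u) = fl j (Phi t).
    apply: hds; first by apply: Phi_le; [case/andP: tT|exact: ltW|case/andP: uT].
    have := hPhi u uT u2 => /ltr_normlW; by rewrite ltrBlDl.
  have -> : velocity t - velocity u = (velocity t - ud j (fl j (Phi t)))
      - (velocity u - ud j (fl j (Phi u))) by rewrite fE opprB subrKA.
  apply: le_lt_trans (ler_normB _ _) _; rewrite (splitr eps); apply: ltrD.
    by apply: le_lt_trans (vd _ _ tT tt2 j0j) _.
  by apply: le_lt_trans (vd _ _ uT (hb u lu u1) j0j) _.
have /andP[t0 _] := tT; move: t0; rewrite le_eqVlt => /orP[/eqP t0|t0].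
  exists 0 => B _; apply: (@nearW _ (nbhs t)) => u; rewrite -t0 => u0 [/andP[u0' _] _].
  by move: u0; rewrite ltNge u0'.
suff [l hl] : exists l : 'M[R]_(e, d), velocity u @[u --> t^'-] --> l.
  exists l => B hB; apply: (@filterS _ (nbhs t) _ _ _ _ (hl B hB)) => u hu ut _.
  exact: hu.
suff cv : cvg (velocity u @[u --> t^'-]) by exists (lim (velocity u @[u --> t^'-])).
apply/cauchy_cvgP/cauchy_exP => eps e0.
have [j j0j hj] := fine _ e0.
have Pt : 0 < Phi t by rewrite -Phi0; apply: Phi_lt => //; case/andP: tT.
have [k [ds ds0 hds]] := fl_left j Pt.
have [del2 d20 hPhi] := Phi_cont tT ds0.
have dd : 0 < Num.min t del2 by rewrite lt_min t0.
exists (ud j k).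
apply: (@filterS _ (nbhs t) _ (ball t (Num.min t del2))); last exact: nbhsx_ballx.
move=> u; rewrite -ball_normE /= lt_min distrC => /andP[u1 u2] ut.
have u0 : 0 <= u by move: u1; rewrite distrC => /ltr_normlW; rewrite ltrBlDr ltrDl => /ltW.
have uT : 0 <= u <= T by rewrite u0 (le_trans (ltW ut))//; case/andP: tT.
have fE : fl j (Phi u) = k.
  apply: hds; last by apply: Phi_lt => //; case/andP: tT.
  have := hPhi u uT u2; rewrite distrC => /ltr_normlW.
  by rewrite ltrBlDr -ltrBlDl.
rewrite -ball_normE /= distrC -fE.
by apply: le_lt_trans (vd _ _ uT (le_trans (ltW ut) tt2) j0j) _.
Qed.

Lemma velocity_Vplus : Vplus_cadlag_loc (q / gamma) lifetime velocity.
Proof. by move=> p /= qp; split; [exact: velocity_variation|exact: velocity_cadlag]. Qed.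

Lemma local_solution : solution_with_velocity T q U F xi x lifetime position velocity.
Proof.
have /andP[s0 sT] := lifetime_sup.
split.
- by exists (sup lifetime); [rewrite sT ltW|exact: lifetime_initial].
- by split; [exact: position_variation|exact: position_continuous].
- by move=> t /position_velocity[].
- have qg0 : 0 < q / gamma by rewrite divr_gt0.
  (* an exponent between [q / gamma] and the conjugate exponent of [q] *)
  pose r := (gamma / q + (1 - q^-1)) / 2.
  have h1 : 1 - q^-1 < gamma / q.
    by move: th_gt1; rewrite /al [q^-1 * _]mulrC ltrBlDl.
  have r1 : 1 - q^-1 < r by rewrite /r; lra.
  have r2 : r < gamma / q by rewrite /r; lra.
  have q1 : q^-1 <= 1 := al_le1.
  have r0 : 0 < r by apply: le_lt_trans r1; rewrite subr_ge0.
  exists r^-1; split.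
  + rewrite invf_ge1//; apply: le_trans (ltW r2) _.
    by rewrite mulrC; exact: be_le1.
  + by rewrite invrK; lra.
  + apply: velocity_variation; rewrite -[q / gamma]invrK ltf_pV2 ?posrE ?invr_gt0//.
    by rewrite invf_div.
- by move=> t lt; split; [exact: position_young|case: (position_velocity lt)].
Qed.

(** If the closure of the positions in [U] were compact, a neighbourhood of it
    would be contained in a single member of the exhaustion. Each position would
    then guarantee that the schemes stay in this member for an additional time
    [dy J], with [J] fixed: the time [1] is reached after finitely many steps. *)
Lemma lifetime_not_precompact : lifetime <> `[0, T]%classic ->
  ~ precompact_in U (position @` lifetime).
Proof.
rewrite /precompact_in => lT; set C := _ `&` U => cC; apply: lT.
have CU : C `<=` U by move=> y [].
have zC t : lifetime t -> C (position t).
  move=> lt; split; last by case: (position_velocity lt).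
  by apply: subset_closure; exists t.
have [m [del [d0 h]]] := exhaust_near U_open cC CU.
have d20 : 0 < del / 2 by rewrite divr_gt0.
have [J hJ] := stays_extend al_gt0 ga_gt0 be_le1 th_gt1 H_ge0 F_compact F_holder
  X_holder xi_U nn_ge (@exhaust_compact _ _ U m) (@exhaust_sub _ _ U m) d20.
have dJ : (2 ^ J)%N%:R * dy J = 1 :> R by rewrite natrX -[X in dy X]addn0 dyM.
have xiK : exhaust U m xi.
  apply: (h (position 0)); first exact: zC lifetime0.
  by rewrite /position Phi0 position0 subrr normr0 ltW.
have stay k : (k <= 2 ^ J)%N -> remains (k%:R * dy J) (exhaust U m).
  elim: k => [_|k IH kJ].
    rewrite mul0r /remains /stays; apply: nearW => i [|k].
      by rewrite posn0.
    by rewrite leNgt mulr_gt0 ?dy_gt0.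
  have sk := IH (ltnW kJ).
  have s1 : k%:R * dy J <= 1 :> R.
    apply: le_trans (_ : _ <= (2 ^ J)%N%:R * dy J) _; last by rewrite dJ.
    by rewrite ler_wpM2r ?dy_ge0// ler_nat ltnW.
  have s0 : 0 <= k%:R * dy J :> R by rewrite mulr_ge0 ?dy_ge0.
  have [t tT Et] := clock_onto s0 s1.
  have lt : lifetime t by split=> //; exists J, k, m; rewrite Et.
  have [j0 [c sol]] := dyadic_solutionP al_gt0 ga_gt0 be_le1 th_gt1 H_ge0 F_compact F_holder
    X_holder xi_U nn_ge decided_posn decided_velo (@exhaust_compact _ _ U m)
    (@exhaust_sub _ _ U m) sk.
  have Ey : position t = lim_posn U F X xi nn J k.
    by rewrite /position Et; apply: (posn_pt sol).
  have cv := cvg_sub_posn nn_ge decided_posn (@exhaust_compact _ _ U m) sk (lexx _).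
  apply: (hJ J _ (lim_posn U F X xi nn J k) (leqnn _) _ erefl) => //.
    by have /cvgrPdistC_lt/(_ _ d20) := cv.
  by move=> u; rewrite mulrC divfK// -Ey; apply: h; exact: zC.
apply/seteqP; split=> t /=; rewrite in_itv /=; first by case.
move=> tT; split=> //; exists J, (2 ^ J)%N, m; split; last exact: stay.
by rewrite dJ -PhiT; apply: Phi_le; case/andP: tT.
Qed.

End LocalSolution.

Section Maximality.
Context {R : realType} {e d : nat}.
Variables (T q : R) (U : set 'cV[R]_e) (F : 'cV[R]_e -> set 'M[R]_(e, d)).
Variables (xi : 'cV[R]_e) (x : R -> 'cV[R]_d) (I : set R) (z : R -> 'cV[R]_e).

(** An extension of the solution to a bigger interval would be continuous on a
    compact interval that contains [I], which would make [z @` I] precompact. *)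
Lemma not_precompact_maximal S : initial_interval S I -> 0 <= S <= T ->
  solution T q U F xi x I z ->
  (I <> `[0, T]%classic -> ~ precompact_in U (z @` I)) ->
  maximal_solution T q U F xi x I z.
Proof.
move=> iI /andP[S0 ST] sI npc; split=> // -[J [z' [IJ sJ zz']]].
have [IsubJ nJI] : I `<=` J /\ ~ (J `<=` I) by case: IJ.
have [v' [[S' /andP[S'0 S'T] iJ] [_ cz'] z'U _ _]] := sJ.
have JT : J `<=` `[0, T].
  by case: iJ => -> u /=; rewrite !in_itv /= => /andP[-> uS] /=; rewrite (le_trans _ S'T) // ?ltW.
apply: npc; first by move=> IT; apply: nJI; rewrite IT.
have [u Ju nIu] : exists2 u, J u & ~ I u.
  by apply: contrapT => h; apply: nJI => u Ju; apply: contrapT => nIu; apply: h; exists u.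
have uS : S <= u.
  rewrite leNgt; apply/negP => uS; apply: nIu.
  have u0 : 0 <= u by have := JT u Ju; rewrite /= in_itv /= => /andP[].
  by case: iI => ->; rewrite /= in_itv /= u0 // ltW.
have SJ : `[0, S]%classic `<=` J.
  move=> w; rewrite /= in_itv /= => /andP[w0 wS].
  by move: Ju; case: iJ => ->; rewrite /= !in_itv /= w0 => /andP[_];
    [apply: le_trans|apply: le_lt_trans]; exact: le_trans uS.
have IS : I `<=` `[0, S]%classic.
  by case: iI => -> w /=; rewrite !in_itv /= => /andP[-> wS] //=; exact: ltW.
pose D := z' @` `[0, S]%classic.
have cD : compact D.
  apply: continuous_compact; last exact: segment_compact.
  exact: continuous_subspaceW cz'.
have zD : z @` I `<=` D.
  move=> _ [w Iw <-]; exists w; first exact: IS.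
  by apply: zz'; rewrite inE.
have clD : closed D by apply: compact_closed => //; exact: norm_hausdorff.
have clz : closure (z @` I) `<=` D.
  by rewrite closureE => y; apply.
rewrite /precompact_in (_ : closure _ `&` U = closure (z @` I)).
  by apply: (subclosed_compact _ cD) => //; exact: closed_closure.
apply/seteqP; split=> [y []//|y cy]; split=> //.
by have [w Sw <-] := clz y cy; apply: z'U; exact: SJ.
Qed.

End Maximality.

(** * Measurable conditions and functions *)

Section MeasurableProps.
Context {dd : measure_display} {Om : measurableType dd}.

Definition mprop (P : Om -> Prop) : Prop := measurable [set w | P w].

Lemma eq_mprop (P Q : Om -> Prop) : (forall w, P w <-> Q w) -> mprop P -> mprop Q.
Proof.
move=> PQ; rewrite /mprop (_ : [set w | Q w] = [set w | P w])//.
by apply/seteqP; split=> w /= /PQ.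
Qed.

Lemma mprop_not P : mprop P -> mprop (fun w => ~ P w).
Proof. exact: measurableC. Qed.

Lemma mprop_and P Q : mprop P -> mprop Q -> mprop (fun w => P w /\ Q w).
Proof. exact: measurableI. Qed.

Lemma mprop_or P Q : mprop P -> mprop Q -> mprop (fun w => P w \/ Q w).
Proof. exact: measurableU. Qed.

Lemma mprop_ex (P : nat -> Om -> Prop) : (forall n, mprop (P n)) ->
  mprop (fun w => exists n, P n w).
Proof.
move=> mP; rewrite /mprop (_ : [set _ | _] = \bigcup_n [set w | P n w]).
  by apply: bigcup_measurable => n _; exact: mP.
by apply/seteqP; split=> w; [move=> [n Pn]; exists n|move=> [n _ Pn]; exists n].
Qed.

Lemma mprop_all (P : nat -> Om -> Prop) : (forall n, mprop (P n)) ->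
  mprop (fun w => forall n, P n w).
Proof.
move=> mP; rewrite /mprop (_ : [set _ | _] = \bigcap_n [set w | P n w]).
  by apply: bigcap_measurable => // n _; exact: mP.
by apply/seteqP; split=> w /= h n; [move=> _; exact: h|exact: (h n I)].
Qed.

Lemma mprop_const (P : Prop) : mprop (fun=> P).
Proof.
have [p|np] := pselect P.
  by apply: (@eq_mprop (fun=> True)) => //; exact: measurableT.
apply: (@eq_mprop (fun=> False)); first by move=> w; split.
by rewrite /mprop (_ : [set _ | _] = set0)//; apply/seteqP; split.
Qed.

Lemma mprop_imp P Q : mprop P -> mprop Q -> mprop (fun w => P w -> Q w).
Proof.
move=> mP mQ; apply: (@eq_mprop (fun w => ~ P w \/ Q w)).
  move=> w; split=> [[nP /nP//|//]|PQ].
  by have [p|] := pselect (P w); [right; exact: PQ|left].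
by apply: mprop_or mQ; exact: mprop_not.
Qed.

Lemma mprop_ex_count (C : countType) (P : C -> Om -> Prop) : (forall c, mprop (P c)) ->
  mprop (fun w => exists c, P c w).
Proof.
move=> mP; apply: (@eq_mprop (fun w => exists n, exists2 c, unpickle n = Some c & P c w)).
  move=> w; split=> [[n [c _ Pc]]|[c Pc]]; first by exists c.
  by exists (pickle c), c => //; exact: pickleK.
apply: mprop_ex => n; case: (unpickle n) => [c|].
  by apply: eq_mprop (mP c) => w; split=> [Pc|[_ [<-]]//]; exists c.
by apply: eq_mprop (mprop_const False) => w; split=> // -[].
Qed.

Lemma mprop_all_count (C : countType) (P : C -> Om -> Prop) : (forall c, mprop (P c)) ->
  mprop (fun w => forall c, P c w).
Proof.
move=> mP; apply: (@eq_mprop (fun w => ~ exists c, ~ P c w)).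
  move=> w; split=> [h c|h [c]]; last exact.
  by apply: contrapT => nP; apply: h; exists c.
by apply: mprop_not; apply: mprop_ex_count => c; exact: mprop_not.
Qed.

Lemma mprop_near (P : nat -> Om -> Prop) : (forall i, mprop (P i)) ->
  mprop (fun w => \forall i \near \oo, P i w).
Proof.
move=> mP; apply: (@eq_mprop (fun w => exists n, forall i, (n <= i)%N -> P i w)).
  by move=> w; split=> [[n h]|[n _ h]]; exists n.
apply: mprop_ex => n; apply: mprop_all => i.
by apply: mprop_imp => //; exact: mprop_const.
Qed.

Definition mnat (N : Om -> nat) : Prop := forall k, mprop (fun w => N w = k).

Lemma mnat_first (P : nat -> Om -> Prop) : (forall n, mprop (P n)) ->
  mnat (fun w => first (P^~ w)).
Proof.
move=> mP k.
apply: (@eq_mprop (fun w => (P k w /\ forall j, (j < k)%N -> ~ P j w) \/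
   (k = 0%N /\ forall n, ~ P n w))).
  move=> w; split=> [[[Pk h]|[-> h]]|<-].
  - apply/eqP; rewrite eqn_leq first_le//= leqNgt; apply/negP => lt.
    by apply: (h _ lt); apply: (@firstP (P^~ w)); exists k.
  - exact: first_none.
  have [[n Pn]|nP] := pselect (exists n, P n w).
    left; split; first by apply: (@firstP (P^~ w)); exists n.
    by move=> j jk Pj; have := @first_le (P^~ w) j Pj; rewrite leqNgt jk.
  right; have nP' n : ~ P n w by move=> Pn; apply: nP; exists n.
  by split=> //; exact: first_none.
apply: mprop_or.
  apply: mprop_and => //; apply: mprop_all => j.
  by apply: mprop_imp; [exact: mprop_const|exact: mprop_not].
apply: mprop_and; first exact: mprop_const.
by apply: mprop_all => n; exact: mprop_not.
Qed.

Lemma mnat_prop (N : Om -> nat) (P : nat -> Om -> Prop) : mnat N ->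
  (forall n, mprop (P n)) -> mprop (fun w => P (N w) w).
Proof.
move=> mN mP; apply: (@eq_mprop (fun w => exists k, N w = k /\ P k w)).
  by move=> w; split=> [[k [-> ]]//|h]; exists (N w).
by apply: mprop_ex => k; apply: mprop_and.
Qed.

End MeasurableProps.

Section MeasurableMatrices.
Context {dd : measure_display} {Om : measurableType dd} {R : realType}.

Definition mreal (f : Om -> R) : Prop := measurable_fun [set: Om] f.

Lemma mreal_gt f : (forall c, mprop (fun w => c < f w)) -> mreal f.
Proof.
move=> mf mD; apply: (measurability _ (RGenOInfty.measurableE R)) => //.
move=> _ [_ [c ->] <-]; rewrite setTI.
by have := mf c; rewrite /mprop; congr measurable; apply/seteqP; split=> w /=;
  rewrite in_itv /= andbT.
Qed.

Lemma mprop_lt f g : mreal f -> mreal g -> mprop (fun w => f w < g w).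
Proof.
move=> mf mg; have h := measurable_fun_ltr mf mg.
by rewrite /mprop -[X in measurable X]setTI; apply: (h measurableT [set true]).
Qed.

Lemma mprop_le f g : mreal f -> mreal g -> mprop (fun w => f w <= g w).
Proof.
move=> mf mg; have h := measurable_fun_ler mf mg.
by rewrite /mprop -[X in measurable X]setTI; apply: (h measurableT [set true]).
Qed.

Lemma mreal_cst c : mreal (fun=> c). Proof. exact: measurable_cst. Qed.

Lemma mreal_norm f : mreal f -> mreal (fun w => `|f w|).
Proof. by move=> mf; apply: measurableT_comp mf; exact: normr_measurable. Qed.

Lemma mreal_powR f p : mreal f -> mreal (fun w => f w `^ p).
Proof.
move=> mf; apply: (measurableT_comp (f := (@powR R)^~ p) _ mf).
exact: measurable_powR.
Qed.

Lemma eq_mreal f g : f =1 g -> mreal f -> mreal g.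
Proof. by move=> /funext ->. Qed.

Lemma mreal_natcomp (N : Om -> nat) (f : nat -> Om -> R) : mnat N ->
  (forall n, mreal (f n)) -> mreal (fun w => f (N w) w).
Proof.
move=> mN mf; apply: mreal_gt => c; apply: (mnat_prop (P := fun k w => c < f k w)) => // n.
by apply: mprop_lt => //; exact: mreal_cst.
Qed.

Lemma mreal_lim (f : nat -> Om -> R) : (forall n, mreal (f n)) ->
  mreal (fun w => esup_lim (f^~ w)).
Proof.
move=> mf; apply: (measurableT_comp (fine_measurable measurableT)).
by apply: measurable_fun_limn_esup => n; apply/measurable_EFinP; exact: mf.
Qed.

Lemma mreal_sum n (f : 'I_n -> Om -> R) : (forall i, mreal (f i)) ->
  mreal (fun w => \sum_i f i w).
Proof. by move=> mf; apply: measurable_sum. Qed.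

Lemma mreal_sup (C : countType) (A : C -> Prop) (f : C -> Om -> R) :
  (forall c, A c -> mreal (f c)) ->
  (forall w, has_sup [set f c w | c in A]) -> mreal (fun w => sup [set f c w | c in A]).
Proof.
move=> mf hs; apply: mreal_gt => b.
apply: (@eq_mprop _ _ (fun w => exists c, A c /\ b < f c w)).
  move=> w; split=> [[c [Ac bc]]|bs].
    by apply: lt_le_trans bc _; apply: ub_le_sup; [exact: (hs w).2|exists c].
  have e0 : 0 < sup [set f c w | c in A] - b by rewrite subr_gt0.
  have [_ [c Ac <-]] := sup_adherent e0 (hs w).
  by rewrite opprB addrC subrK => bc; exists c.
apply: mprop_ex_count => c; have [Ac|nAc] := pselect (A c).
  by apply: mprop_and; [exact: mprop_const|apply: mprop_lt (mf c Ac); exact: mreal_cst].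
by apply: (@eq_mprop _ _ (fun=> False)) (mprop_const False) => w; split=> // -[].
Qed.

Section Matrices.
Context {m n : nat}.
Implicit Types (f g : Om -> 'M[R]_(m, n)).

Definition mmx f : Prop := forall i j, mreal (fun w => f w i j).

Lemma mmx_cst A : mmx (fun=> A). Proof. by move=> i j; exact: mreal_cst. Qed.

Lemma mmxD f g : mmx f -> mmx g -> mmx (fun w => f w + g w).
Proof.
move=> mf mg i j; apply: (@eq_mreal (fun w => f w i j + g w i j)).
  by move=> w; rewrite mxE.
by apply: measurable_funD; [exact: mf|exact: mg].
Qed.

Lemma mmxB f g : mmx f -> mmx g -> mmx (fun w => f w - g w).
Proof.
move=> mf mg i j; apply: (@eq_mreal (fun w => f w i j - g w i j)).
  by move=> w; rewrite !mxE.
by apply: measurable_funB; [exact: mf|exact: mg].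
Qed.

Lemma mmx_natcomp (N : Om -> nat) (f : nat -> Om -> 'M[R]_(m, n)) : mnat N ->
  (forall k, mmx (f k)) -> mmx (fun w => f (N w) w).
Proof.
move=> mN mf i j; apply: (mreal_natcomp (f := fun k w => f k w i j)) => // k.
exact: mf.
Qed.

Lemma mmx_lim (f : nat -> Om -> 'M[R]_(m, n)) : (forall k, mmx (f k)) ->
  mmx (fun w => mx_lim (f^~ w)).
Proof.
move=> mf i j; apply: (@eq_mreal (fun w => esup_lim (fun k => f k w i j))).
  by move=> w; rewrite mxE.
by apply: mreal_lim => k; exact: mf.
Qed.

Lemma mprop_norm_lt f c : mmx f -> mprop (fun w => `|f w| < c).
Proof.
move=> mf; have [c0|c0] := ltP 0 c; last first.
  apply: (@eq_mprop _ _ (fun=> False)); last exact: mprop_const.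
  by move=> w; split=> //; rewrite ltNge (le_trans c0).
apply: (@eq_mprop _ _ (fun w => forall ij : 'I_m * 'I_n, `|f w ij.1 ij.2| < c)).
  move=> w; rewrite mx_norm_ltP//; split=> [h i j|h [i j]]; last exact: h.
  exact: (h (i, j)).
apply: mprop_all_count => -[i j]; apply: mprop_lt; last exact: mreal_cst.
by apply: mreal_norm; exact: mf.
Qed.

Lemma mreal_mx_norm f : mmx f -> mreal (fun w => `|f w|).
Proof.
move=> mf; apply: mreal_gt => c.
apply: (@eq_mprop _ _ (fun w => ~ forall r : rat, c < ratr r -> `|f w| < ratr r)).
  move=> w; split=> [h|cf h].
    rewrite ltNge; apply/negP => fc; apply: h => r; exact: le_lt_trans.
  have [r] := rat_in_itvoo cf; rewrite in_itv /= => /andP[cr rf].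
  by have := lt_trans rf (h r cr); rewrite ltxx.
apply: mprop_not; apply: mprop_all_count => r; apply: mprop_imp; first exact: mprop_const.
exact: mprop_norm_lt.
Qed.

End Matrices.

Lemma mmxM m n p (f : Om -> 'M[R]_(m, n)) (g : Om -> 'M[R]_(n, p)) :
  mmx f -> mmx g -> mmx (fun w => f w *m g w).
Proof.
move=> mf mg i j; apply: (@eq_mreal (fun w => \sum_k f w i k * g w k j)).
  by move=> w; rewrite mxE.
by apply: mreal_sum => k; apply: measurable_funM; [exact: mf|exact: mg].
Qed.

(** An open set is the union of the products of balls of rational centers and
    dyadic radii that it contains. *)
Lemma mprop_open2 m n k p (f : Om -> 'M[R]_(m, n)) (g : Om -> 'M[R]_(k, p))
    (O : set ('M[R]_(m, n) * 'M[R]_(k, p))) :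
  mmx f -> mmx g -> open O -> mprop (fun w => O (f w, g w)).
Proof.
move=> mf mg oO.
pose good (c : nat * nat * nat) := forall a b,
  `|a - ratmx c.1.1| < dy c.2 -> `|b - ratmx c.1.2| < dy c.2 -> O (a, b).
apply: (@eq_mprop _ _ (fun w => exists c : nat * nat * nat,
   good c /\ (`|f w - ratmx c.1.1| < dy c.2 /\ `|g w - ratmx c.1.2| < dy c.2))).
  move=> w; split=> [[c [gc [h1 h2]]]|Ow]; first exact: gc.
  have /nbhs_ballP[r /= r0 rO] : nbhs (f w, g w) O by apply: open_nbhs_nbhs; split.
  have r20 : 0 < r / 2 by rewrite divr_gt0.
  have [l hl] := dy_small r20.
  have [i hi] := ratmx_dense (f w) (dy_gt0 (R := R) l).
  have [j hj] := ratmx_dense (g w) (dy_gt0 (R := R) l).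
  exists (i, j, l); split=> // a b /= ha hb; apply: rO.
  have key (m' n' : nat) (u v u' : 'M[R]_(m', n')) : `|u - u'| < dy l -> `|v - u'| < dy l -> `|u - v| < r.
    move=> h1 h2; have -> : u - v = (u - u') - (v - u') by rewrite opprB subrKA.
    apply: le_lt_trans (ler_normB _ _) _; rewrite (splitr r).
    by apply: ltrD; exact: lt_trans hl.
  by split; rewrite -ball_normE /=; [exact: key hi ha|exact: key hj hb].
apply: mprop_ex_count => c; apply: mprop_and; first exact: mprop_const.
by apply: mprop_and; apply: mprop_norm_lt; apply: mmxB => //; exact: mmx_cst.
Qed.

Lemma mprop_open m n (f : Om -> 'M[R]_(m, n)) (O : set 'M[R]_(m, n)) :
  mmx f -> open O -> mprop (fun w => O (f w)).
Proof.
move=> mf oO.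
have oO' : open [set yz : 'M[R]_(m, n) * 'M[R]_(m, n) | O yz.1].
  by apply: (@open_comp _ _ fst) => // yz _; exact: cvg_fst.
by have := mprop_open2 mf mf oO'.
Qed.

End MeasurableMatrices.

(** * Measurable diagonal subsequences *)

Section DiagonalSubsequence.
Context {dd : measure_display} {Om : measurableType dd}.
Variable S : nat -> nat -> Om -> Prop.
Hypothesis mS : forall i n, mprop (S i n).

Let unbounded (P : nat -> Prop) := forall m, exists n, (m <= n)%N /\ P n.

(** The integers left after the first [i] decisions: at each step, keep those
    which satisfy the condition if there are infinitely many of them, and those
    which do not otherwise. *)
Fixpoint kept (i : nat) (w : Om) (n : nat) : Prop :=
  if i is i'.+1 then
    kept i' w n /\
    ((unbounded (fun n' => kept i' w n' /\ S i' n' w) /\ S i' n w) \/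
     (~ unbounded (fun n' => kept i' w n' /\ S i' n' w) /\ ~ S i' n w))
  else True.

Definition diag (i : nat) (w : Om) : nat := first (fun n => (i <= n)%N /\ kept i w n).

Let kept_unbounded i w : unbounded (kept i w).
Proof.
elim: i => [|i IH] m; first by exists m.
have [U|nU] := pselect (unbounded (fun n' => kept i w n' /\ S i n' w)).
  by have [n [mn [kn Sn]]] := U m; exists n; split=> //; split=> //; left.
have [m' hm'] : exists m', forall n, (m' <= n)%N -> kept i w n -> ~ S i n w.
  apply: contrapT => h; apply: nU => m'; apply: contrapT => h'; apply: h.
  by exists m' => n m'n kn Sn; apply: h'; exists n.
have [n [mn kn]] := IH (maxn m m').
move: mn; rewrite geq_max => /andP[mn m'n].
by exists n; split=> //; split=> //; right; split=> //; exact: hm'.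
Qed.

Let diagP i w : (i <= diag i w)%N /\ kept i w (diag i w).
Proof.
apply: (@firstP (fun n => (i <= n)%N /\ kept i w n)).
by have [n [? ?]] := kept_unbounded i w i; exists n.
Qed.

Lemma diag_ge i w : (i <= diag i w)%N. Proof. by case: (diagP i w). Qed.

Let kept_le i j w n : (i <= j)%N -> kept j w n -> kept i w n.
Proof.
elim: j => [|j IH]; first by rewrite leqn0 => /eqP->.
by rewrite leq_eqVlt => /orP[/eqP->//|ij [kj _]]; exact: IH.
Qed.

Lemma diag_decided i w : decided (fun l => S i (diag l w) w).
Proof.
have k l : (i < l)%N -> kept i.+1 w (diag l w).
  by move=> il; apply: (kept_le il); case: (diagP l w).
have [U|nU] := pselect (unbounded (fun n' => kept i w n' /\ S i n' w)).
  by left; exists i.+1 => // l /k[_ [[]//|[]]].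
by right; exists i.+1 => // l /k[_ [[]//|[]]].
Qed.

Let mkept i n : mprop (fun w => kept i w n).
Proof.
elim: i n => [|i IH] n; first exact: mprop_const.
have mU : mprop (fun w => unbounded (fun n' => kept i w n' /\ S i n' w)).
  apply: mprop_all => m; apply: mprop_ex => n'.
  by apply: mprop_and; [exact: mprop_const|apply: mprop_and].
apply: mprop_and => //; apply: mprop_or; apply: mprop_and => //; exact: mprop_not.
Qed.

Lemma mnat_diag i : mnat (diag i).
Proof.
apply: mnat_first => n; apply: mprop_and => //; exact: mprop_const.
Qed.

End DiagonalSubsequence.

(** * The measurable space of starting points and drivers *)

Section TraceSigmaAlgebra.
Context {R : realType} {e d : nat}.
Variables (T q : R) (U : set 'cV[R]_e).

Let Om0 : pointedType := ('cV[R]_e * (R -> 'cV[R]_d))%type.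

(** All subsets of the complement of [Omega] are added, so that [Omega] itself
    becomes measurable and functions only matter on [Omega]. *)
Definition trace_system : set (set Om0) :=
  [set A | Omega_sigma T q U (A `&` Omega T q U)].

Lemma trace_sigma_algebra : sigma_algebra setT trace_system.
Proof.
split.
- by rewrite /trace_system /= set0I; exact: sigma_algebra0.
- move=> A sA; rewrite /trace_system /=.
  have -> : (setT `\` A) `&` Omega T q U = Omega T q U `\` (A `&` Omega T q U).
    by apply/seteqP; split=> w [] => [[_ nA] Ow|Ow nA]; split=> //; [case|split=> // Aw; apply: nA].
  exact: sigma_algebraCD.
- move=> A sA; rewrite /trace_system /= setI_bigcupl.
  by apply: sigma_algebra_bigcup => n; exact: sA.
Qed.

Definition data : Type := g_sigma_algebraType trace_system.
HB.instance Definition _ := Measurable.on data.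

Lemma mprop_trace (P : data -> Prop) :
  mprop P <-> Omega_sigma T q U ([set w | P w] `&` Omega T q U).
Proof.
have E := measurable_g_measurableTypeE trace_sigma_algebra.
split=> h; first exact: (eq_ind _ (fun M : set (set Om0) => M [set w | P w]) h _ E).
exact: (eq_ind _ (fun M : set (set Om0) => M [set w | P w]) h _ (esym E)).
Qed.

Lemma mprop_on (P Q : data -> Prop) :
  (forall w, Omega T q U w -> (P w <-> Q w)) -> mprop P -> mprop Q.
Proof.
move=> PQ; rewrite !mprop_trace; congr (Omega_sigma _ _ _ _).
by apply/seteqP; split=> w [h Ow]; split=> //; exact/(PQ w Ow).
Qed.

Lemma mreal_on (f g : data -> R) :
  (forall w, Omega T q U w -> f w = g w) -> mreal f -> mreal g.
Proof.
move=> fg mf; apply: mreal_gt => c; apply: (mprop_on (P := fun w => c < f w)).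
  by move=> w /fg ->.
by apply: mprop_lt => //; exact: mreal_cst.
Qed.

Lemma mmx_on m n (f g : data -> 'M[R]_(m, n)) :
  (forall w, Omega T q U w -> f w = g w) -> mmx f -> mmx g.
Proof.
move=> fg mf i j; apply: (mreal_on (f := fun w => f w i j)); last exact: mf.
by move=> w /fg ->.
Qed.

Let open_entry m n (i : 'I_m) (j : 'I_n) c : open [set y : 'M[R]_(m, n) | c < y i j].
Proof.
apply: (@open_comp _ _ (fun y : 'M[R]_(m, n) => y i j) [set r | c < r]).
  by move=> y _; exact: coord_continuous.
exact: open_gt.
Qed.

Lemma mmx_initial : mmx (fun w : data => w.1).
Proof.
move=> i j; apply: mreal_gt => c; apply/mprop_trace.
apply: sub_sigma_algebra; left.
exists (U `&` [set y : 'cV[R]_e | c < y i j]).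
  apply: sub_sigma_algebra; exists [set y : 'cV[R]_e | c < y i j] => //; exact: open_entry.
by apply/seteqP; split=> w [] => [Ow [Uw cw]|cw Ow]; split=> //; case: Ow.
Qed.

Lemma mmx_driver t : 0 <= t <= T -> mmx (fun w : data => w.2 t).
Proof.
move=> tT i j; apply: mreal_gt => c; apply/mprop_trace.
apply: sub_sigma_algebra; right.
exists (Vp_cont q `[0, T] `&` [set x : R -> 'cV[R]_d | c < x t i j]).
  apply: sub_sigma_algebra; exists t; first by rewrite /= in_itv.
  exists [set y : 'cV[R]_d | c < y i j] => //.
  apply: sub_sigma_algebra; exists [set y : 'cV[R]_d | c < y i j]; first exact: open_entry.
  by rewrite setTI.
by apply/seteqP; split=> w [] => [Ow [Uw cw]|cw Ow]; split=> //; case: Ow.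
Qed.

End TraceSigmaAlgebra.

(** * Measurability of the construction *)

Section MeasurableConstruction.
Context {R : realType} {e d : nat}.
Variables (T q gamma : R) (U : set 'cV[R]_e) (F : 'cV[R]_e -> set 'M[R]_(e, d)).
Hypotheses (T_gt0 : 0 < T) (q_range : 1 <= q < 2) (gamma_gt0 : 0 < gamma).
Hypothesis U_open : open U.
Hypothesis F_holder : locally_holder gamma U F.

Let q_ge1 : 1 <= q. Proof. by case/andP: q_range. Qed.
Let q_le2 : q <= 2. Proof. by case/andP: q_range => _ /ltW. Qed.

Let Om := @data R e d T q U.
Let OmegaT := @Omega R e d T q U.

Let mem_Omega w : OmegaT w ->
  [/\ U w.1, {within `[0, T], continuous w.2} & Vp q `[0, T] w.2].
Proof. by move=> [Uw [Vw cw]]; split. Qed.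

(** The variation is a supremum over the countable set of rational subdivisions. *)
Lemma mreal_clock t : t <= T -> mreal (fun w : Om => clock q w.2 t).
Proof.
move=> tT; have DT : `[0, t[%classic `<=` `[0, T]%classic.
  by move=> u /=; rewrite !in_itv /= => /andP[-> /ltW /le_trans]; apply.
pose pts (s : seq rat) : seq R := map (ratr : rat -> R) s.
pose A (s : seq rat) := rat_subdiv `[0, t[ (pts s).
pose f (s : seq rat) (w : Om) : R :=
  if `[< OmegaT w >] then var_sum q w.2 (pts s) else 0.
have hs w : has_sup [set f s w | s in A].
  have Anil : A [::] by [].
  rewrite /f; case: asboolP => [Ow|_]; last first.
    by split; [exists 0, [::]|exists 0 => _ [s _ <-]].
  have [_ cw Vw] := mem_Omega Ow.
  split; first by eexists; exists [::].
  have [M hM] := (rat_var_has_sup q_ge1 Vw DT).2.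
  by exists M => _ [s As <-]; apply: hM; exists (pts s).
have mf s : A s -> mreal (f s).
  move=> As; apply: (mreal_on (f := fun w : Om => var_sum q w.2 (pts s))).
    by move=> w Ow; rewrite /f asboolT.
  apply: mreal_sum => k; apply: mreal_powR; apply: mreal_mx_norm.
  have ks : (k.+1 < size (pts s))%N by rewrite -ltn_predRL.
  have inT i : (i < size (pts s))%N -> 0 <= (pts s)`_i <= T.
    move=> il; have [] := As.2 _ (mem_nth 0 il) => + _.
    by move=> /DT; rewrite /= in_itv /= .
  by apply: mmxB; apply: mmx_driver; apply: inT => //; exact: ltnW.
apply: (mreal_on (f := fun w => t + sup [set f s w | s in A])).
  move=> w Ow; rewrite /clock /rat_var; congr (_ + sup _).
  apply/seteqP; split=> [_ [s As <-]|_ [s [ss sD] <-]].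
    by rewrite /f asboolT//; exists (pts s).
  have [s' Es] : exists s' : seq rat, s = pts s'.
    elim: (s) sD => [|a r IH] h; first by exists [::].
    have [|r' ->] := IH; first by move=> u ur; apply: h; rewrite inE ur orbT.
    by have [_ [a' ->]] := h a (mem_head _ _); exists (a' :: r').
  by exists s'; rewrite /A /f ?asboolT// -Es.
apply: measurable_funD; first exact: mreal_cst.
exact: mreal_sup.
Qed.

Let clockT_gt0 w : OmegaT w -> 0 < clock q w.2 T.
Proof.
move=> /mem_Omega[_ cw Vw].
have := clock_lt q_ge1 cw Vw (lexx 0) T_gt0 (lexx T).
by rewrite (clock0 q_ge1 T_gt0 Vw).
Qed.

Lemma mprop_unit_clock_ge c t : t <= T -> mprop (fun w : Om => c <= unit_clock q T w.2 t).
Proof.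
move=> tT; apply: (mprop_on (P := fun w : Om => c * clock q w.2 T <= clock q w.2 t)).
  by move=> w Ow; rewrite /unit_clock ler_pdivlMr ?clockT_gt0.
apply: mprop_le; last exact: mreal_clock.
by apply: measurable_funM; [exact: mreal_cst|exact: mreal_clock].
Qed.

Lemma mprop_unit_clock_le c t : t <= T -> mprop (fun w : Om => unit_clock q T w.2 t <= c).
Proof.
move=> tT; apply: (mprop_on (P := fun w : Om => clock q w.2 t <= c * clock q w.2 T)).
  by move=> w Ow; rewrite /unit_clock ler_pdivrMr ?clockT_gt0.
apply: mprop_le; first exact: mreal_clock.
by apply: measurable_funM; [exact: mreal_cst|exact: mreal_clock].
Qed.

(** The floor of [f] is determined by countably many superlevel sets of [f]. *)
Let mnat_fl j (f : Om -> R) : (forall c, 0 <= c -> mprop (fun w : Om => c <= f w)) ->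
  (forall w, OmegaT w -> 0 <= f w) ->
  forall g : Om -> nat, (forall w, OmegaT w -> g w = fl j (f w)) ->
  (forall w, ~ OmegaT w -> g w = 0%N) -> mnat g.
Proof.
move=> mf f0 g gE g0 k.
apply: (mprop_on (P := fun w => k%:R * dy j <= f w /\ ~ k.+1%:R * dy j <= f w)).
  move=> w Ow; rewrite gE//; split=> [[h1 /negP]|<-].
    by rewrite -ltNge => h2; apply: fl_uniq; rewrite h1.
  have /andP[h1 h2] := fl_itv j (f0 w Ow); split=> //.
  by apply/negP; rewrite -ltNge.
apply: mprop_and; first by apply: mf; rewrite mulr_ge0 ?dy_ge0.
by apply: mprop_not; apply: mf; rewrite mulr_ge0 ?dy_ge0.
Qed.

(** Set to [0] outside [Omega], where the clock has no meaning. *)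
Definition clock_index j t (w : Om) : nat :=
  if `[< OmegaT w >] then fl j (unit_clock q T w.2 t) else 0%N.

Lemma mnat_clock_index j t : 0 <= t <= T -> mnat (clock_index j t).
Proof.
move=> /andP[t0 tT]; apply: (@mnat_fl j (fun w : Om => unit_clock q T w.2 t)).
- by move=> c _; exact: mprop_unit_clock_ge.
- move=> w /mem_Omega[_ cw Vw].
  by case/andP: (unit_clock_itv q_ge1 T_gt0 cw Vw (ltac:(by rewrite t0 tT) : 0 <= t <= T)).
- by move=> w Ow; rewrite /clock_index asboolT.
- by move=> w nOw; rewrite /clock_index asboolF.
Qed.

Lemma mprop_clock_inv_ge s t : 0 <= s -> 0 <= t ->
  mprop (fun w : Om => t <= clock_inv q T w.2 s).
Proof.
move=> s0 t0; have [tT|tT] := leP t T.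
  apply: (mprop_on (P := fun w : Om => unit_clock q T w.2 t <= s)).
    move=> w /mem_Omega[_ cw Vw].
    by rewrite (clock_inv_ge q_ge1 q_le2 T_gt0 cw Vw)// t0.
  exact: mprop_unit_clock_le.
apply: (mprop_on (P := fun w : Om => False)); last exact: mprop_const.
move=> w /mem_Omega[_ cw Vw]; split=> //.
have [/andP[_ iT] _] := clock_inv_spec q_ge1 q_le2 T_gt0 cw Vw s0.
by rewrite leNgt (le_lt_trans iT tT).
Qed.

(** Evaluations of the driver are measurable at deterministic times only. The
    random time [clock_inv] is approached by its dyadic floors, which take
    countably many values. *)
Lemma mmx_slow s : 0 <= s -> mmx (fun w : Om => slow q T w.2 s).
Proof.
move=> s0.
pose N n (w : Om) : nat := if `[< OmegaT w >] then fl n (clock_inv q T w.2 s / T) else 0%N.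
have mN n : mnat (N n).
  apply: (@mnat_fl n (fun w : Om => clock_inv q T w.2 s / T)).
  - move=> c c0; apply: (@eq_mprop _ _ (fun w : Om => c * T <= clock_inv q T w.2 s)).
      by move=> w; rewrite ler_pdivlMr.
    by apply: mprop_clock_inv_ge => //; rewrite mulr_ge0// ltW.
  - move=> w /mem_Omega[_ cw Vw].
    have [/andP[i0 _] _] := clock_inv_spec q_ge1 q_le2 T_gt0 cw Vw s0.
    by rewrite divr_ge0// ltW.
  - by move=> w Ow; rewrite /N asboolT.
  - by move=> w nOw; rewrite /N asboolF.
pose f n k (w : Om) : 'cV[R]_d := if k%:R * dy n <= 1 :> R then w.2 (k%:R * dy n * T) else 0.
have mf n k : mmx (f n k).
  have [h|h] := boolP (k%:R * dy n <= 1 :> R); last first.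
    have -> : f n k = fun=> 0 by apply/funext => w; rewrite /f (negbTE h).
    exact: mmx_cst.
  have -> : f n k = fun w : Om => w.2 (k%:R * dy n * T) by apply/funext => w; rewrite /f h.
  apply: mmx_driver; rewrite !mulr_ge0 ?dy_ge0 ?(ltW T_gt0)//=.
  by rewrite ler_piMl// ltW.
apply: (mmx_on (f := fun w : Om => mx_lim (fun n => f n (N n w) w))); last first.
  by apply: mmx_lim => n; apply: mmx_natcomp.
move=> w Ow; apply: mx_limE; have [_ cw Vw] := mem_Omega Ow.
have [iT _] := clock_inv_spec q_ge1 q_le2 T_gt0 cw Vw s0.
rewrite /slow; set u := clock_inv q T w.2 s in iT *.
have uT0 : 0 <= u / T by rewrite divr_ge0 ?(ltW T_gt0)//; case/andP: iT.
apply/cvgrPdist_lt => eps e0.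
have [del d0 hdel] := x_near cw iT e0.
have dT : 0 < del / T by rewrite divr_gt0.
have [n0 hn0] := dy_small dT.
exists n0 => // n /= n0n.
rewrite /f /N asboolT// -/u.
have h1 := fl_le n uT0; have h2 := fl_gt n uT0.
have uT1 : u / T <= 1 by rewrite ler_pdivrMr// mul1r; case/andP: iT.
rewrite (le_trans h1 uT1) distrC; apply: hdel.
  rewrite !mulr_ge0 ?dy_ge0 ?(ltW T_gt0)//=; rewrite ler_piMl ?(ltW T_gt0)//.
  exact: le_trans h1 uT1.
rewrite distrC ger0_norm; last first.
  by rewrite subr_ge0 -ler_pdivlMr.
have E (y : R) : u - y * T = (u / T - y) * T by rewrite mulrBl divfK// gt_eqF.
rewrite E -ltr_pdivlMr//; apply: le_lt_trans (le_lt_trans (dy_le n0n) hn0).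
by rewrite lerBlDl -[X in _ + X]mul1r -mulrDl natr1 ltW.
Qed.

Section Scheme.

Let scheme_ n (w : Om) := scheme U F (slow q T w.2) w.1 n.

Let near_value_prop eps (y : Om -> 'cV[R]_e) i : mmx y ->
  mprop (fun w => near_value U F eps (y w) i).
Proof.
move=> my; have oN : open [set y | near_value U F eps y i].
  apply: (near_value_open _ _ gamma_gt0) => y0 Uy0.
  have [m [del [d0 h]]] := @exhaust_near _ _ U [set y0] U_open (@compact_set1 _ y0)
    (ltac:(by move=> _ ->)).
  exists (exhaust U m); split; first exact: exhaust_sub.
    exact: F_holder (@exhaust_compact _ _ U m) (@exhaust_sub _ _ U m).
  apply/nbhs_ballP; exists del => // u; rewrite -ball_normE /= distrC => uy.
  by apply: (h y0) => //; exact: ltW.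
exact: (mprop_open my oN).
Qed.

Let mmx_sel eps (y : Om -> 'cV[R]_e) (v : Om -> 'M[R]_(e, d)) : mmx y -> mmx v ->
  mmx (fun w => sel U F eps (y w) (v w)).
Proof.
move=> my mv; apply: (mmx_natcomp (f := fun i _ => ratmx i)); last first.
  by move=> i; exact: mmx_cst.
apply: (mnat_first (P := fun i w => sel_good U F eps (y w) (v w) i)) => i.
apply: mprop_and; first exact: near_value_prop.
have mn j : mreal (fun w => `|ratmx j - v w|).
  by apply: mreal_mx_norm; apply: mmxB => //; exact: mmx_cst.
apply: mprop_all => j; apply: mprop_imp; first exact: near_value_prop.
apply: mprop_le; first exact: mn.
by apply: measurable_funD; [exact: mn|exact: mreal_cst].
Qed.

Let mmx_scheme n k : mmx (fun w => (scheme_ n w k).1) /\ mmx (fun w => (scheme_ n w k).2).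
Proof.
elim/ltn_ind: k => -[_|k IH].
  split; first exact: mmx_initial.
  by apply: mmx_sel; [exact: mmx_initial|exact: mmx_cst].
have [my mv] := IH k (ltnSn k).
have [_ mp] := IH (parent k.+1) (leq_ltn_trans (parent_lt k) (ltnSn k)).
have E1 : (fun w => (scheme_ n w k.+1).1) = fun w : Om => (scheme_ n w k).1 + (scheme_ n w k).2 *m
    (slow q T w.2 (k.+1%:R * dy n) - slow q T w.2 (k%:R * dy n)).
  by apply/funext => w; rewrite /scheme_ /scheme euler_positionS.
have m1 : mmx (fun w => (scheme_ n w k.+1).1).
  rewrite E1; apply: mmxD => //; apply: mmxM => //.
  by apply: mmxB; apply: mmx_slow; rewrite mulr_ge0 ?dy_ge0.
split=> //.
have -> : (fun w => (scheme_ n w k.+1).2) = fun w : Om =>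
    sel U F (dy n) (scheme_ n w k.+1).1 (scheme_ n w (parent k.+1)).2.
  by apply/funext => w; rewrite /scheme_ /scheme euler_velocityS.
exact: mmx_sel.
Qed.

Lemma mmx_posn n k : mmx (fun w : Om => posn U F (slow q T w.2) w.1 n k).
Proof. exact: (mmx_scheme n k).1. Qed.

Lemma mmx_velo n k : mmx (fun w : Om => velo U F (slow q T w.2) w.1 n k).
Proof. exact: (mmx_scheme n k).2. Qed.

End Scheme.

(** The questions decided along the subsequence: the position of every
    coordinate of the scheme with respect to every rational number, and whether
    the scheme remains in a given member of the exhaustion up to a dyadic time. *)
Definition question : countType :=
  ((nat * nat * ('I_e * 'I_1) * rat) + (nat * nat * ('I_e * 'I_d) * rat) +
   (nat * nat * nat))%type.

Definition answer (c : question) (n : nat) (w : Om) : Prop :=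
  let X := slow q T w.2 in
  match c with
  | inl (inl (j, k, (a, b), r)) => ratr r < posn U F X w.1 n (refine n j k) a b
  | inl (inr (j, k, (a, b), r)) => ratr r < velo U F X w.1 n (refine n j k) a b
  | inr (j, k, m) => forall k', k'%:R * dy n <= k%:R * dy j :> R ->
      exhaust U m (posn U F X w.1 n k')
  end.

Lemma mprop_answer c n : mprop (answer c n).
Proof.
case: c => [[[[[j k] [a b]] r]|[[[j k] [a b]] r]]|[[j k] m]] /=.
- by apply: mprop_lt; [exact: mreal_cst|exact: mmx_posn].
- by apply: mprop_lt; [exact: mreal_cst|exact: mmx_velo].
apply: mprop_all => k'; apply: mprop_imp; first exact: mprop_const.
apply: (@eq_mprop _ _ (fun w : Om => ~ (~` exhaust U m) (posn U F (slow q T w.2) w.1 n k'))).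
  by move=> w; split=> [/contrapT|h] //; apply.
apply: mprop_not; apply: mprop_open; first exact: mmx_posn.
by apply: closed_openC; exact: exhaust_closed.
Qed.

Definition numbered_answer (i n : nat) (w : Om) : Prop :=
  if unpickle i is Some c then answer c n w else True.

Let mprop_numbered i n : mprop (numbered_answer i n).
Proof.
rewrite /numbered_answer; case: (unpickle i) => [c|]; last exact: mprop_const.
exact: mprop_answer.
Qed.

Definition levels (w : Om) (i : nat) : nat := diag numbered_answer i w.

Lemma levels_ge w i : (i <= levels w i)%N.
Proof. exact: diag_ge. Qed.

Lemma levels_decided w (c : question) : decided (fun i => answer c (levels w i) w).
Proof.
have := diag_decided numbered_answer (pickle c) w.
by rewrite /numbered_answer pickleK.
Qed.

Lemma mnat_levels i : mnat (levels^~ i).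
Proof. exact: mnat_diag. Qed.

Let life w := lifetime T U F w.1 (unit_clock q T w.2) (slow q T w.2) (levels w).

Lemma mprop_lifetime t : 0 <= t <= T -> mprop (fun w : Om => life w t).
Proof.
move=> tT; apply: mprop_and; first exact: mprop_const.
apply: mprop_ex => j; apply: mprop_ex => k; apply: mprop_ex => m.
apply: mprop_and; first by apply: mprop_unit_clock_le; case/andP: tT.
apply: mprop_near => i.
apply: (mnat_prop (N := levels^~ i) (P := fun n w => answer (inr (j, k, m)) n w)).
  exact: mnat_levels.
by move=> n; exact: mprop_answer.
Qed.

Let clock_indexE w j t : OmegaT w -> clock_index j t w = fl j (unit_clock q T w.2 t).
Proof. by move=> Ow; rewrite /clock_index asboolT. Qed.

(** Each limit in the definition of the path is a limit of values of the schemes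
    at random indices, namely the levels of the subsequence and the dyadic floors
    of the clock. *)
Lemma mmx_position t : 0 <= t <= T ->
  mmx (fun w : Om => position U F w.1 (unit_clock q T w.2) (slow q T w.2) (levels w) t).
Proof.
move=> tT; apply: (mmx_on (f := fun w : Om => mx_lim (fun j =>
    lim_posn U F (slow q T w.2) w.1 (levels w) j (clock_index j t w)))).
  by move=> w Ow; congr mx_lim; apply/funext => j; rewrite clock_indexE.
apply: mmx_lim => j; apply: (mmx_natcomp (N := clock_index j t) (f := fun k (w : Om) =>
    lim_posn U F (slow q T w.2) w.1 (levels w) j k)); first exact: mnat_clock_index.
move=> k; apply: mmx_lim => i; apply: (mmx_natcomp (N := fun w : Om => levels w i) (f := fun n (w : Om) =>
    posn U F (slow q T w.2) w.1 n (refine n j k))); first exact: mnat_levels.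
by move=> n; exact: mmx_posn.
Qed.

Lemma mmx_velocity t : 0 <= t <= T ->
  mmx (fun w : Om => velocity U F w.1 (unit_clock q T w.2) (slow q T w.2) (levels w) t).
Proof.
move=> tT; apply: (mmx_on (f := fun w : Om => mx_lim (fun j =>
    lim_velo U F (slow q T w.2) w.1 (levels w) j (clock_index j t w)))).
  by move=> w Ow; congr mx_lim; apply/funext => j; rewrite clock_indexE.
apply: mmx_lim => j; apply: (mmx_natcomp (N := clock_index j t) (f := fun k (w : Om) =>
    lim_velo U F (slow q T w.2) w.1 (levels w) j k)); first exact: mnat_clock_index.
move=> k; apply: mmx_lim => i; apply: (mmx_natcomp (N := fun w : Om => levels w i) (f := fun n (w : Om) =>
    velo U F (slow q T w.2) w.1 n (refine n j k))); first exact: mnat_levels.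
by move=> n; exact: mmx_velo.
Qed.

End MeasurableConstruction.

(** * Measurable choice of maximal solutions *)

Section GeneratedMaps.
Context {S1 S2 : Type}.

(** The hypothesis says that the sets whose trace on [D] belongs to [SD] form a
    sigma-algebra, hence so do the sets whose preimage has its trace in [SD]. *)
Lemma preimage_generated (SD : set_system S1) (D : set S1) (G : set_system S2) (f : S1 -> S2) :
  sigma_algebra setT [set A | SD (A `&` D)] ->
  (forall B, G B -> SD (f @^-1` B `&` D)) ->
  forall B, <<s [set: S2], G >> B -> SD (f @^-1` B `&` D).
Proof.
move=> [s0 sC sU] GB B; suff : <<s [set: S2], G >> `<=` [set B | SD (f @^-1` B `&` D)] by exact.
apply: smallest_sub GB; split=> /=; first by rewrite preimage_set0.
  by move=> A /sC; rewrite /= setTD setTD preimage_setC.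
by move=> A /sU; rewrite /= preimage_bigcup.
Qed.

End GeneratedMaps.

Theorem theoremI1p5 (R : realType) (T : R) (d e : nat) (q gamma : R)
    (U : set 'cV[R]_e) (F : 'cV[R]_e -> set 'M[R]_(e, d))
    (T_gt0 : 0 < T) (d_ge1 : (1 <= d)%N) (e_ge1 : (1 <= e)%N)
    (q_range : 1 <= q < 2) (gamma_range : q - 1 < gamma <= 1)
    (U_open : open U) (U_convex : convex_set U)
    (F_compact : forall y, U y -> F y !=set0 /\ compact (F y))
    (F_holder : locally_holder gamma U F) :
  exists (Tstar : 'cV[R]_e * (R -> 'cV[R]_d) -> R)
         (I : 'cV[R]_e * (R -> 'cV[R]_d) -> set R)
         (z : 'cV[R]_e * (R -> 'cV[R]_d) -> R -> 'cV[R]_e)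
         (v : 'cV[R]_e * (R -> 'cV[R]_d) -> R -> 'M[R]_(e, d)),
  [/\ (forall w, Omega T q U w ->
         [/\ 0 < Tstar w <= T /\ initial_interval (Tstar w) (I w),
             solution_with_velocity T q U F w.1 w.2 (I w) (z w) (v w),
             Vplus_cadlag_loc (q / gamma) (I w) (v w),
             (I w <> `[0, T]%classic -> ~ precompact_in U (z w @` I w)) &
             maximal_solution T q U F w.1 w.2 (I w) (z w)]),
      measurable_map (Omega T q U) (Omega_sigma T q U)
        (borel_on [set: R]) Tstar &
      measurable_map (Omega T q U) (Omega_sigma T q U)
        (cylindrical `[0, T] [set: R -> 'cV[R]_e * 'M[R]_(e, d)])
        (fun w => patch (fun=> 0) (I w) (fun t => (z w t, v w t)))].
Proof.
have gamma_gt0 : 0 < gamma by case/andP: q_range => ? _; case/andP: gamma_range => + _; lra.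
have q_ge1 : 1 <= q by case/andP: q_range.
have q_le2 : q <= 2 by case/andP: q_range => _ /ltW.
pose nn := @levels R e d T q U F.
pose Phi (w : 'cV[R]_e * (R -> 'cV[R]_d)) := unit_clock q T w.2.
pose X (w : 'cV[R]_e * (R -> 'cV[R]_d)) := slow q T w.2.
pose I w := lifetime T U F w.1 (Phi w) (X w) (nn w).
pose z w := position U F w.1 (Phi w) (X w) (nn w).
pose v w := velocity U F w.1 (Phi w) (X w) (nn w).
have props w : Omega T q U w ->
    [/\ 0 < sup (I w) <= T /\ initial_interval (sup (I w)) (I w),
        solution_with_velocity T q U F w.1 w.2 (I w) (z w) (v w),
        Vplus_cadlag_loc (q / gamma) (I w) (v w) &
        (I w <> `[0, T]%classic -> ~ precompact_in U (z w @` I w))].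
  move=> [Uw [Vw cw]].
  have P0 := unit_clock0 q_ge1 T_gt0 Vw.
  have PT := unit_clockT q_ge1 T_gt0 cw Vw.
  have Plt := unit_clock_lt q_ge1 T_gt0 cw Vw.
  have Pc := unit_clock_continuous q_ge1 q_le2 T_gt0 cw Vw.
  have Xh := slow_holder q_ge1 q_le2 T_gt0 cw Vw.
  have yg := @young_time_change R e d q T w.2 q_ge1 q_le2 T_gt0 cw Vw.
  have onto s : 0 <= s -> s <= 1 -> exists2 t, 0 <= t <= T & Phi w t = s.
    move=> s0 s1; have [iT E] := clock_inv_spec q_ge1 q_le2 T_gt0 cw Vw s0.
    by exists (clock_inv q T w.2 s) => //; rewrite /Phi E (min_idPl s1).
  have H0 : 0 <= clock q w.2 T `^ q^-1 := powR_ge0 _ _.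
  have nnge := @levels_ge R e d T q U F w.
  have dp j k a b (r : rat) : decided (fun i => ratr r < sub_posn U F (X w) w.1 (nn w) j k i a b).
    exact: (@levels_decided R e d T q U F w (inl (inl (j, k, (a, b), r)))).
  have dv j k a b (r : rat) : decided (fun i => ratr r < sub_velo U F (X w) w.1 (nn w) j k i a b).
    exact: (@levels_decided R e d T q U F w (inl (inr (j, k, (a, b), r)))).
  split.
  - split.
      exact: (lifetime_sup T_gt0 q_range gamma_range H0 U_open F_compact F_holder Uw P0 Plt Pc Xh nnge dp).
    exact: (lifetime_initial F (X w) (nn w) T_gt0 U_open Uw P0 Plt).
  - exact: (local_solution T_gt0 q_range gamma_range H0 U_open F_compact F_holder Uw P0 Plt Pc Xh yg nnge dp dv).
  - exact: (velocity_Vplus T_gt0 q_range gamma_range H0 U_open F_compact F_holder Uw P0 Plt Pc Xh nnge dp dv).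
  - exact: (lifetime_not_precompact T_gt0 q_range gamma_range H0 U_open F_compact F_holder Uw P0 PT Plt Xh onto nnge dp dv).
exists (fun w => sup (I w)), I, z, v; split.
- move=> w Ow; have [h1 h2 h3 h4] := props w Ow; split=> //.
  have [/andP[s0 sT] iI] := h1.
  apply: (@not_precompact_maximal _ _ _ _ _ _ _ _ _ _ _ (sup (I w))) => //.
    by rewrite sT ltW.
  by exists (v w).
- have mT : mreal (fun w : data T q U => sup (I w)).
    apply: mreal_gt => c.
    (* an initial interval reaches beyond [c] iff it has a rational point beyond [c] *)
    apply: (mprop_on (P := fun w : data T q U => c < 0 \/
      exists r : rat, (c < ratr r /\ 0 <= (ratr r : R) <= T) /\ I w (ratr r))
      (Q := fun w : data T q U => c < sup (I w))).
      move=> w Ow; have [[/andP[s0 sT] iI] _ _ _] := props w Ow.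
      have ubI : has_ubound (I w) by exists T => t [/andP[]].
      split=> [[c0|[r [[cr rT] Ir]]]|cs].
      + exact: lt_trans c0 s0.
      + by apply: lt_le_trans cr _; apply: ub_le_sup.
      have [c0|c0] := ltP c 0; [by left|right].
      have [r] := rat_in_itvoo cs; rewrite in_itv /= => /andP[cr rs].
      have r0 : 0 <= ratr r :> R by apply: le_trans c0 (ltW cr).
      exists r; split; first by rewrite r0 cr (le_trans (ltW rs)).
      by case: iI => ->; rewrite /= in_itv /= r0 // ltW.
    apply: mprop_or; first exact: mprop_const.
    apply: mprop_ex_count => r.
    have [rT|nrT] := pselect (0 <= (ratr r : R) <= T); last first.
      by apply: (@eq_mprop _ _ (fun=> False)) (mprop_const False) => w; split=> // -[[]].
    apply: mprop_and; first exact: mprop_const.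
    exact: (mprop_lifetime T_gt0 q_range gamma_gt0 U_open F_holder rT).
  move=> _ [B mB <-]; rewrite setIC.
  apply: (preimage_generated (trace_sigma_algebra T q U) _ mB) => C [G oG <-].
  rewrite setTI; have mG : measurable G by exact: open_measurable.
  have [mP _] := mprop_trace (fun w : data T q U => G (sup (I w))).
  by apply: mP; have := mT measurableT _ mG; rewrite setTI.
- move=> _ [B mB <-]; rewrite setIC.
  apply: (preimage_generated (trace_sigma_algebra T q U) _ mB) => C [t tT [C' mC' <-]].
  rewrite setTI -[X in X `&` _]/((fun w => patch (fun=> 0) (I w) (fun t0 => (z w t0, v w t0)) t) @^-1` C').
  apply: (preimage_generated (trace_sigma_algebra T q U) _ mC') => C'' [G oG <-].
  rewrite setTI; have {}tT : 0 <= t <= T by move: tT; rewrite /= in_itv.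
  have [mP _] := mprop_trace (fun w : data T q U =>
    G (patch (fun=> 0) (I w) (fun t0 => (z w t0, v w t0)) t)).
  apply: mP.
  apply: (@eq_mprop _ _ (fun w : data T q U => (I w t /\ G (z w t, v w t)) \/ (~ I w t /\ G 0))).
    move=> w; have [It|nIt] := pselect (I w t).
      by rewrite /patch mem_set//; split=> [[[]|[]]|h] //; left.
    by rewrite /patch memNset//; split=> [[[]|[]]|h] //; right.
  apply: mprop_or.
    apply: mprop_and; first exact: (mprop_lifetime T_gt0 q_range gamma_gt0 U_open F_holder tT).
    by apply: mprop_open2 => //; [exact: (mmx_position T_gt0 q_range gamma_gt0 U_open F_holder tT)|exact: (mmx_velocity T_gt0 q_range gamma_gt0 U_open F_holder tT)].
  apply: mprop_and; last exact: mprop_const.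
  by apply: mprop_not; exact: (mprop_lifetime T_gt0 q_range gamma_gt0 U_open F_holder tT).
Qed.
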